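(* Assume that: (Moment) there exists $\eta\in(0,1)$ with $\mathbb{E}[N(g_1)^\eta]<+\infty$; (Column comparability) for any $1\leq j\leq d$ there exists a constant $C>1$ such that for any $g=(g^{i,j})_{1\leq i,j\leq d}\in\operatorname{supp}\mu$, $1\leq\frac{\max_{1\leq i\leq d}g^{i,j}}{\min_{1\leq i\leq d}g^{i,j}}\leq C$; (Variance) $\sigma^2>0$. Let $\gamma>0$ be a fixed small enough constant. Then: (1) There exists a constant $C>0$ such that for all $n\geq1$ and $\varphi\in\mathcal{B}_\gamma$, $$\sup_{y\in\mathbb{R}}\ \sup_{f,x\in\mathbb{S}_+^{d-1}}\left|\mathbb{E}\left[\varphi(X_n^x)\,\mathbf{1}_{\left\{\frac{\log\langle f,G_nx\rangle-n\lambda}{\sigma\sqrt{n}}\leq y\right\}}\right]-\nu(\varphi)\Phi(y)\right|\leq\frac{C}{\sqrt{n}}\|\varphi\|_\gamma .$$ (2) For any compact set $K\subset(\mathbb{S}_+^{d-1})^\circ$, there exists a constant $C>0$ such that for all $n\geq1$ and $\varphi\in\mathcal{B}_\gamma$, $$\sup_{y\in\mathbb{R}}\ \sup_{x\in K}\left|\mathbb{E}\left[\varphi(X_n^x)\,\mathbf{1}_{\left\{\frac{\log\rho(G_n)-n\lambda}{\sigma\sqrt{n}}\leq y\right\}}\right]-\nu(\varphi)\Phi(y)\right|\leq\frac{C}{\sqrt{n}}\|\varphi\|_\gamma .$$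
   Context: Fix an integer $d\geq 2$. $\mathcal{M}_+$ is the multiplicative semigroup of $d\times d$ matrices with non-negative real entries. A matrix $g\in\mathcal{M}_+$ is allowable if every row and every column of $g$ contains a strictly positive entry. $\mathbb{R}^d$ carries the standard scalar product $\langle\cdot,\cdot\rangle$ and Euclidean norm $|\cdot|$; $x\geq 0$ (resp. $x>0$) means that all components are non-negative (resp. strictly positive). $\mathbb{S}_+^{d-1}=\{x\geq 0:|x|=1\}$ and $(\mathbb{S}_+^{d-1})^\circ=\{x>0:|x|=1\}$. Hilbert cross-ratio metric on $\mathbb{S}_+^{d-1}$: $\mathbf{d}(x,y)=\frac{1-m(x,y)m(y,x)}{1+m(x,y)m(y,x)}$, where $m(x,y)=\sup\{\alpha>0:\alpha y_i\leq x_i\ \forall i=1,\dots,d\}$ (with $\sup\emptyset=0$). $\mathcal{C}(\mathbb{S}_+^{d-1})$ is the space of continuous complex-valued functions on $\mathbb{S}_+^{d-1}$. For a fixed small enough constant $\gamma>0$, $\|\varphi\|_\gamma=\sup_{x}|\varphi(x)|+\sup_{x\neq y}\frac{|\varphi(x)-\varphi(y)|}{\mathbf{d}^\gamma(x,y)}$ and $\mathcal{B}_\gamma=\{\varphi\in\mathcal{C}(\mathbb{S}_+^{d-1}):\|\varphi\|_\gamma<+\infty\}$. $(g_n)_{n\geq1}$ is a sequence of i.i.d. random matrices with law $\mu$ on $\mathcal{M}_+$, $\operatorname{supp}\mu$ is the support of $\mu$, $G_n=g_n\cdots g_1$. $\|g\|=\sup_{x\in\mathbb{S}_+^{d-1}}|gx|$,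 $\iota(g)=\inf_{x\in\mathbb{S}_+^{d-1}}|gx|$, $N(g)=\max\{\|g\|,\iota(g)^{-1}\}$; $\rho(g)$ is the spectral radius of $g$. For $x\in\mathbb{S}_+^{d-1}$ and $g$ allowable, $g\cdot x=gx/|gx|$; $X_0^x=x$, $X_n^x=G_n\cdot x$. Under the assumptions the Markov chain $(X_n^x)_{n\geq 0}$ has a unique stationary probability measure $\nu$ on $\mathbb{S}_+^{d-1}$, i.e. $\int\int\varphi(g\cdot x)\,\mu(dg)\,\nu(dx)=\int\varphi\,d\nu$ for all $\varphi\in\mathcal{C}(\mathbb{S}_+^{d-1})$; $\nu(\varphi)=\int\varphi\,d\nu$. The upper Lyapunov exponent is the constant $\lambda=\lim_{n\to\infty}\frac1n\log\|G_n\|$ a.s., and $\sigma^2=\lim_{n\to\infty}\frac1n\mathbb{E}[(\log|G_nx|-n\lambda)^2]\in[0,\infty)$, a limit that exists uniformly in $x\in\mathbb{S}_+^{d-1}$ and does not depend on $x$. $\Phi(y)=\frac1{\sqrt{2\pi}}\int_{-\infty}^y e^{-t^2/2}dt$. *)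

(* Defs.v *)
From HB Require Import structures.
From mathcomp Require Import all_boot all_order all_algebra finmap.
From mathcomp Require Import all_classical all_reals all_analysis.
From mathcomp Require Import complex.

Set Implicit Arguments.
Unset Strict Implicit.
Unset Printing Implicit Defensive.

Import Order.TTheory GRing.Theory Num.Theory.
Import numFieldNormedType.Exports ComplexField.Normc.

Local Open Scope classical_set_scope.
Local Open Scope ring_scope.
Local Open Scope complex_scope.

(* T with its Borel sigma-algebra (convertible to T). *)
Definition borel (T : ptopologicalType) := g_sigma_algebraType (@open T).

Section Geometry.
Context {R : realType} {d : nat}.
Implicit Types (x y : 'cV[R]_d) (g : 'M[R]_d).

Definition dotv (x y : 'cV[R]_d) : R := \sum_(i < d) x i 0 * y i 0.

(* The Euclidean norm; the library's `|x| on matrices is the sup norm. *)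
Definition enorm x : R := Num.sqrt (dotv x x).

Definition nonneg_mx : set 'M[R]_d := [set g : 'M[R]_d | forall i j, 0 <= g i j].

Definition sphere_pos : set 'cV[R]_d :=
  [set x : 'cV[R]_d | (forall i, 0 <= x i 0) /\ enorm x = 1].

Definition sphere_pos_int : set 'cV[R]_d :=
  [set x : 'cV[R]_d | (forall i, 0 < x i 0) /\ enorm x = 1].

(* On the sphere the set below is bounded; sup set0 = 0. *)
Definition ratio_sup x y : R :=
  sup [set a : R | 0 < a /\ forall i, a * y i 0 <= x i 0].

Definition hilbert_dist x y : R :=
  (1 - ratio_sup x y * ratio_sup y x) / (1 + ratio_sup x y * ratio_sup y x).

Definition mx_norm_pos g : R := sup [set enorm (g *m x) | x in sphere_pos].

Definition mx_iota g : R := inf [set enorm (g *m x) | x in sphere_pos].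

(* When mx_iota g = 0 (so g is not allowable) the second term is 0 instead of
   +oo. *)
Definition mx_N g : R := Num.max (mx_norm_pos g) (mx_iota g)^-1.

(* Only meaningful when g *m x != 0, e.g. g allowable and x in sphere_pos. *)
Definition act g x : 'cV[R]_d := (enorm (g *m x))^-1 *: (g *m x).

Definition spectral_radius g : R :=
  sup [set normc z | z in
         [set z : R[i] | eigenvalue (map_mx (real_complex R) g) z]].

(* For g in nonneg_mx these are the largest and smallest entries of column j:
   0 bounds the entries from below, col_max from above. Since a / 0 = 0, the
   condition 1 <= col_max g j / col_min g j forces col_min g j > 0. *)
Definition col_max g (j : 'I_d) : R := \big[Num.max/0]_(i < d) g i j.
Definition col_min g (j : 'I_d) : R := \big[Num.min/col_max g j]_(i < d) g i j.

(* g (n-1) *m ... *m g 0, the new factor on the left. *)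
Fixpoint rprod (g : nat -> 'M[R]_d) (n : nat) : 'M[R]_d :=
  if n is m.+1 then g m *m rprod g m else 1%:M.

End Geometry.

Section Integration.
Context {R : realType}.

Definition cintegral disp (T : measurableType disp)
    (mu : {measure set T -> \bar R}) (D : set T) (h : T -> R[i]) : R[i] :=
  (\int[mu]_(x in D) complex.Re (h x)) +i* (\int[mu]_(x in D) complex.Im (h x)).

Definition Phi (y : R) : R :=
  (Num.sqrt (2 * pi))^-1 *
  \int[lebesgue_measure]_(t in `]-oo, y]) expR (- (t ^+ 2 / 2)).

Definition msupport (T : ptopologicalType)
    (mu : {measure set (borel T) -> \bar R}) : set T :=
  [set x | forall U : set T, open U -> U x -> (0 < mu U)%E].

Definition iid disp (Omega : measurableType disp) (P : probability Omega R)
    disp' (T : measurableType disp') (mu : probability T R)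
    (g : nat -> {RV P >-> T}) : Prop :=
  (forall n (A : set T), measurable A -> P (g n @^-1` A) = mu A) /\
  (forall (J : {fset nat}) (A : nat -> set T),
     (forall k, measurable (A k)) ->
     P (\bigcap_(k in [set` J]) (g k @^-1` A k)) =
     (\prod_(k <- J) P (g k @^-1` A k))%E).

End Integration.

Section Holder.
Context {R : realType} {d : nat}.

(* Only the values of h on sphere_pos matter. R[i]^o is R[i] with its usual
   topology. *)
Definition continuous_on_sphere (h : 'cV[R]_d -> R[i]^o) : Prop :=
  {within sphere_pos, continuous h}.

Definition holder_norm (gamma : R) (h : 'cV[R]_d -> R[i]) : \bar R :=
  (ereal_sup [set (normc (h x))%:E | x in sphere_pos] +
   ereal_sup [set (normc (h xy.1 - h xy.2)
                     / (hilbert_dist xy.1 xy.2 `^ gamma))%:E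
             | xy in [set xy : 'cV[R]_d * 'cV[R]_d |
                        [/\ sphere_pos xy.1, sphere_pos xy.2
                          & xy.1 <> xy.2]]])%E.

Definition holder_space (gamma : R) : set ('cV[R]_d -> R[i]) :=
  [set h | continuous_on_sphere h /\ (holder_norm gamma h < +oo)%E].

(* nu is a measure on sphere_pos, encoded as a Borel measure on R^d that it
   carries. *)
Definition stationary (mu : probability (borel 'M[R]_d) R)
    (nu : probability (borel 'cV[R]_d) R) : Prop :=
  nu sphere_pos = 1%E /\
  forall h : 'cV[R]_d -> R[i], continuous_on_sphere h ->
    cintegral nu sphere_pos
      (fun x => cintegral mu nonneg_mx (fun g => h (act g x)))
    = cintegral nu sphere_pos h.

End Holder.

(* Main.v *)
Require Import Defs.
From HB Require Import structures.
From mathcomp Require Import all_boot all_order all_algebra finmap.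
From mathcomp Require Import all_classical all_reals all_analysis.
From mathcomp Require Import measurable_realfun complex.
From mathcomp Require Import ring lra zify.

(** The logarithm of the size of G_n x is an additive cocycle over the chain of
    directions of G_n x.  Comparability of the columns forces every matrix of
    the support to send the cone into the vectors with comparable entries
    (core_mul), and there the matrices contract a projective distance by a
    fixed rate (pd_contract).  The increments of the cocycle depend on the
    direction in a Lipschitz way (slog_lip), and the moment assumption gives
    them eight moments (lsize_integrable).  This reduces the theorem to
    contracting_cocycle_clt, a statement on cocycles over contracting random
    iterations, applied to the sum of the entries in place of the Euclidean
    norm.

    That statement is proved by Lindeberg's method.  Let U be the heat evolution
    of the indicator of a half-line.  Solutions of three Poisson equations
    (correctors) modify U by terms depending on the direction, so that one step
    of the walk has the same effect as an increase of the time of U by the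
    variance sg2, up to the fourth order (corr_step).  Summing over the steps
    (lindeberg) compares the law of the cocycle, smoothed at a scale L, with the
    Gaussian law; the error involves the probabilities that the cocycle lies in
    a window of length L at earlier times.  Such probabilities are themselves
    controlled by the smoothed estimate, in which the constant for earlier times
    comes back divided by L.  For L large an induction on n closes, and windows
    have probability at most A / sqrt n (concentration).  Removing the smoothing
    costs one more window, hence an error of order 1 / sqrt n (clt).

    A Holder function minus its stationary mean has averages that decay
    geometrically under the transfer operator, because the distance is
    contracted (psi_decay).  Its correlation with a half-line event at time n
    telescopes over the last steps: averaging j of them leaves a factor q ^ j
    times the probability that the cocycle is near the threshold (target).

    The constants lambda and sigma2 of the statement are recognised from the
    growth of second moments (variance_identified).  Finally the coefficients
    and the spectral radius of G_n differ from the sum of the entries of G_n x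
    by bounded factors (ln_dotv, ln_spectral_radius), so that each event in the
    theorem lies between two half-line events of the walk whose thresholds
    differ by a constant, and concentration pays for the difference (sandwich,
    real_estimate). *)

Set Implicit Arguments.
Unset Strict Implicit.
Unset Printing Implicit Defensive.

Import Order.TTheory GRing.Theory Num.Theory.
Import numFieldNormedType.Exports ComplexField.Normc.

Local Open Scope classical_set_scope.
Local Open Scope ring_scope.

(** * Gaussian density, its derivatives and its distribution function *)

Section GaussKernel.
Context {R : realType}.
Implicit Types (y z s t tau : R) (j p : nat).

Definition gdens z : R := (Num.sqrt (2 * pi))^-1 * expR (- (z ^+ 2 / 2)).

(** The derivatives of gdens, through the recursion of Hermite polynomials. *)
Fixpoint gder j z : R :=
  if j is j'.+1 then
    - (z * gder j' z + (if j' is j''.+1 then j'%:R * gder j'' z else 0))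
  else gdens z.

Lemma sqrt2pi_gt0 : 0 < Num.sqrt (2 * pi : R).
Proof. by rewrite sqrtr_gt0 mulr_gt0 ?pi_gt0. Qed.

Lemma is_derive_gdens z : is_derive z 1 gdens (gder 1 z).
Proof.
have h : is_derive z 1 (fun z : R => - (z ^+ 2 / 2)) (- z).
  have -> : (fun z : R => - (z ^+ 2 / 2)) = (- 2^-1 : R) *: (id ^+ 2 : R -> R).
    by apply/funext => u; rewrite !fctE /GRing.scale/=; ring.
  apply: (is_derive_eq (is_deriveZ _ (is_deriveX 2 (is_derive_id z 1)))).
  by rewrite /GRing.scale /= expr1; field.
have h2 := is_derive1_comp (is_derive_expR _) h.
have -> : gdens = (Num.sqrt (2 * pi))^-1 *: (expR \o (fun z : R => - (z ^+ 2 / 2))).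
  by apply/funext => u.
apply: (is_derive_eq (is_deriveZ _ h2)); rewrite /GRing.scale /= /gdens; ring.
Qed.

Lemma is_derive_gder j z : is_derive z 1 (gder j) (gder j.+1 z).
Proof.
suff [] : is_derive z 1 (gder j) (gder j.+1 z) /\
          is_derive z 1 (gder j.+1) (gder j.+2 z) by [].
elim: j => [|j [ih1 ih2]].
  split; first exact: is_derive_gdens.
  have hd := is_derive_gdens z.
  have -> : gder 1 = - ((id : R -> R) * gdens).
    by apply/funext => u /=; rewrite addr0.
  apply: (is_derive_eq (is_deriveN (is_deriveM (is_derive_id z 1) hd))).
  by rewrite /GRing.scale /=; ring.
split=> //.
have -> : gder j.+2 = - ((id : R -> R) * gder j.+1 + j.+1%:R *: gder j).
  by apply/funext => u.
apply: (is_derive_eq (is_deriveN (is_deriveD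
  (is_deriveM (is_derive_id z 1) ih2) (is_deriveZ _ ih1)))).
rewrite /GRing.scale /= -[j.+2%:R]natr1; ring.
Qed.

Lemma gdens_ge0 z : 0 <= gdens z.
Proof. by rewrite mulr_ge0 ?invr_ge0 ?sqrtr_ge0 ?expR_ge0. Qed.

(** The exponential series dominates each of its terms. *)
Lemma gdens_moment p : exists2 C : R, 0 < C & forall z, `|z| ^+ p * gdens z <= C.
Proof.
pose S := (Num.sqrt (2 * pi : R))^-1.
have S0 : 0 < S by rewrite invr_gt0 sqrt2pi_gt0.
have p0 : 0 <= 2 ^+ p.+1 * p.+1`!%:R :> R by rewrite mulr_ge0.
exists (S * (1 + 2 ^+ p.+1 * p.+1`!%:R)); first by rewrite mulr_gt0 // ltr_pwDl.
move=> z; rewrite /gdens -/S mulrCA ler_wpM2l ?(ltW S0)//.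
have h0 : 0 <= z ^+ 2 / 2 by rewrite divr_ge0 // sqr_ge0.
have := expR_ge1Dxn p h0; set E := expR (z ^+ 2 / 2) => hE.
have E0 : 0 < E by exact: expR_gt0.
have F0 : 0 < p.+1`!%:R :> R by rewrite ltr0n fact_gt0.
rewrite expRN -/E ler_pdivrMr //.
have hz : `|z| ^+ p <= 1 + `|z| ^+ (2 * p.+1).
  have [z1|z1] := leP `|z| 1.
    by rewrite (le_trans (exprn_ile1 _ _ z1)) ?lerDl ?exprn_ge0.
  have : `|z| ^+ p <= `|z| ^+ (2 * p.+1).
    by apply: ler_weXn2l; [exact: ltW | rewrite mul2n -addnn addSn (leq_trans (leq_addr p.+1 p)) // leqnSn].
  by move=> h; apply: le_trans h _; rewrite lerDr.
apply: (le_trans hz); rewrite exprM real_normK ?num_real //.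
have hE2 : (z ^+ 2) ^+ p.+1 <= 2 ^+ p.+1 * p.+1`!%:R * E.
  have h3 : (z ^+ 2 / 2) ^+ p.+1 / p.+1`!%:R <= E by apply: le_trans hE; lra.
  move: h3; rewrite ler_pdivrMr // expr_div_n ler_pdivrMr ?exprn_gt0 // => h3.
  by apply: le_trans h3 _; lra.
have E1 : 1 <= E by apply: le_trans hE; rewrite lerDl divr_ge0 // exprn_ge0.
by rewrite mulrDl mul1r lerD.
Qed.

Lemma gder_moment j p : exists2 C : R, 0 < C & forall z, `|z| ^+ p * `|gder j z| <= C.
Proof.
suff [] : (forall p, exists2 C : R, 0 < C & forall z, `|z| ^+ p * `|gder j z| <= C) /\
  (forall p, exists2 C : R, 0 < C & forall z, `|z| ^+ p * `|gder j.+1 z| <= C) by [].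
elim: j {p} => [|j [ih1 ih2]].
  have h p : exists2 C : R, 0 < C & forall z, `|z| ^+ p * `|gder 0 z| <= C.
    have [C C0 hC] := gdens_moment p; exists C => // z.
    by rewrite /= (ger0_norm (gdens_ge0 z)) hC.
  split=> // p; have [C C0 hC] := h p.+1; exists C => // z.
  have := hC z; rewrite exprSr -mulrA; apply: le_trans.
  by rewrite /= addr0 normrN (normrM z).
split=> // p; have [C C0 hC] := ih2 p.+1; have [C' C0' hC'] := ih1 p.
exists (C + j.+1%:R * C'); first by rewrite ltr_wpDr // mulr_ge0 // ltW.
move=> z; rewrite -/(gder j.+1 z).
have -> : gder j.+2 z = - (z * gder j.+1 z + j.+1%:R * gder j z) by [].
rewrite normrN.
apply: le_trans (ler_wpM2l _ (ler_normD _ _)) _; first exact: exprn_ge0.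
rewrite mulrDr; apply: lerD; first by have := hC z; rewrite normrM exprSr mulrA.
by rewrite normrM normr_nat mulrCA ler_wpM2l.
Qed.

(** A weight that dominates all the derivatives of gdens and that, unlike
    gdens, changes at most by a polynomial factor when its argument is shifted. *)
Definition env z : R := (1 + z ^+ 2)^-1.

Lemma env_gt0 z : 0 < env z.
Proof. by rewrite invr_gt0 ltr_pwDl // sqr_ge0. Qed.

Lemma env_ge0 z : 0 <= env z. Proof. exact: ltW (env_gt0 z). Qed.

Lemma env_le1 z : env z <= 1.
Proof. by rewrite invf_le1 ?lerDl ?sqr_ge0 // ltr_pwDl // sqr_ge0. Qed.

Lemma env_decr s t : `|s| <= `|t| -> env t <= env s.
Proof.
move=> st; rewrite lef_pV2 ?posrE ?ltr_pwDl ?sqr_ge0 // lerD2l.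
by rewrite -[s ^+ 2]real_normK ?num_real // -[t ^+ 2]real_normK ?num_real // lerXn2r ?nnegrE.
Qed.

Lemma env_shift z w : env (z + w) <= 2 * (1 + w ^+ 2) * env z.
Proof.
have h1 : 0 < 1 + (z + w) ^+ 2 by rewrite ltr_pwDl // sqr_ge0.
have h2 : 0 < 1 + z ^+ 2 by rewrite ltr_pwDl // sqr_ge0.
rewrite /env ler_pdivlMr // mulrC ler_pdivrMr //.
have := sqr_ge0 (z + 2 * w); have := sqr_ge0 (w * (z + w)); nra.
Qed.

Lemma gder_env j : exists2 C : R, 0 < C & forall z, `|gder j z| <= C * env z.
Proof.
have [C C0 hC] := gder_moment j 0; have [D D0 hD] := gder_moment j 2.
exists (C + D); first exact: addr_gt0.
move=> z; rewrite /env ler_pdivlMr ?ltr_pwDl ?sqr_ge0 //.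
have := hC z; have := hD z; rewrite expr0 real_normK ?num_real // mul1r; lra.
Qed.

Lemma gdens_lb z : `|z| <= 2 -> gdens 2 <= gdens z.
Proof.
move=> z2; rewrite ler_wpM2l ?invr_ge0 ?sqrtr_ge0 // ler_expR lerN2.
by rewrite ler_wpM2r // -[z ^+ 2]real_normK ?num_real // lerXn2r ?nnegrE.
Qed.

Lemma gdens_gt0 z : 0 < gdens z.
Proof. by rewrite mulr_gt0 ?expR_gt0 ?invr_gt0 ?sqrt2pi_gt0. Qed.

Local Notation mu := (@lebesgue_measure R).

Lemma gdens_pdf : gdens = normal_pdf 0 1.
Proof.
apply/funext => z; rewrite normal_pdfE ?oner_eq0 // /normal_peak /normal_fun /gdens.
rewrite subr0 expr1n mul1r mulr_natl; congr (_ * expR _).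
by rewrite mulNr.
Qed.

Lemma integrable_gdens D : measurable D -> mu.-integrable D (EFin \o gdens).
Proof.
move=> mD; apply: (@integrableS _ _ _ _ setT) => //; rewrite gdens_pdf.
exact: integrable_normal_pdf.
Qed.

Lemma Rintegral_gdens : \int[mu]_z gdens z = 1.
Proof. by rewrite gdens_pdf /Rintegral integral_normal_pdf. Qed.

Lemma PhiE y : Phi y = \int[mu]_(t in `]-oo, y]) gdens t.
Proof.
rewrite /gdens RintegralZl //.
have : mu.-integrable `]-oo, y] (fun x => (Num.sqrt (2 * pi))%:E * (EFin \o gdens) x)%E.
  by apply: integrableZl => //; exact: integrable_gdens.
apply: eq_integrable => //= x _.
by rewrite /gdens -EFinM mulrA mulfV ?mul1r // gt_eqF ?sqrt2pi_gt0.
Qed.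

Lemma is_derive_Phi y : is_derive y 1 (@Phi R) (gdens y).
Proof.
have hy : y < y + 1 by rewrite ltrDl.
have [] := @continuous_FTC1 R gdens -oo%O y (y + 1) hy.
- exact: integrable_gdens (measurable_itv _).
- by rewrite ltNyr.
- by apply/differentiable_continuous/derivable1_diffP; case: (is_derive_gdens y).
move=> h1 h2; have -> : @Phi R = fun x => \int[mu]_(t in `]-oo, x]) gdens t.
  by apply/funext => x; rewrite PhiE.
by apply: DeriveDef => //; rewrite -derive1E h2.
Qed.

Lemma Phi_ge0 y : 0 <= @Phi R y.
Proof. by rewrite PhiE Rintegral_ge0 // => x _; exact: gdens_ge0. Qed.

Lemma Phi_compl y : 1 - Phi y = \int[mu]_(t in `]y, +oo[) gdens t.
Proof.
rewrite PhiE -Rintegral_gdens -[X in \int[_]_(_ in X) _ - _](setUCr `]-oo, y]%classic).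
rewrite setCitvl Rintegral_setU //=.
- by rewrite addrC addKr.
- by apply: integrable_gdens; exact: measurableU.
- by rewrite -setCitvl disj_set2E setICr eqxx.
Qed.

Lemma Phi_le1 y : @Phi R y <= 1.
Proof. by rewrite -subr_ge0 Phi_compl Rintegral_ge0 // => x _; exact: gdens_ge0. Qed.

End GaussKernel.

(** * Taylor bounds and the heat kernel of a half-line *)

Section Taylor.
Context {R : realType}.

Lemma taylor01 (D : nat -> R -> R) (M : R) (k : nat) :
  (forall i (t : R), 0 <= t <= 1 -> is_derive t 1 (D i) (D i.+1 t)) ->
  (forall t, 0 <= t <= 1 -> `|D k t| <= M) ->
  forall b, 0 <= b <= 1 ->
    `|D 0%N b - \sum_(i < k) D i 0 * b ^+ i / i`!%:R| <= M * b ^+ k.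
Proof.
elim: k D => [|k ih] D hD hM b b01.
  by rewrite big_ord0 subr0 expr0 mulr1 hM.
have {}ih := ih (fun i => D i.+1) (fun i => hD i.+1) hM.
pose g x := D 0%N x - \sum_(i < k.+1) D i 0 * x ^+ i / i`!%:R.
pose dg x := D 1%N x - \sum_(i < k) D i.+1 0 * x ^+ i / i`!%:R.
have dgP (x : R) : 0 <= x <= 1 -> is_derive x 1 g (dg x).
  move=> x01.
  have -> : g = D 0%N - \sum_(i < k.+1) ((D i 0 / i`!%:R) *: (id ^+ i : R -> R)).
    apply/funext => u; rewrite /g !fctE /=; congr (_ - _).
    rewrite fct_sumE; apply: eq_bigr => i _.
    by rewrite !fctE /GRing.scale /= mulrAC.
  apply: (is_derive_eq (is_deriveB (hD 0%N x x01)
    (is_derive_sum (fun i : 'I_k.+1 => is_deriveZ (D i 0 / i`!%:R)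
       (is_deriveX i (is_derive_id x 1)))))).
  rewrite /dg big_ord_recl /= mul0r !(scale0r,scaler0) add0r; congr (_ - _).
  apply: eq_bigr => i _; rewrite /GRing.scale /= mulr1 factS natrM.
  have i0 : (i.+1)%:R != 0 :> R by rewrite pnatr_eq0.
  have i1 : (i`!)%:R != 0 :> R by rewrite pnatr_eq0 -lt0n fact_gt0.
  rewrite /bump leq0n add1n add0n; field.
  by rewrite nat1r i0 i1.
have g0 : g 0 = 0.
  rewrite /g big_ord_recl /= expr0 mulr1 divr1 big1 ?addr0 ?subrr // => i _.
  by rewrite /bump /= add1n expr0n /= mulr0 mul0r.
have /andP[b0 b1] := b01.
have [||c cab] := @MVT_segment _ g dg 0 b b0.
- move=> x; rewrite in_itv /= => /andP[x0 xb]; apply: dgP.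
  by rewrite (ltW x0) (le_trans (ltW xb)).
- apply: derivable_within_continuous => x; rewrite in_itv /= => /andP[x0 xb].
  by have [] : is_derive x 1 g (dg x) by apply: dgP; rewrite x0 (le_trans xb).
rewrite g0 !subr0 -/(g b) => ->.
move: cab; rewrite in_itv /= => /andP[c0 cb].
have c01 : 0 <= c <= 1 by rewrite c0 (le_trans cb).
rewrite normrM (ger0_norm b0) exprSr mulrA ler_wpM2r //.
apply: le_trans (ih c c01) _; apply: ler_wpM2l.
  by apply: le_trans (hM 0 _); rewrite ?normr_ge0 // lexx ler01.
by rewrite lerXn2r ?nnegrE.
Qed.

(** taylor01 along the segment from a to a + h. *)
Lemma taylor (F : nat -> R -> R) (a h M : R) (k : nat) :
  (forall i (t : R), 0 <= t <= 1 -> is_derive (a + t * h) 1 (F i) (F i.+1 (a + t * h))) ->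
  (forall t, 0 <= t <= 1 -> `|F k (a + t * h)| <= M) ->
  `|F 0%N (a + h) - \sum_(i < k) F i a * h ^+ i / i`!%:R| <= M * `|h| ^+ k.
Proof.
move=> hF hM.
have hD i (t : R) : 0 <= t <= 1 ->
    is_derive t 1 (fun t => F i (a + t * h) * h ^+ i) (F i.+1 (a + t * h) * h ^+ i.+1).
  move=> t01.
  have hl : is_derive t 1 (fun t : R => a + t * h) h.
    have -> : (fun t : R => a + t * h) = cst a + h *: (id : R -> R).
      by apply/funext => u; rewrite !fctE /GRing.scale /= mulrC.
    apply: (is_derive_eq (is_deriveD (is_derive_cst a t 1) (is_deriveZ h (is_derive_id t 1)))).
    by rewrite add0r /GRing.scale /= mulr1.
  have hc := @is_derive1_comp R (F i) (fun t => a + t * h) t _ _ (hF i t t01) hl.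
  have -> : (fun t => F i (a + t * h) * h ^+ i) =
            (h ^+ i) *: (F i \o (fun t : R => a + t * h)).
    by apply/funext => u; rewrite !fctE /GRing.scale /= mulrC.
  by apply: (is_derive_eq (is_deriveZ _ hc)); rewrite /GRing.scale /= exprS; ring.
have := @taylor01 (fun i t => F i (a + t * h) * h ^+ i) (M * `|h| ^+ k) k hD _ 1.
rewrite ler01 lexx => /(_ _ isT); rewrite expr1n mulr1 mul1r mulr1 mul0r addr0.
under eq_bigr do rewrite expr1n mulr1.
apply=> t t01; rewrite normrM normrX; apply: ler_wpM2r; last exact: hM.
exact: exprn_ge0.
Qed.

Lemma mean_value (f df : R -> R) (a h M : R) :
  (forall t : R, 0 <= t <= 1 -> is_derive (a + t * h) 1 f (df (a + t * h))) ->
  (forall t, 0 <= t <= 1 -> `|df (a + t * h)| <= M) ->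
  `|f (a + h) - f a| <= M * `|h|.
Proof.
move=> hf hM.
have hl (t : R) : is_derive t 1 (fun t : R => a + t * h) h.
  have -> : (fun t : R => a + t * h) = cst a + h *: (id : R -> R).
    by apply/funext => u; rewrite !fctE /GRing.scale /= mulrC.
  apply: (is_derive_eq (is_deriveD (is_derive_cst a t 1) (is_deriveZ h (is_derive_id t 1)))).
  by rewrite add0r /GRing.scale /= mulr1.
have hc (t : R) (t01 : 0 <= t <= 1) :=
  @is_derive1_comp R f (fun t => a + t * h) t _ _ (hf t t01) (hl t).
have [||c] := @MVT_segment _ (f \o (fun t : R => a + t * h)) (fun t => df (a + t * h) * h) 0 1 ler01.
- move=> x; rewrite in_itv /= => /andP[x0 xb]; apply: hc.
  by rewrite (ltW x0) (ltW xb).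
- apply: derivable_within_continuous => x; rewrite in_itv /= => x01.
  by have [] := hc x x01.
rewrite in_itv /= => c01; rewrite mul1r mul0r addr0 subr0 mulr1 => ->.
by rewrite normrM ler_wpM2r // hM.
Qed.

End Taylor.

Section PhiBounds.
Context {R : realType}.
Implicit Types y z s t tau : R.
Local Notation mu := (@lebesgue_measure R).

Lemma gdens_le1 z : gdens z <= 1.
Proof.
rewrite /gdens mulrC ler_pdivrMr ?sqrt2pi_gt0 // mul1r.
apply: (@le_trans _ _ 1).
  by rewrite -expR0 ler_expR oppr_le0 divr_ge0 // sqr_ge0.
rewrite -[X in X <= _]sqrtr1 ler_wsqrtr //.
by have := pi_ge2 R; lra.
Qed.

Lemma Phi_lipschitz y z : `|Phi y - Phi z| <= `|y - z|.
Proof.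
have := @mean_value R (@Phi R) gdens z (y - z) 1.
rewrite mul1r [z + _]addrC subrK; apply=> t _; first exact: is_derive_Phi.
by rewrite ger0_norm ?gdens_ge0 ?gdens_le1.
Qed.

Lemma gdens_tail : exists2 C : R, 0 < C & forall (A : set R) y, measurable A ->
  (forall t, A t -> `|y| <= `|t|) -> \int[mu]_(t in A) gdens t <= C * env y.
Proof.
pose sg := Num.sqrt 2 : R.
have sg0 : sg != 0 by rewrite gt_eqF // sqrtr_gt0.
pose K := 4 * (Num.sqrt (2 * pi))^-1 / normal_peak sg.
have pk0 := normal_peak_gt0 sg0.
have K0 : 0 < K by rewrite divr_gt0 // mulr_gt0 // invr_gt0 sqrt2pi_gt0.
exists K => // A y mA hA.
pose f t := (K * env y) * normal_pdf 0 sg t.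
have intp D : measurable D -> mu.-integrable D (EFin \o normal_pdf 0 sg).
  move=> mD; apply: (@integrableS _ _ _ _ setT) => //; exact: integrable_normal_pdf.
have intf D : measurable D -> mu.-integrable D (EFin \o f).
  move=> mD; have : mu.-integrable D (fun x => (K * env y)%:E * (EFin \o normal_pdf 0 sg) x)%E.
    by apply: integrableZl => //; exact: intp.
  by apply: eq_integrable.
have h1 : \int[mu]_(t in A) gdens t <= \int[mu]_(t in A) f t.
  apply: le_Rintegral => //; [exact: integrable_gdens | exact: intf |].
  move=> t /hA yt.
  have e1 : (1 + t ^+ 2) * gdens t <= K * normal_pdf 0 sg t.
    rewrite normal_pdfE // /K mulrA mulfVK ?gt_eqF //.
    rewrite /gdens /normal_fun mulrCA [X in _ <= X]mulrAC mulrC ler_pM2r ?invr_gt0 ?sqrt2pi_gt0 //.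
    rewrite subr0 sqr_sqrtr // mulNr.
    have -> : t ^+ 2 / (2 *+ 2) = t ^+ 2 / 4 by rewrite -mulr_natr; congr (_ / _); ring.
    have -> : t ^+ 2 / 2 = t ^+ 2 / 4 + t ^+ 2 / 4 by field.
    rewrite opprD expRD mulrA ler_wpM2r ?expR_ge0 // expRN.
    rewrite ler_pdivrMr ?expR_gt0 //.
    have := expR_ge1Dx (t ^+ 2 / 4); lra.
  have e2 : 0 < 1 + y ^+ 2 by rewrite ltr_pwDl // sqr_ge0.
  have e3 : y ^+ 2 <= t ^+ 2.
    by rewrite -[y ^+ 2]real_normK ?num_real // -[t ^+ 2]real_normK ?num_real // lerXn2r ?nnegrE.
  rewrite /f /env mulrAC ler_pdivlMr // mulrC.
  apply: le_trans e1; rewrite ler_wpM2r ?gdens_ge0 //; lra.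
apply: le_trans h1 _.
have h2 : \int[mu]_(t in A) f t <= \int[mu]_t f t.
  apply: fine_le.
  - by apply: integrable_fin_num => //; exact: intf.
  - by apply: integrable_fin_num => //; exact: intf.
  apply: ge0_subset_integral => //.
    by have /integrableP[] := intf _ measurableT.
  by move=> t _; rewrite lee_fin mulr_ge0 ?normal_pdf_ge0 // mulr_ge0 ?env_ge0 // ltW.
apply: le_trans h2 _.
by rewrite /f RintegralZl ?intp // /Rintegral integral_normal_pdf mulr1.
Qed.

(** The difference is a Gaussian tail beyond the distance of s to 0. *)
Lemma Phi_tail : exists2 C : R, 0 < C &
  forall s, `|(s <= 0)%R%:R - Phi (- s)| <= C * env s.
Proof.
have [C C0 hC] := gdens_tail; exists C => // s.
have [s0|s0] := leP s 0.
  rewrite ger0_norm ?subr_ge0 ?Phi_le1 // Phi_compl; apply: hC => // t.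
  rewrite /= in_itv /= andbT => st; rewrite ler0_norm //.
  by apply: le_trans (ltW st) (ler_norm _).
rewrite sub0r normrN ger0_norm ?Phi_ge0 // PhiE; apply: hC => // t.
rewrite /= in_itv /= => st; rewrite gtr0_norm // lerNr in st *.
by rewrite -normrN; apply: le_trans st (ler_norm _).
Qed.

End PhiBounds.

(** The functions U j are the spatial derivatives of the solution
    U 0 of the heat equation with initial datum the indicator of s <= 0. *)
Section HeatKernel.
Context {R : realType}.
Implicit Types s t tau : R.

Arguments gder : simpl never.

Definition U j tau s : R :=
  if j is j'.+1 then - ((Num.sqrt tau)^-1 ^+ j * gder j' (s / Num.sqrt tau))
  else Phi (- (s / Num.sqrt tau)).

Lemma gdensN (z : R) : gdens (- z) = gdens z.
Proof. by rewrite /gdens sqrrN. Qed.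

Lemma is_derive_U j tau s : is_derive s 1 (U j tau) (U j.+1 tau s).
Proof.
set w := (Num.sqrt tau)^-1.
have hl : is_derive s 1 (fun s : R => s * w) w.
  have -> : (fun s : R => s * w) = w *: (id : R -> R).
    by apply/funext => u; rewrite !fctE /GRing.scale /= mulrC.
  by apply: (is_derive_eq (is_deriveZ _ (is_derive_id s 1))); rewrite /GRing.scale /= mulr1.
case: j => [|j].
  have -> : U 0 tau = @Phi R \o (fun s => - (s * w)) by [].
  have hn : is_derive s 1 (fun s : R => - (s * w)) (- w).
    exact: (is_deriveN hl).
  apply: (is_derive_eq (is_derive1_comp (is_derive_Phi _) hn)).
  by rewrite /= gdensN expr1 -/w mulrN mulrC.
have -> : U j.+1 tau = (- (w ^+ j.+1)) *: (gder j \o (fun s : R => s * w)).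
  by apply/funext => u; rewrite !fctE /GRing.scale /= /U -/w mulNr.
apply: (is_derive_eq (is_deriveZ _ (is_derive1_comp (is_derive_gder j _) hl))).
by rewrite /GRing.scale /= /U -/w [in RHS]exprS; ring.
Qed.

Lemma is_derive_U_tau j tau s : 0 < tau ->
  is_derive tau 1 (fun tau => U j tau s) (2^-1 * U j.+2 tau s).
Proof.
move=> t0; have r0 : 0 < Num.sqrt tau by rewrite sqrtr_gt0.
have rn : Num.sqrt tau != 0 by rewrite gt_eqF.
have hr := is_derive1_sqrt t0.
have hw : is_derive tau 1 (fun x : R => (Num.sqrt x)^-1) (- 2^-1 * (Num.sqrt tau)^-1 ^+ 3).
  apply: (is_derive_eq (is_deriveV rn hr)); rewrite /GRing.scale /=.
  by field.
set w := (Num.sqrt tau)^-1 in hw *.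
have hz : is_derive tau 1 (fun x : R => s * (Num.sqrt x)^-1) (- 2^-1 * s * w ^+ 3).
  by apply: (is_derive_eq (is_deriveZ s hw)); rewrite /GRing.scale /=; ring.
case: j => [|j].
  have hzn : is_derive tau 1 (fun x : R => - (s * (Num.sqrt x)^-1)) (2^-1 * s * w ^+ 3).
    by apply: (is_derive_eq (is_deriveN hz)); ring.
  have -> : (fun tau => U 0 tau s) = @Phi R \o (fun x : R => - (s * (Num.sqrt x)^-1)) by [].
  apply: (is_derive_eq (is_derive1_comp (is_derive_Phi _) hzn)).
  rewrite -/w gdensN /U -/w.
  have -> : gder 1 (s * w) = - (s * w * gdens (s * w) + 0) by [].
  by ring.
have -> : (fun tau => U j.+1 tau s) =
   - ((fun x : R => (Num.sqrt x)^-1) ^+ j.+1 * (gder j \o (fun x : R => s * (Num.sqrt x)^-1))).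
  by apply/funext => u; rewrite !fctE.
apply: (is_derive_eq (is_deriveN (is_deriveM (is_deriveX j.+1 hw)
  (is_derive1_comp (is_derive_gder j _) hz)))).
rewrite !fctE /GRing.scale /= /U -/w.
have -> : gder j.+2 (s * w) = - (s * w * gder j.+1 (s * w) + j.+1%:R * gder j (s * w)) by [].
have e3 : w ^+ j.+3 = w ^+ j * w ^+ 3 by rewrite -exprD addn3.
rewrite e3 !(exprS w j) /=; ring.
Qed.

Lemma U_env j : (0 < j)%N -> exists2 C : R, 0 < C & forall tau s, 0 < tau ->
  `|U j tau s| <= C * (Num.sqrt tau)^-1 ^+ j * env (s / Num.sqrt tau).
Proof.
case: j => // j _; have [C C0 hC] := @gder_env R j; exists C => // tau s t0.
have w0 : 0 <= (Num.sqrt tau)^-1 by rewrite invr_ge0 sqrtr_ge0.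
rewrite /U normrN normrM (ger0_norm (exprn_ge0 _ w0)) (mulrC C) -mulrA.
by rewrite ler_wpM2l ?exprn_ge0 ?hC.
Qed.

Lemma U0_norm tau s : `|U 0 tau s| <= 1.
Proof. by rewrite ger0_norm ?Phi_le1 ?Phi_ge0. Qed.

Lemma U0_step : exists2 C : R, 0 < C & forall tau s, 0 < tau ->
  `|(s <= 0)%R%:R - U 0 tau s| <= C * env (s / Num.sqrt tau).
Proof.
have [C C0 hC] := @Phi_tail R; exists C => // tau s t0.
have r0 : 0 < Num.sqrt tau by rewrite sqrtr_gt0.
by have := hC (s / Num.sqrt tau); rewrite pmulr_lle0 ?invr_gt0.
Qed.

End HeatKernel.

Arguments U : simpl never.

(** * Transfer operators of random iterations *)

Section GeometricLimit.
Context {R : realType}.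

(** The increments are summable, so w is Cauchy; the tail of the geometric series gives the rate. *)
Lemma geometric_limit (w : nat -> R) (C r : R) : 0 <= r < 1 -> 0 <= C ->
  (forall n, `|w n.+1 - w n| <= C * r ^+ n) ->
  exists l, forall n, `|w n - l| <= C / (1 - r) * r ^+ n.
Proof.
move=> /andP[r0 r1] C0 hw.
have q0 : 0 < 1 - r by rewrite subr_gt0.
pose e n := C / (1 - r) * r ^+ n.
have eS n : e n - C * r ^+ n = e n.+1.
  by rewrite /e exprS; field; rewrite gt_eqF.
have e0 n : 0 <= e n by rewrite mulr_ge0 ?exprn_ge0 // divr_ge0 // ltW.
have lo : nondecreasing_seq (fun n => w n - e n).
  apply/nondecreasing_seqP => n; have := hw n; have := eS n; rewrite ler_norml; lra.
have up : nonincreasing_seq (fun n => w n + e n).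
  apply/nonincreasing_seqP => n; have := hw n; have := eS n; rewrite ler_norml; lra.
have lu m n : w m - e m <= w n + e n.
  apply: (@le_trans _ _ (w (maxn m n) - e (maxn m n))); first exact/lo/leq_maxl.
  apply: (@le_trans _ _ (w (maxn m n) + e (maxn m n))); last exact/up/leq_maxr.
  by have := e0 (maxn m n); lra.
pose S := [set w n - e n | n in [set: nat]].
have hS : has_sup S.
  split; first by exists (w 0%N - e 0%N); exists 0%N.
  by exists (w 0%N + e 0%N) => _ [n _ <-].
exists (sup S) => n; rewrite -/(e n) ler_norml.
have h1 : w n - e n <= sup S by apply: ub_le_sup; [case: hS|exists n].
have h2 : sup S <= w n + e n by apply: ge_sup => [|_ [m _ <-]]; [case: hS|].
lra.
Qed.

End GeometricLimit.

Section ParametricIntegral.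
Context {R : realType} {dE dT : measure_display}.
Context {E : measurableType dE} {T : measurableType dT}.
Variable mu : probability E R.

Lemma measurable_Rint (G : T * E -> R) : measurable_fun setT G ->
  measurable_fun setT (fun v => \int[mu]_e G (v, e)).
Proof.
move=> mG; rewrite /Rintegral; apply: measurableT_comp; first exact: fine_measurable.
have mE : measurable_fun setT (EFin \o G) by exact/measurable_EFinP.
have mp := measurable_fun_fubini_tonelli_F (m2 := mu) _ (measurable_funepos mE) (fun _ => funepos_ge0 _ _).
have mn := measurable_fun_fubini_tonelli_F (m2 := mu) _ (measurable_funeneg mE) (fun _ => funeneg_ge0 _ _).
have := emeasurable_funB mp mn; congr (measurable_fun _ _).
apply/funext => v; rewrite /= [RHS]integralE /fubini_F; congr (_ - _)%E;
  by apply: eq_integral => e _; rewrite ?funeposE ?funenegE.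
Qed.

Variable ell : E -> R.
Hypothesis mell : measurable_fun setT ell.
Hypothesis ell1 : forall e, 1 <= ell e.
Hypothesis iell : mu.-integrable setT (EFin \o (fun e => ell e ^+ 8)).

Lemma ell0 e : 0 <= ell e. Proof. exact: le_trans ler01 (ell1 e). Qed.

Lemma ell_exp m n e : (m <= n)%N -> ell e ^+ m <= ell e ^+ n.
Proof. by move=> mn; exact: ler_weXn2l. Qed.

Lemma integrable_ell p (G : E -> R) K : (p <= 8)%N -> measurable_fun setT G ->
  (forall e, `|G e| <= K * ell e ^+ p) -> mu.-integrable setT (EFin \o G).
Proof.
move=> p8 mG hG.
have iK : mu.-integrable setT (fun e => K%:E * (EFin \o (fun e => (ell e ^+ 8)%R)) e)%E.
  exact: integrableZl.
apply: le_integrable iK => //; first exact/measurable_EFinP.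
move=> e _; rewrite /= lee_fin; apply: le_trans (hG e) _.
have K0 : 0 <= K.
  have := le_trans (normr_ge0 _) (hG e).
  by rewrite pmulr_lge0 // exprn_gt0 // (lt_le_trans ltr01).
by rewrite ger0_norm ?mulr_ge0 ?exprn_ge0 ?ell0 // ler_wpM2l // ell_exp.
Qed.

Lemma Rint_cst (c : R) : \int[mu]_(e in [set: E]) c = c.
Proof. by rewrite Rintegral_cst // [X in fine X](_ : _ = 1%E) ?mulr1 //; exact: probability_setT. Qed.

Definition ellI := \int[mu]_e (ell e ^+ 8).

Lemma ellI_ge1 : 1 <= ellI.
Proof.
have -> : 1 = \int[mu]_(e in [set: E]) (1 : R).
  by rewrite Rint_cst.
apply: le_Rintegral => //.
  by apply: (@integrable_ell 0 _ 1) => // e; rewrite normr1 mul1r.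
by move=> e _; rewrite exprn_ege1.
Qed.

Lemma Rint_ell_norm p (G : E -> R) K : (p <= 8)%N -> measurable_fun setT G ->
  0 <= K ->
  (forall e, `|G e| <= K * ell e ^+ p) -> `|\int[mu]_e G e| <= K * ellI.
Proof.
move=> p8 mG K0 hG; have iG := integrable_ell p8 mG hG.
apply: le_trans (le_normr_Rintegral measurableT iG) _.
rewrite -RintegralZl //; apply: le_Rintegral => //.
- by apply: (@integrable_ell p _ K) => //; [exact: measurableT_comp | move=> e; rewrite normr_id].
- by apply: (@integrable_ell 8 _ K) => //; [apply: measurable_funM => //; exact: measurable_funX |
    move=> e; rewrite ger0_norm // mulr_ge0 ?exprn_ge0 ?ell0].
by move=> e _; apply: le_trans (hG e) _; rewrite ler_wpM2l // ell_exp.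
Qed.

Lemma Rint_ell_dist p (G H : E -> R) K : (p <= 8)%N ->
  measurable_fun setT G -> measurable_fun setT H -> 0 <= K ->
  mu.-integrable setT (EFin \o G) -> mu.-integrable setT (EFin \o H) ->
  (forall e, `|G e - H e| <= K * ell e ^+ p) ->
  `|\int[mu]_e G e - \int[mu]_e H e| <= K * ellI.
Proof.
move=> p8 mG mH K0 iG iH hGH; rewrite -RintegralB //.
by apply: Rint_ell_norm hGH => //; exact: measurable_funB.
Qed.

End ParametricIntegral.

Section Operator.
Context {R : realType} {dE dT : measure_display}.
Context {E : measurableType dE} {T : measurableType dT}.
Variable mu : probability E R.
Variables (step : E -> T -> T) (s : T -> R) (ell : E -> R).
Hypothesis mstep : measurable_fun setT (fun p : T * E => step p.2 p.1).
Hypothesis ms : measurable_fun setT s.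
Hypothesis mell : measurable_fun setT ell.
Hypothesis ell1 : forall e, 1 <= ell e.
Hypothesis iell : mu.-integrable setT (EFin \o (fun e => ell e ^+ 8)).
Hypothesis sstep : forall e v, `|s (step e v) - s v| <= ell e.
Implicit Types F G : T -> R.

(** The transfer operator of the chain whose step is drawn from mu. *)
Definition Pop F v : R := \int[mu]_e F (step e v).

(** Quadratic growth in s: it admits second moments of the cocycle and is
    preserved by the transfer operator, so integrability is automatic. *)
Definition adm F := measurable_fun setT F /\
  exists2 K : R, 0 <= K & forall v, `|F v| <= K * (1 + s v ^+ 2).

Lemma mstep_v v : measurable_fun setT (step^~ v).
Proof. exact: (@measurable_fun_pair2 _ _ _ _ _ _ _ v mstep). Qed.

Lemma adm_step F v : adm F -> mu.-integrable setT (EFin \o (fun e => F (step e v))).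
Proof.
move=> [mF [K K0 hF]].
apply: (integrable_ell ell1 iell (p := 2) (K := K * (3 * (1 + s v ^+ 2)))) => //.
  by apply: measurableT_comp => //; exact: mstep_v.
move=> e; apply: le_trans (hF _) _; rewrite -mulrA ler_wpM2l //.
have := sstep e v; have := ell1 e; rewrite ler_norml; move: (s _) (s _) (ell e) => x y l.
move=> l1 /andP[h1 h2].
have h3 : (x - y) ^+ 2 <= l ^+ 2.
  have : 0 <= (l - (x - y)) * (l + (x - y)) by rewrite mulr_ge0 //; lra.
  nra.
have h4 : 0 <= (l ^+ 2 - 1) * y ^+ 2.
  by rewrite mulr_ge0 ?sqr_ge0 // subr_ge0 exprn_ege1.
have h5 : 1 <= l ^+ 2 by rewrite exprn_ege1.
have := sqr_ge0 (x - 2 * y); nra.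
Qed.

Lemma Pop_measurable F : measurable_fun setT F -> measurable_fun setT (Pop F).
Proof.
move=> mF; apply: (@measurable_Rint _ _ _ _ _ mu (fun p => F (step p.2 p.1))).
exact: measurableT_comp.
Qed.

Lemma adm_Pop F : adm F -> adm (Pop F).
Proof.
move=> aF; have [mF [K K0 hF]] := aF; split; first exact: Pop_measurable.
exists (K * 3 * ellI mu ell).
  have h1 := ellI_ge1 (mu := mu) ell1 iell.
  by rewrite mulr_ge0 ?(le_trans ler01 h1) // mulr_ge0.
move=> v; rewrite -!mulrA mulrCA [X in _ <= X]mulrA [X in _ <= X]mulrA.
have h0 : 0 <= 3 * K * (1 + s v ^+ 2) by rewrite !mulr_ge0 // addr_ge0 // sqr_ge0.
rewrite [X in _ <= X]mulrAC.
apply: (Rint_ell_norm mell ell1 iell (p := 2)) => //.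
  by apply: measurableT_comp => //; exact: mstep_v.
move=> e; apply: le_trans (hF _) _.
apply: (@le_trans _ _ (K * (3 * (1 + s v ^+ 2) * ell e ^+ 2))); last first.
  by rewrite le_eqVlt; apply/orP; left; apply/eqP; ring.
rewrite ler_wpM2l //.
have := sstep e v; have := ell1 e; rewrite ler_norml; move: (s _) (s _) (ell e) => x y l.
move=> l1 /andP[h1 h2].
have h3 : (x - y) ^+ 2 <= l ^+ 2.
  have : 0 <= (l - (x - y)) * (l + (x - y)) by rewrite mulr_ge0 //; lra.
  nra.
have h4 : 0 <= (l ^+ 2 - 1) * y ^+ 2.
  by rewrite mulr_ge0 ?sqr_ge0 // subr_ge0 exprn_ege1.
have h5 : 1 <= l ^+ 2 by rewrite exprn_ege1.
have := sqr_ge0 (x - 2 * y); nra.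
Qed.

Lemma adm_bounded F K : measurable_fun setT F -> (forall v, `|F v| <= K) -> adm F.
Proof.
move=> mF hF; split=> //; exists `|K| => // v.
apply: le_trans (hF v) (le_trans (ler_norm _) _).
by rewrite ler_peMr // lerDl sqr_ge0.
Qed.

Lemma adm_cst (c : R) : adm (fun=> c).
Proof. by apply: (@adm_bounded _ `|c|). Qed.

Lemma admD F G : adm F -> adm G -> adm (fun v => F v + G v).
Proof.
move=> [mF [K K0 hF]] [mG [L L0 hG]]; split; first exact: measurable_funD.
exists (K + L) => [|v]; first exact: addr_ge0.
by apply: le_trans (ler_normD _ _) _; rewrite mulrDl lerD.
Qed.

Lemma admZ (c : R) F : adm F -> adm (fun v => c * F v).
Proof.
move=> [mF [K K0 hF]]; split; first exact: measurable_funM.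
exists (`|c| * K) => [|v]; first exact: mulr_ge0.
by rewrite normrM -mulrA ler_wpM2l.
Qed.

Lemma admB F G : adm F -> adm G -> adm (fun v => F v - G v).
Proof.
move=> aF /(admZ (-1)) aG; have := admD aF aG.
by under eq_fun do rewrite mulN1r.
Qed.

Lemma adm_norm F : adm F -> adm (fun v => `|F v|).
Proof.
move=> [mF [K K0 hF]]; split; first exact: measurableT_comp.
by exists K => // v; rewrite normr_id.
Qed.

Lemma adm_sum (I : Type) (r : seq I) (F : I -> T -> R) :
  (forall i, adm (F i)) -> adm (fun v => \sum_(i <- r) F i v).
Proof.
move=> h; elim: r => [|i r ih].
  by under eq_fun do rewrite big_nil; exact: adm_cst.
by under eq_fun do rewrite big_cons; exact: admD.
Qed.

Lemma PopD F G : adm F -> adm G -> Pop (fun v => F v + G v) = fun v => Pop F v + Pop G v.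
Proof.
move=> aF aG; apply/funext => v; rewrite /Pop RintegralD //; exact: adm_step.
Qed.

Lemma PopZ c F : adm F -> Pop (fun v => c * F v) = fun v => c * Pop F v.
Proof.
move=> aF; apply/funext => v; rewrite /Pop RintegralZl //; exact: adm_step.
Qed.

Lemma PopB F G : adm F -> adm G -> Pop (fun v => F v - G v) = fun v => Pop F v - Pop G v.
Proof.
move=> aF aG; apply/funext => v; rewrite /Pop RintegralB //; exact: adm_step.
Qed.

Lemma Pop_cst c : Pop (fun=> c) = fun=> c.
Proof.
by apply/funext => v; rewrite /Pop Rint_cst.
Qed.

Lemma Pop_le F G : adm F -> adm G -> (forall v, F v <= G v) ->
  forall v, Pop F v <= Pop G v.
Proof. by move=> aF aG h v; apply: le_Rintegral => //; exact: adm_step. Qed.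

Definition Pn n F := iter n Pop F.

Lemma Pn_S n F : Pn n.+1 F = Pn n (Pop F). Proof. exact: iterSr. Qed.

Lemma Pn_add m n F : Pn (m + n) F = Pn m (Pn n F). Proof. exact: iterD. Qed.

Lemma adm_Pn n F : adm F -> adm (Pn n F).
Proof. by move=> aF; elim: n => // n ih; exact: adm_Pop. Qed.

Lemma PnD n F G : adm F -> adm G -> Pn n (fun v => F v + G v) = fun v => Pn n F v + Pn n G v.
Proof.
move=> aF aG; elim: n => // n ih.
by rewrite /Pn iterS -/(Pn n _) ih PopD //; exact: adm_Pn.
Qed.

Lemma PnZ n c F : adm F -> Pn n (fun v => c * F v) = fun v => c * Pn n F v.
Proof.
move=> aF; elim: n => // n ih.
by rewrite /Pn iterS -/(Pn n _) ih PopZ //; exact: adm_Pn.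
Qed.

Lemma PnB n F G : adm F -> adm G -> Pn n (fun v => F v - G v) = fun v => Pn n F v - Pn n G v.
Proof.
move=> aF aG; elim: n => // n ih.
by rewrite /Pn iterS -/(Pn n _) ih PopB //; exact: adm_Pn.
Qed.

Lemma Pn_cst n c : Pn n (fun=> c) = fun=> c.
Proof. by elim: n => // n ih; rewrite /Pn iterS -/(Pn n _) ih Pop_cst. Qed.

Lemma Pn_sum n (I : Type) (r : seq I) (F : I -> T -> R) : (forall i, adm (F i)) ->
  Pn n (fun v => \sum_(i <- r) F i v) = fun v => \sum_(i <- r) Pn n (F i) v.
Proof.
move=> h; elim: r => [|i r ih].
  under eq_fun do rewrite big_nil; rewrite Pn_cst.
  by apply/funext => v; rewrite big_nil.
under eq_fun do rewrite big_cons; rewrite PnD ?ih //; last exact: adm_sum.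
by apply/funext => v; rewrite big_cons.
Qed.

Lemma Pn_le n F G : adm F -> adm G -> (forall v, F v <= G v) ->
  forall v, Pn n F v <= Pn n G v.
Proof.
move=> aF aG h; elim: n => // n ih v.
by apply: Pop_le; [exact: adm_Pn | exact: adm_Pn | exact: ih].
Qed.

Lemma Pn_norm n F G : adm F -> adm G -> (forall v, `|F v| <= G v) ->
  forall v, `|Pn n F v| <= Pn n G v.
Proof.
move=> aF aG h v; rewrite ler_norml; apply/andP; split.
  have -> : - Pn n G v = Pn n (fun v => -1 * G v) v by rewrite PnZ // mulN1r.
  by apply: Pn_le => //; [exact: admZ | move=> w; have := h w; rewrite ler_norml mulN1r => /andP[]].
by apply: Pn_le => // w; apply: le_trans (h w); exact: ler_norm.
Qed.

Lemma Pn_bound n F K : adm F -> (forall v, `|F v| <= K) -> forall v, `|Pn n F v| <= K.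
Proof.
move=> aF h v; have := @Pn_norm n F (fun=> K) aF (adm_cst K) h v.
by rewrite Pn_cst.
Qed.

(** The functions Pn k (V k) interpolate between V 0 and Pn n (V n), and two
    successive ones differ by a one-step error averaged over the past. *)
Lemma telescope_Pn n (V e : nat -> T -> R) v :
  (forall k, adm (V k)) -> (forall k, adm (e k)) ->
  (forall k w, (k < n)%N -> `|Pop (V k.+1) w - V k w| <= e k w) ->
  `|Pn n (V n) v - V 0%N v| <= \sum_(k < n) Pn k (e k) v.
Proof.
move=> aV ae h; elim: n h => [|n ih] h.
  by rewrite big_ord0 subrr normr0.
rewrite big_ord_recr /=.
have -> : Pn n.+1 (V n.+1) v - V 0%N v =
  (Pn n (V n) v - V 0%N v) + Pn n (fun w => Pop (V n.+1) w - V n w) v.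
  by rewrite PnB -?Pn_S; [ring|exact: adm_Pop|exact: aV].
apply: le_trans (ler_normD _ _) (lerD (ih _) _).
  by move=> k w kn; apply: h; rewrite ltnS ltnW.
apply: Pn_norm => // [|w]; last exact: h.
by apply: admB => //; exact: adm_Pop.
Qed.

Variables (dist : T -> T -> R) (Delta r : R).
Hypothesis dist_ge0 : forall v w, 0 <= dist v w.
Hypothesis dist_le : forall v w, dist v w <= Delta.
Hypothesis r01 : 0 <= r < 1.
Hypothesis dist_step : forall e v w, dist (step e v) (step e w) <= r * dist v w.

Definition lipb (K : R) F := [/\ measurable_fun setT F, (forall v, `|F v| <= K) &
  forall v w, `|F v - F w| <= K * dist v w].

Lemma Pn_lip n F K : 0 <= K -> adm F -> (forall v w, `|F v - F w| <= K * dist v w) ->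
  forall v w, `|Pn n F v - Pn n F w| <= K * r ^+ n * dist v w.
Proof.
have /andP[r0 r1] := r01.
move=> K0 aF h; elim: n => [|n ih] v w; first by rewrite expr0 mulr1.
have an := adm_Pn n aF.
rewrite /Pn iterS -/(Pn n F) /Pop -RintegralB //; try exact: adm_step.
have i1 : mu.-integrable setT (EFin \o (fun e => Pn n F (step e v) - Pn n F (step e w))).
  have := integrableB measurableT (adm_step v an) (adm_step w an).
  by apply: eq_integrable.
apply: le_trans (le_normr_Rintegral measurableT i1) _.
have -> : K * r ^+ n.+1 * dist v w = \int[mu]_(e in [set: E]) (K * r ^+ n.+1 * dist v w).
  by rewrite Rint_cst.
apply: le_Rintegral => //.
- have := integrable_norm i1; exact: eq_integrable.
- by apply: (integrable_ell ell1 iell (p := 0) (K := `|K * r ^+ n.+1 * dist v w|)) => // e; rewrite mulr1.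
move=> e _; apply: le_trans (ih _ _) _; rewrite exprSr !mulrA -!mulrA.
by rewrite ler_wpM2l // ler_wpM2l ?exprn_ge0.
Qed.

(** By contraction the oscillation of Pn n f decays geometrically, so Pn n f
    tends to a constant c and the series of the Pn n f - c converges to u. *)
Lemma poisson K f : T -> lipb K f -> exists c : R, exists2 u : T -> R,
  (exists K', lipb K' u) & forall v, u v - Pop u v = f v - c.
Proof.
move=> x0 [mf bf lf]; have af := adm_bounded mf bf.
have /andP[r0 r1] := r01.
have q0 : 0 < 1 - r by rewrite subr_gt0.
have K0 : 0 <= K by apply: le_trans (bf x0); exact: normr_ge0.
have D0 : 0 <= Delta by apply: le_trans (dist_le x0 x0); exact: dist_ge0.
have KD : 0 <= K * Delta by exact: mulr_ge0.
have lipn n v w : `|Pn n f v - Pn n f w| <= K * Delta * r ^+ n.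
  apply: le_trans (Pn_lip n K0 af lf v w) _.
  by rewrite mulrAC ler_wpM2r ?exprn_ge0 // ler_wpM2l.
have shift n m v w : `|Pn (m + n) f v - Pn n f w| <= K * Delta * r ^+ n.
  have an := adm_Pn n af.
  have -> : Pn (m + n) f v - Pn n f w = Pn m (fun v' => Pn n f v' - Pn n f w) v.
    by rewrite PnB ?Pn_cst ?Pn_add //; exact: adm_cst.
  apply: Pn_bound => [|v']; last exact: lipn.
  by apply: admB => //; exact: adm_cst.
have [c hc] := geometric_limit r01 KD (fun n => shift n 1%N x0 x0).
pose K1 := K * Delta / (1 - r) + K * Delta.
have K10 : 0 <= K1 by rewrite addr_ge0 // divr_ge0 // ltW.
have hcv n v : `|Pn n f v - c| <= K1 * r ^+ n.
  have := lipn n v x0; have := hc n; have -> : Pn n f v - c = (Pn n f v - Pn n f x0) + (Pn n f x0 - c) by ring.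
  move=> h1 h2; apply: le_trans (ler_normD _ _) _; rewrite /K1 mulrDl addrC; exact: lerD.
pose w N v := \sum_(n < N) (Pn n f v - c).
have hw v n : `|w n.+1 v - w n v| <= K1 * r ^+ n.
  by rewrite /w big_ord_recr /= [_ + (_ - c)]addrC addrK.
have /choice[u hu] : forall v, exists l, forall n, `|w n v - l| <= K1 / (1 - r) * r ^+ n.
  by move=> v; exact: geometric_limit (hw v).
pose K2 := K1 / (1 - r).
have K20 : 0 <= K2 by rewrite divr_ge0 // ltW.
have aw N : adm (w N).
  apply: (@adm_sum 'I_N (index_enum _) (fun n v => Pn n f v - c)) => n.
  by apply: admB; [exact: adm_Pn | exact: adm_cst].
have small (x : R) : (forall n, `|x| <= (2 * K2) * r ^+ n) -> x = 0.
  move=> hx; apply/eqP; rewrite -normr_le0; apply/ler_addgt0Pr => e e0.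
  rewrite add0r.
  have rn : `|r| < 1 by rewrite ger0_norm.
  have := @cvg_geometric R (2 * K2) r rn.
  move=> /cvgrPdist_lt /(_ e e0) [N _ /(_ N (leqnn N))] /=.
  rewrite sub0r normrN => h; apply/ltW; apply: le_lt_trans (hx N) _.
  exact: le_lt_trans (ler_norm _) h.
have mu_ : measurable_fun setT u.
  apply: (@measurable_fun_cvg _ _ _ _ w) => [n|v _]; first by case: (aw n).
  apply/cvgrPdist_lt => e e0.
  have rn : `|r| < 1 by rewrite ger0_norm.
  have := @cvg_geometric R K2 r rn.
  move=> /cvgrPdist_lt /(_ e e0) [N _ hN]; exists N => // n Nn.
  have := hN n Nn; rewrite /= sub0r normrN => h.
  rewrite distrC; apply: le_lt_trans (hu v n) _.
  exact: le_lt_trans (ler_norm _) h.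
have bu v : `|u v| <= K2 by have := hu v 0%N; rewrite /w big_ord0 sub0r normrN expr0 mulr1.
have au : adm u by exact: adm_bounded bu.
exists c; exists u.
  exists (K2 + K / (1 - r)); split=> //.
    by move=> v; apply: le_trans (bu v) _; rewrite lerDl divr_ge0 // ltW.
  move=> v v'.
  have lw N : `|w N v - w N v'| <= K / (1 - r) * dist v v'.
    have -> : w N v - w N v' = \sum_(n < N) (Pn n f v - Pn n f v').
      by rewrite /w -sumrB; apply: eq_bigr => i _; ring.
    apply: (@le_trans _ _ (\sum_(n < N) K * dist v v' * r ^+ n)).
      apply: le_trans (ler_norm_sum _ _ _) (ler_sum _ _) => n _.
      by apply: le_trans (Pn_lip n K0 af lf v v') _; rewrite mulrAC.
    rewrite -mulr_sumr.
    have hg : \sum_(n < N) r ^+ n <= (1 - r)^-1.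
      have := subrX1 r N; rewrite -[_ - 1]opprB -[r - 1]opprB mulNr => /oppr_inj hE.
      rewrite -[_^-1]mul1r ler_pdivlMr // mulrC -hE lerBlDr lerDl exprn_ge0 //.
    apply: le_trans (ler_wpM2l _ hg) _; first by rewrite mulr_ge0.
    by rewrite mulrAC.
  have : `|u v - u v'| <= K / (1 - r) * dist v v'.
    apply/ler_addgt0Pr => e e0.
    have rn : `|r| < 1 by rewrite ger0_norm.
    have := @cvg_geometric R (2 * K2) r rn.
    move=> /cvgrPdist_lt /(_ e e0) [N _ /(_ N (leqnn N))] /=; rewrite sub0r normrN => h.
    have := le_lt_trans (ler_norm _) h; have := hu v N; have := hu v' N; have := lw N.
    rewrite -/K2 !ler_norml; lra.
  by move=> h; apply: le_trans h _; rewrite ler_wpM2r // lerDr.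
move=> v; apply/eqP; rewrite -subr_eq0; apply/eqP; apply: small => n.
have eqw : Pop (w n) v = w n.+1 v - (f v - c).
  have <- : (fun v => \sum_(i <- index_enum (ordinal n)) (Pn i f v - c)) = w n by [].
  have := @Pn_sum 1%N _ (index_enum (ordinal n)) (fun (i : 'I_n) v => Pn i f v - c).
  rewrite /Pn /= -/(Pn _ _) => ->; last first.
    by move=> i; apply: admB; [exact: adm_Pn | exact: adm_cst].
  rewrite /w big_ord_recl /= [RHS]addrC addKr.
  apply: eq_bigr => i _; rewrite PopB ?Pop_cst //; [exact: adm_Pn | exact: adm_cst].
have e1 : `|Pop u v - Pop (w n) v| <= K2 * r ^+ n.
  have -> : Pop u v - Pop (w n) v = Pn 1 (fun v => u v - w n v) v.
    by rewrite /Pn /= PopB.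
  by apply: Pn_bound => [|v']; [exact: admB | rewrite distrC; exact: hu].
have e2 := hu v n.+1.
have rn : K2 * r ^+ n.+1 <= K2 * r ^+ n.
  by rewrite ler_wpM2l // exprS ler_piMl ?exprn_ge0 // ltW.
move: e1 e2; rewrite eqw -/K2 !ler_norml; lra.
Qed.

Lemma lipb_int p (G : T -> E -> R) K : (p <= 8)%N -> 0 <= K ->
  measurable_fun setT (fun q : T * E => G q.1 q.2) ->
  (forall v e, `|G v e| <= K * ell e ^+ p) ->
  (forall v w e, `|G v e - G w e| <= K * ell e ^+ p * dist v w) ->
  lipb (K * ellI mu ell) (fun v => \int[mu]_e G v e).
Proof.
move=> p8 K0 mG bG lG.
have mGv v : measurable_fun setT (G v) by exact: (@measurable_fun_pair2 _ _ _ _ _ _ _ v mG).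
split.
- exact: (@measurable_Rint _ _ _ _ _ mu (fun q => G q.1 q.2)).
- by move=> v; apply: (Rint_ell_norm mell ell1 iell p8).
move=> v w; rewrite mulrAC.
apply: (Rint_ell_dist mell ell1 iell p8) => //.
- by rewrite mulr_ge0.
- by apply: (integrable_ell ell1 iell p8) (bG v).
- by apply: (integrable_ell ell1 iell p8) (bG w).
by move=> e; rewrite mulrAC.
Qed.

End Operator.

(** * Decay of the heat kernel and elementary sums *)

Section HeatEstimates.
Context {R : realType}.
Implicit Types x tau : R.

Definition iw tau : R := (Num.sqrt tau)^-1.

Lemma iw_gt0 tau : 0 < tau -> 0 < iw tau.
Proof. by move=> t0; rewrite invr_gt0 sqrtr_gt0. Qed.

Lemma iw_le1 tau : 1 <= tau -> iw tau <= 1.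
Proof.
move=> t1; rewrite invf_le1 ?sqrtr_gt0 ?(lt_le_trans ltr01) //.
by rewrite -[X in X <= _]sqrtr1 ler_wsqrtr.
Qed.

Lemma iw_sqr tau : 0 < tau -> iw tau ^+ 2 = tau^-1.
Proof. by move=> t0; rewrite exprVn sqr_sqrtr // ltW. Qed.

Lemma iw_le tau tau' : 0 < tau -> tau <= tau' -> iw tau' <= iw tau.
Proof.
move=> t0 tt; rewrite lef_pV2 ?posrE ?sqrtr_gt0 ?(lt_le_trans t0) //.
exact: ler_wsqrtr.
Qed.

Lemma iwX_le tau m n : 1 <= tau -> (m <= n)%N -> iw tau ^+ n <= iw tau ^+ m.
Proof.
move=> t1 mn; have t0 : 0 < tau by exact: lt_le_trans t1.
by rewrite ler_wiXn2l ?(ltW (iw_gt0 t0)) // iw_le1.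
Qed.

Lemma continuous_U j tau : continuous (U j tau).
Proof.
move=> x; apply: differentiable_continuous; apply/derivable1_diffP.
by have [] := is_derive_U j tau x.
Qed.

Lemma measurable_U j tau : measurable_fun setT (U j tau).
Proof. exact: continuous_measurable_fun (continuous_U (j := j) (tau := tau)). Qed.

Lemma measurable_env : measurable_fun setT (@env R).
Proof.
apply: continuous_measurable_fun => x; apply: cvgV.
  by rewrite gt_eqF // ltr_pwDl // sqr_ge0.
apply: cvgD; first exact: cvg_cst.
exact: exprn_continuous.
Qed.

Lemma U_bound : exists2 C : R, 0 < C & forall j tau x, (0 < j <= 8)%N -> 1 <= tau ->
  `|U j tau x| <= C * iw tau ^+ j * env (x * iw tau).
Proof.
have /choice[C hC] : forall j, exists C : R, 0 < C /\
    ((0 < j)%N -> forall tau x, 0 < tau -> `|U j tau x| <= C * iw tau ^+ j * env (x * iw tau)).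
  move=> j; have [j0|j0] := leqP j 0; first by exists 1; split.
  by have [C C0 hC] := @U_env R j j0; exists C; split.
exists (\sum_(j < 9) C j).
  rewrite big_ord_recl /= ltr_wpDr //; last by have [] := hC 0%N.
  by apply: sumr_ge0 => i _; have [/ltW] := hC (bump 0 i).
move=> j tau x /andP[j0 j8] t1; have t0 : 0 < tau by exact: lt_le_trans t1.
have [_ /(_ j0) h] := hC j; apply: le_trans (h _ _ t0) _.
rewrite -!mulrA ler_wpM2r //.
  by rewrite mulr_ge0 ?env_ge0 // exprn_ge0 // ltW // iw_gt0.
have jo : (j < 9)%N by [].
rewrite (bigD1 (Ordinal jo)) //= lerDl; apply: sumr_ge0 => i _.
by have [/ltW] := hC i.
Qed.

(** Increasing tau enlarges the variance, hence widens env, by a bounded factor. *)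
Lemma env_time (x tau sg t : R) : 1 <= tau -> 0 <= sg -> 0 <= t <= 1 ->
  env (x * iw (tau + t * sg)) <= (1 + sg) * env (x * iw tau).
Proof.
move=> t1 sg0 /andP[th0 th1].
have t0 : 0 < tau by exact: lt_le_trans t1.
have ts : 0 <= t * sg by exact: mulr_ge0.
have t0' : 0 < tau + t * sg by exact: ltr_wpDr.
rewrite /env !exprMn !iw_sqr //.
have X0 := sqr_ge0 x.
have d1 : 0 < 1 + x ^+ 2 / tau by rewrite ltr_pwDl // divr_ge0 // ltW.
have d2 : 0 < 1 + x ^+ 2 / (tau + t * sg) by rewrite ltr_pwDl // divr_ge0 // ltW.
rewrite ler_pdivlMr // mulrC ler_pdivrMr //.
have h : x ^+ 2 / tau <= (1 + sg) * (x ^+ 2 / (tau + t * sg)).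
  rewrite mulrCA ler_wpM2l // ler_pdivlMr // mulrC ler_pdivrMr //.
  have : t * sg <= sg * tau.
    by rewrite mulrC ler_wpM2l // (le_trans th1).
  by move=> h; rewrite mulrDl mul1r lerD2l.
rewrite mulrDr mulr1; lra.
Qed.

Lemma env_space (x tau t h : R) : 1 <= tau -> 0 <= t <= 1 ->
  env ((x + t * h) * iw tau) <= 2 * (1 + h ^+ 2) * env (x * iw tau).
Proof.
move=> t1 /andP[th0 th1]; rewrite mulrDl; apply: le_trans (env_shift _ _) _.
rewrite ler_wpM2r ?env_ge0 // ler_wpM2l // lerD2l.
have w0 : 0 <= iw tau by apply/ltW/iw_gt0; exact: lt_le_trans t1.
have w1 := iw_le1 t1.
rewrite !exprMn mulrAC ler_piMl ?sqr_ge0 //.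
by rewrite mulr_ile1 ?sqr_ge0 // exprn_ile1.
Qed.

End HeatEstimates.

Section Sums.
Context {R : realType}.

Lemma sqrtn_gt0 (n : nat) : (0 < n)%N -> 0 < Num.sqrt (n%:R : R).
Proof. by move=> n0; rewrite sqrtr_gt0 ltr0n. Qed.

Lemma sum_invsqrt (n : nat) : \sum_(k < n) (Num.sqrt (k.+1%:R : R))^-1 <= 2 * Num.sqrt n%:R.
Proof.
elim: n => [|n ih]; first by rewrite big_ord0 sqrtr0 mulr0.
rewrite big_ord_recr /=; apply: le_trans (lerD ih (lexx _)) _.
have b0 : 0 < Num.sqrt (n.+1%:R : R) by exact: sqrtn_gt0.
have a0 : 0 <= Num.sqrt (n%:R : R) by exact: sqrtr_ge0.
have ha : Num.sqrt (n%:R : R) ^+ 2 = n%:R by rewrite sqr_sqrtr.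
have hb : Num.sqrt (n.+1%:R : R) ^+ 2 = n%:R + 1 by rewrite sqr_sqrtr // natr1.
move: (Num.sqrt (n.+1%:R : R)) (Num.sqrt (n%:R : R)) b0 a0 ha hb => b a b0 a0 ha hb.
have -> : b^-1 = 1 / b by rewrite mul1r.
have ab : a <= b by rewrite -(@ler_pXn2r _ 2) ?nnegrE ?(ltW b0) // ha hb; lra.
have : 1 / b <= 2 * (b - a) by rewrite ler_pdivrMr //; nra.
lra.
Qed.

(** When k is at least of order n, the second factor is of order 1 / sqrt n and
    the cubes are summable; otherwise the square of iw is of order 1 / n. *)
Lemma sum_iw (sg2 : R) : 0 < sg2 -> exists2 C : R, 0 < C & forall t0 (n : nat), 1 <= t0 ->
  (0 < n)%N ->
  \sum_(k < n) iw (t0 + sg2 * (n - k.+1)%:R) ^+ 3 * (Num.sqrt (k.+1%:R))^-1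
   <= C * iw t0 * (Num.sqrt (n%:R : R))^-1.
Proof.
move=> sg0; have r0 : 0 <= sg2^-1 by rewrite invr_ge0 ltW.
exists (2 * (1 + 2 / sg2) + 4 / sg2).
  by rewrite ltr_wpDr ?mulr_ge0 // mulr_gt0 // ltr_wpDr // mulr_ge0.
move=> t0 n t1 n0.
pose tt m := t0 + sg2 * m%:R.
have tt1 m : 1 <= tt m by apply: le_trans t1 _; rewrite lerDl mulr_ge0 // ltW.
have tt0 m : 0 < tt m by exact: lt_le_trans (tt1 m).
pose W m := iw (tt m).
have W0 m : 0 < W m by exact: iw_gt0.
have WE : W 0%N = iw t0 by rewrite /W /tt mulr0 addr0.
have Wle m : W m <= iw t0 by apply: iw_le; [exact: lt_le_trans t1|rewrite lerDl mulr_ge0 // ltW].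
have Wt1 : iw t0 <= 1 by exact: iw_le1.
have sn := sqrtn_gt0 n0.
set sN := Num.sqrt (n%:R : R) in sn *.
(* W m ^+ 3 is at most a multiple of the difference W m.-1 - W m *)
have cubes N : \sum_(m < N) W m ^+ 3 <= iw t0 * (1 + 2 / sg2).
  have : \sum_(m < N.+1) W m ^+ 3 <= W 0%N ^+ 3 + 2 / sg2 * (W 0%N - W N).
    elim: N => [|N ih]; first by rewrite big_ord_recl big_ord0 subrr mulr0.
    rewrite big_ord_recr /=.
    suff h : W N.+1 ^+ 3 <= 2 / sg2 * (W N - W N.+1) by move: ih h; rewrite !mulrBr; lra.
    have hp : (W N)^-1 ^+ 2 = tt N by rewrite /W /iw invrK sqr_sqrtr // ltW.
    have hq : (W N.+1)^-1 ^+ 2 = tt N + sg2.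
      by rewrite /W /iw invrK sqr_sqrtr ?(ltW (tt0 _)) // /tt -addrA -[N.+1%:R]natr1 mulrDr mulr1.
    have p0 : 0 < (W N)^-1 by rewrite invr_gt0.
    have q0 : 0 < (W N.+1)^-1 by rewrite invr_gt0.
    rewrite -[W N]invrK -[W N.+1]invrK; move: (W N)^-1 (W N.+1)^-1 p0 q0 hp hq => p q p0 q0 hp hq.
    have pq : p <= q by rewrite -(@ler_pXn2r _ 2) ?nnegrE ?(ltW p0) ?(ltW q0) // hp hq lerDl ltW.
    have -> : 2 / sg2 * (p^-1 - q^-1) = 2 / (p * q * (p + q)).
      have e : q ^+ 2 - p ^+ 2 = sg2 by rewrite hp hq; ring.
      have nz : q ^+ 2 - p ^+ 2 != 0 by rewrite e gt_eqF.
      have fac : (q - p) * (q + p) = q ^+ 2 - p ^+ 2 by ring.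
      have nqp : q - p != 0 by apply/eqP => e0; move: nz; rewrite -fac e0 mul0r eqxx.
      have sN0 : q + p != 0 by rewrite gt_eqF ?addr_gt0.
      rewrite -e -fac; field.
      by rewrite ?nqp ?sN0 ?(addrC p) ?sN0 !gt_eqF.
    rewrite exprVn -[X in X <= _]mul1r ler_pdivrMr ?exprn_gt0 // mulrAC ler_pdivlMr ?mulr_gt0 ?addr_gt0 // mul1r.
    rewrite exprS expr2.
    have : p * q * (p + q) <= q * q * (q + q).
      by apply: ler_pM; rewrite ?mulr_ge0 ?addr_ge0 ?(ltW p0) ?(ltW q0) // ?lerD2r // ler_wpM2r // ltW.
    by move=> h; apply: le_trans h _; rewrite le_eqVlt; apply/orP; left; apply/eqP; ring.
  have : \sum_(m < N) W m ^+ 3 <= \sum_(m < N.+1) W m ^+ 3.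
    by rewrite big_ord_recr /= lerDl exprn_ge0 // ltW.
  move=> h1 h2; apply: (le_trans h1); apply: (le_trans h2).
  rewrite WE (mulrDr (iw t0)) mulr1 lerD //.
    by rewrite exprSr ler_piMl ?(ltW (iw_gt0 _)) ?(lt_le_trans _ t1) // exprn_ile1 // ltW // iw_gt0 // (lt_le_trans _ t1).
  rewrite mulrC ler_wpM2r ?mulr_ge0 // lerBlDr lerDl ltW //.
have term (k : 'I_n) : W (n - k.+1)%N ^+ 3 * (Num.sqrt (k.+1%:R))^-1 <=
    2 * sN^-1 * W (n - k.+1)%N ^+ 3 + iw t0 * (2 / (sg2 * n%:R)) * (Num.sqrt (k.+1%:R))^-1.
  have kn := ltn_ord k.
  have k0 : 0 < Num.sqrt (k.+1%:R : R) by exact: sqrtn_gt0.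
  have w3 : 0 <= W (n - k.+1)%N ^+ 3 by rewrite exprn_ge0 // ltW.
  have [h|h] := leqP n (2 * k.+1).
    apply: ler_wpDr.
      have i0 : 0 <= iw t0 by rewrite ltW // iw_gt0 // (lt_le_trans _ t1).
      by rewrite mulr_ge0 ?invr_ge0 ?(ltW k0) // mulr_ge0 // divr_ge0 // mulr_ge0 // ltW.
    rewrite mulrC ler_wpM2r // ler_pdivlMr // mulrC ler_pdivrMr //.
    rewrite -(@ler_pXn2r _ 2) ?nnegrE ?(ltW sn) ?mulr_ge0 ?(ltW k0) // exprMn !sqr_sqrtr //.
    apply: (@le_trans _ _ ((2 * k.+1)%:R)); first by rewrite ler_nat.
    by rewrite natrM ler_wpM2r // -natrX ler_nat.
  apply: ler_wpDl; first by rewrite mulr_ge0 // mulr_ge0 // invr_ge0 ltW.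
  rewrite ler_wpM2r ?invr_ge0 ?(ltW k0) // exprSr mulrC ler_pM ?(ltW (W0 _)) ?exprn_ge0 ?(ltW (W0 _)) //.
  rewrite /W iw_sqr // -[X in X <= _]mul1r ler_pdivrMr // mulrAC ler_pdivlMr ?mulr_gt0 ?ltr0n // mul1r.
  have : (n%:R : R) <= 2 * (n - k.+1)%:R.
    by rewrite -[2]/(2%:R) -natrM ler_nat; clear -h kn; lia.
  move=> h2; have : sg2 * n%:R <= sg2 * (2 * (n - k.+1)%:R) by rewrite ler_wpM2l // ltW.
  by move=> h3; apply: (le_trans h3); rewrite /tt; lra.
apply: (@le_trans _ _ (2 * sN^-1 * (iw t0 * (1 + 2 / sg2)) + iw t0 * (2 / (sg2 * n%:R)) * (2 * sN))).
  apply: le_trans (ler_sum _ (fun k _ => term k)) _.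
  rewrite big_split /= -!mulr_sumr; apply: lerD.
    rewrite ler_wpM2l ?mulr_ge0 ?invr_ge0 ?(ltW sn) //.
    rewrite (reindex_inj rev_ord_inj) /=.
    under eq_bigr => i _.
      have -> : (n - (n - i.+1).+1)%N = i by have := ltn_ord i; lia.
      over.
    exact: cubes.
  have i0 : 0 <= iw t0 by rewrite ltW // iw_gt0 // (lt_le_trans _ t1).
  by rewrite ler_wpM2l ?sum_invsqrt // mulr_ge0 // divr_ge0 // mulr_ge0 // ltW.
have nE : (n%:R : R) = sN ^+ 2 by rewrite sqr_sqrtr.
rewrite nE le_eqVlt; apply/orP; left; apply/eqP; field.
by rewrite !gt_eqF.
Qed.

Lemma sum_geo (q : R) : 0 <= q < 1 -> exists2 C : R, 0 < C & forall n : nat, (0 < n)%N ->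
  \sum_(k < n) q ^+ (n - k.+1) * (Num.sqrt (k.+1%:R))^-1 <= C * (Num.sqrt (n%:R : R))^-1.
Proof.
move=> /andP[q0 q1]; have p0 : 0 < 1 - q by rewrite subr_gt0.
exists ((1 - q)^-1 ^+ 2); first by rewrite exprn_gt0 // invr_gt0.
move=> n n0; have sn := sqrtn_gt0 n0.
have hs N : \sum_(j < N) q ^+ j * j.+1%:R <= (1 - q)^-1 ^+ 2.
  have E : (1 - q) ^+ 2 * (\sum_(j < N) q ^+ j * j.+1%:R) = 1 - N.+1%:R * q ^+ N + N%:R * q ^+ N.+1.
    elim: N => [|N ih]; first by rewrite big_ord0 mulr0 expr0; ring.
    rewrite big_ord_recr /= mulrDr ih !exprS -[N.+2%:R]natr1 -[N.+1%:R]natr1; ring.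
  rewrite exprVn -[X in _ <= X]mul1r ler_pdivlMr ?exprn_gt0 // mulrC E -addrA gerDl.
  rewrite addrC subr_le0 exprSr mulrA -mulrA -[X in _ <= X]mulrC.
  have h1 : (N%:R : R) <= N.+1%:R by rewrite ler_nat.
  have h2 : 0 <= q ^+ N by exact: exprn_ge0.
  have h3 : q ^+ N * q <= q ^+ N by rewrite ler_piMr // ltW.
  by rewrite [X in _ <= X]mulrC; apply: ler_pM => //; rewrite mulr_ge0.
rewrite (reindex_inj rev_ord_inj) /=.
apply: le_trans (ler_wpM2r _ (hs n)); last by rewrite invr_ge0 ltW.
rewrite mulr_suml; apply: ler_sum => i _.
have hi := ltn_ord i.
have -> : (n - (n - i.+1).+1)%N = i by clear -hi; lia.
rewrite -mulrA ler_wpM2l ?exprn_ge0 //.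
have k0 : 0 < Num.sqrt ((n - i.+1).+1%:R : R) by exact: sqrtn_gt0.
rewrite -[X in X <= _]mul1r ler_pdivrMr // mulrAC ler_pdivlMr // mul1r.
rewrite -(@ler_pXn2r _ 2) ?nnegrE ?(ltW sn) ?mulr_ge0 ?(ltW k0) // exprMn !sqr_sqrtr //.
rewrite -natrX -natrM ler_nat; clear -hi; nia.
Qed.

End Sums.

Section Auxiliary.
Context {R : realType}.

Lemma measurable_natb d (T : measurableType d) (b : T -> bool) :
  measurable_fun setT b -> measurable_fun setT (fun w => (b w)%:R : R).
Proof.
move=> mb.
have -> : (fun w => (b w)%:R : R) = fun w => if b w then 1 else 0.
  by apply/funext => w; case: (b w).
exact: measurable_fun_ifT.
Qed.

Lemma Phi_gap (a : R) : 0 <= Phi (a + 2) - Phi a /\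
  (`|a + 1| <= 1 -> 2 * gdens 2 <= Phi (a + 2) - Phi a).
Proof.
have a2 : a < a + 2 by rewrite ltrDl.
have [|c] := @MVT R (@Phi R) gdens a (a + 2) a2 (fun x _ => is_derive_Phi x).
  apply: derivable_within_continuous => x _.
  by have [] := is_derive_Phi x.
rewrite in_itv /= => /andP[c1 c2] ->; have -> : a + 2 - a = 2 by ring.
split; first by rewrite mulr_ge0 ?gdens_ge0.
rewrite ler_norml => h; rewrite mulrC ler_wpM2r // gdens_lb // ler_norml; lra.
Qed.

Lemma env_dyadic (J : nat) (z : R) :
  env z <= \sum_(j < J.+1) 4 * 4^-1 ^+ j * (`|z| <= 2 ^+ j)%R%:R + 4^-1 ^+ J.
Proof.
have q0 j : 0 <= 4 * 4^-1 ^+ j :> R by rewrite mulr_ge0 // exprn_ge0 // invr_ge0.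
elim: J => [|J ih].
  rewrite big_ord_recl big_ord0 /= !expr0 addr0 mulr1; apply: le_trans (env_le1 _) _.
  by rewrite lerDr mulr_ge0.
rewrite big_ord_recr /=; have [h|h] := leP `|z| (2 ^+ J.+1).
  apply: le_trans ih _; rewrite mulr1 exprS mulrA mulfV // mul1r -addrA lerD2l lerDl.
  by rewrite mulr_ge0 ?invr_ge0 // exprn_ge0 // invr_ge0.
rewrite mulr0 addr0; apply: (@le_trans _ _ (4^-1 ^+ J.+1)).
  rewrite /env exprVn lef_pV2 ?posrE ?exprn_gt0 ?ltr_pwDl ?sqr_ge0 //.
  have -> : 4 ^+ J.+1 = (2 ^+ J.+1) ^+ 2 :> R by rewrite -exprM mulnC exprM; congr (_ ^+ _); ring.
  rewrite -[z ^+ 2]real_normK ?num_real //.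
  have : (2 ^+ J.+1) ^+ 2 <= `|z| ^+ 2 :> R by rewrite lerXn2r ?nnegrE ?exprn_ge0 // ltW.
  lra.
by rewrite lerDr sumr_ge0 // => j _; rewrite mulr_ge0.
Qed.

Lemma invsqrtS (n : nat) : (0 < n)%N ->
  (Num.sqrt (n%:R : R))^-1 <= Num.sqrt 2 * (Num.sqrt (n.+1%:R))^-1.
Proof.
move=> n0; have s0 := sqrtn_gt0 (R := R) n0.
have s1 : 0 < Num.sqrt (n.+1%:R : R) by exact: sqrtn_gt0.
rewrite -[X in X <= _]mul1r ler_pdivrMr // mulrAC ler_pdivlMr // mul1r -sqrtrM //.
rewrite ler_wsqrtr // -[2]/(2%:R) -natrM ler_nat; clear -n0; lia.
Qed.

End Auxiliary.

(** * Lindeberg's method along a cocycle *)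
Section Lindeberg.
Context {R : realType} {dE dT : measure_display}.
Context {E : measurableType dE} {T : measurableType dT}.
Variable mu : probability E R.
Variables (step : E -> T -> T) (s : T -> R) (ell : E -> R).
Hypothesis mstep : measurable_fun setT (fun p : T * E => step p.2 p.1).
Hypothesis ms : measurable_fun setT s.
Hypothesis mell : measurable_fun setT ell.
Hypothesis ell1 : forall e, 1 <= ell e.
Hypothesis iell : mu.-integrable setT (EFin \o (fun e => ell e ^+ 8)).
Hypothesis sstep : forall e v, `|s (step e v) - s v| <= ell e.

Variables (lam sg2 kap : R) (u1 u2 u3 : T -> R) (Ku : R).
Hypothesis sg2_gt0 : 0 < sg2.
Hypothesis Ku1 : 1 <= Ku.
Hypotheses (mu1 : measurable_fun setT u1) (mu2 : measurable_fun setT u2)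
           (mu3 : measurable_fun setT u3).
Hypotheses (bu1 : forall v, `|u1 v| <= Ku) (bu2 : forall v, `|u2 v| <= Ku)
           (bu3 : forall v, `|u3 v| <= Ku).

Definition incr v e : R := s (step e v) - s v - lam.

Hypothesis eq_u1 : forall v, \int[mu]_e (incr v e + u1 (step e v)) = u1 v.
Hypothesis eq_u2 : forall v,
  \int[mu]_e (incr v e ^+ 2 / 2 + incr v e * u1 (step e v) + u2 (step e v)) =
  u2 v + sg2 / 2.
Hypothesis eq_u3 : forall v,
  \int[mu]_e (incr v e ^+ 3 / 6 + incr v e ^+ 2 / 2 * u1 (step e v) +
     incr v e * u2 (step e v) + u3 (step e v)) =
  u3 v + sg2 / 2 * u1 v + kap.

(** A function of the position x corrected by terms that depend on the
    direction v.  By the equations on u1, u2 and u3, averaging over one step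
    acts on it as if the increments had mean 0, variance sg2 and a third-order
    coefficient kap, whatever the direction. *)
Definition corr (D : nat -> R -> R) v x : R :=
  D 0%N x + u1 v * D 1%N x + u2 v * D 2%N x + u3 v * D 3%N x.

Let ca := 1 + `|lam|.
Let ca1 : 1 <= ca. Proof. by rewrite /ca lerDl. Qed.

Lemma incr_le v e : `|incr v e| <= ca * ell e.
Proof.
rewrite /incr /ca mulrDl mul1r; apply: le_trans (ler_normB _ _) _.
by rewrite lerD ?sstep // ler_peMr.
Qed.

Let mstep_v v : measurable_fun setT (step^~ v).
Proof. exact: (@measurable_fun_pair2 _ _ _ _ _ _ _ v mstep). Qed.

Lemma measurable_incr v : measurable_fun setT (incr v).
Proof.
apply: measurable_funB => //; apply: measurable_funB => //.
exact: measurableT_comp.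
Qed.

Let mcomp (f : T -> R) v : measurable_fun setT f -> measurable_fun setT (fun e => f (step e v)).
Proof. by move=> mf; exact: measurableT_comp. Qed.

Lemma incrX_le v e p q : (p <= q)%N -> `|incr v e| ^+ p <= ca ^+ q * ell e ^+ q.
Proof.
move=> pq; rewrite -exprMn; have h := incr_le v e.
have h1 : 1 <= ca * ell e.
  by apply: le_trans (ell1 e) _; rewrite ler_peMl // (le_trans ler01).
apply: (@le_trans _ _ ((ca * ell e) ^+ p)); last exact: ler_weXn2l.
by rewrite lerXn2r ?nnegrE // (le_trans ler01).
Qed.

Lemma integrable_moment v (p : nat) (f : T -> R) : (p <= 8)%N -> measurable_fun setT f ->
  (forall v, `|f v| <= Ku) ->
  mu.-integrable setT (EFin \o (fun e => incr v e ^+ p * f (step e v))).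
Proof.
move=> p8 mf bf; apply: (integrable_ell ell1 iell (p := p) (K := ca ^+ p * Ku)) => //.
  by apply: measurable_funM; [apply: measurable_funX; exact: measurable_incr | exact: mcomp].
move=> e; rewrite normrM normrX mulrAC; apply: ler_pM => //.
exact: incrX_le.
Qed.

(** Expanding each term to total order three, the moments of the increment and
    the correctors appear exactly in the combinations of the three equations. *)
Lemma taylor_step : exists2 K : R, 0 < K & forall (D : nat -> R -> R) (M : R) v (x : R), 0 <= M ->
  (forall i (x : R), is_derive x 1 (D i) (D i.+1 x)) ->
  (forall i, measurable_fun setT (D i)) ->
  (forall h t : R, 0 <= t <= 1 -> `|D 4%N (x + t * h)| <= M * (1 + h ^+ 2)) ->
  `|\int[mu]_e corr D (step e v) (x + incr v e) -
    (corr D v x + sg2 / 2 * (D 2%N x + u1 v * D 3%N x) + kap * D 3%N x)| <= K * M.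
Proof.
have LI := ellI_ge1 (mu := mu) ell1 iell.
have Ku0 : 0 <= Ku by exact: le_trans ler01 Ku1.
exists (8 * Ku * ca ^+ 6 * ellI mu ell).
  rewrite mulr_gt0 ?(lt_le_trans ltr01 LI) // mulr_gt0 ?exprn_gt0 ?(lt_le_trans ltr01 ca1) //.
  by rewrite mulr_gt0 // (lt_le_trans ltr01 Ku1).
move=> D M v x M0 hD mD hM.
pose a := incr v.
pose q1 e := a e + u1 (step e v).
pose q2 e := a e ^+ 2 / 2 + a e * u1 (step e v) + u2 (step e v).
pose q3 e := a e ^+ 3 / 6 + a e ^+ 2 / 2 * u1 (step e v) + a e * u2 (step e v) + u3 (step e v).
pose main e := D 0%N x + D 1%N x * q1 e + D 2%N x * q2 e + D 3%N x * q3 e.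
have one8 (v' : T) : `|(fun=> 1 : R) v'| <= Ku by rewrite normr1.
have m1 := @integrable_moment v _ (fun=> 1) _ (measurable_cst _) one8.
have iD (f g : E -> R) : mu.-integrable setT (EFin \o f) -> mu.-integrable setT (EFin \o g) ->
   mu.-integrable setT (EFin \o (fun e => f e + g e)).
  by move=> fi gi; have := integrableD measurableT fi gi; exact: eq_integrable.
have iZ c (f : E -> R) : mu.-integrable setT (EFin \o f) ->
   mu.-integrable setT (EFin \o (fun e => c * f e)).
  by move=> fi; have := integrableZl measurableT c fi; exact: eq_integrable.
have iext (f g : E -> R) : mu.-integrable setT (EFin \o f) -> f =1 g -> mu.-integrable setT (EFin \o g).
  by move=> fi fg; apply: eq_integrable fi => // e _ /=; rewrite fg.
have iq1 : mu.-integrable setT (EFin \o q1).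
  apply: iext (iD _ _ (m1 1%N isT) (@integrable_moment v 0%N u1 isT mu1 bu1)) _ => e.
  by rewrite /q1 -/a expr1 expr0 !(mulr1,mul1r).
have iq2 : mu.-integrable setT (EFin \o q2).
  apply: iext (iD _ _ (iD _ _ (iZ 2^-1 _ (m1 2%N isT)) (@integrable_moment v 1%N u1 isT mu1 bu1))
    (@integrable_moment v 0%N u2 isT mu2 bu2)) _ => e.
  by rewrite /q2 -/a expr1 expr0 !(mulr1,mul1r) [2^-1 * _]mulrC.
have iq3 : mu.-integrable setT (EFin \o q3).
  apply: iext (iD _ _ (iD _ _ (iD _ _ (iZ 6^-1 _ (m1 3%N isT))
    (iZ 2^-1 _ (@integrable_moment v 2%N u1 isT mu1 bu1)))
    (@integrable_moment v 1%N u2 isT mu2 bu2)) (@integrable_moment v 0%N u3 isT mu3 bu3)) _ => e.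
  by rewrite /q3 -/a expr1 expr0 !(mulr1,mul1r) [6^-1 * _]mulrC mulrA [2^-1 * _]mulrC.
have ic : mu.-integrable setT (EFin \o (fun _ : E => D 0%N x)).
  by apply: (integrable_ell ell1 iell (p := 0) (K := `|D 0%N x|)) => // e; rewrite mulr1.
have imain : mu.-integrable setT (EFin \o main).
  exact: iD (iD _ _ (iD _ _ ic (iZ _ _ iq1)) (iZ _ _ iq2)) (iZ _ _ iq3).
have Emain : \int[mu]_e main e =
    corr D v x + sg2 / 2 * (D 2%N x + u1 v * D 3%N x) + kap * D 3%N x.
  have E1 : \int[mu]_e q1 e = u1 v := eq_u1 v.
  have E2 : \int[mu]_e q2 e = u2 v + sg2 / 2 := eq_u2 v.
  have E3 : \int[mu]_e q3 e = u3 v + sg2 / 2 * u1 v + kap := eq_u3 v.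
  rewrite /main RintegralD //; [|exact: iD (iD _ _ ic (iZ _ _ iq1)) (iZ _ _ iq2)|exact: iZ].
  rewrite RintegralD //; [|exact: iD ic (iZ _ _ iq1)|exact: iZ].
  rewrite RintegralD //; [|exact: iZ].
  by rewrite !RintegralZl // E1 E2 E3 Rint_cst /corr; field.
rewrite -Emain -mulrA [ellI _ _ * M]mulrC mulrA.
have mcorr : measurable_fun setT (fun e => corr D (step e v) (x + a e)).
  have mxa i : measurable_fun setT (fun e => D i (x + a e)).
    apply: measurableT_comp => //; apply: measurable_funD => //; exact: measurable_incr.
  by rewrite /corr; do 3 ?[apply: measurable_funD => //; last by apply: measurable_funM => //; exact: mcomp].
have point e : `|corr D (step e v) (x + a e) - main e| <= 8 * Ku * ca ^+ 6 * M * ell e ^+ 6.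
  have T4 i (k : nat) : (i + k = 4)%N ->
      `|D i (x + a e) - \sum_(l < k) D (i + l)%N x * a e ^+ l / l`!%:R| <= M * (1 + a e ^+ 2) * `|a e| ^+ k.
    move=> ik; have := @taylor R (fun l => D (i + l)%N) x (a e) (M * (1 + a e ^+ 2)) k.
    rewrite addn0; apply=> [l t _|t t01]; first by rewrite addnS.
    by rewrite ik; exact: hM.
  have B k : (k <= 4)%N -> M * (1 + a e ^+ 2) * `|a e| ^+ k <= 2 * ca ^+ 6 * M * ell e ^+ 6.
    move=> k4; have h1 := @incrX_le v e k 6 (leq_trans k4 (isT : (4 <= 6)%N)).
    have h2 : `|incr v e| ^+ (k + 2) <= _ := @incrX_le v e (k + 2) 6 (leq_add k4 (leqnn 2)).
    rewrite -mulrA; apply: (@le_trans _ _ (M * (2 * (ca ^+ 6 * ell e ^+ 6)))).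
      rewrite ler_wpM2l // mulrDl mul1r -[a e ^+ 2]real_normK ?num_real // -exprD addnC -/a.
      rewrite mulr2n mulrDl mul1r; exact: lerD.
    by rewrite le_eqVlt; apply/orP; left; apply/eqP; ring.
  have t0 := T4 0%N 4%N erefl; have t1 := T4 1%N 3%N erefl.
  have t2 := T4 2%N 2%N erefl; have t3 := T4 3%N 1%N erefl.
  pose r0 := D 0%N (x + a e) - (D 0%N x + D 1%N x * a e + D 2%N x * (a e ^+ 2 / 2) + D 3%N x * (a e ^+ 3 / 6)).
  pose r1 := D 1%N (x + a e) - (D 1%N x + D 2%N x * a e + D 3%N x * (a e ^+ 2 / 2)).
  pose r2 := D 2%N (x + a e) - (D 2%N x + D 3%N x * a e).
  pose r3 := D 3%N (x + a e) - D 3%N x.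
  have f2 : (2`!)%:R = 2 :> R by [].
  have f3 : (3`!)%:R = 6 :> R by [].
  have hr0 : `|r0| <= 2 * ca ^+ 6 * M * ell e ^+ 6.
    apply: le_trans (B 4%N isT); move: t0.
    rewrite !big_ord_recl big_ord0 /= /bump /= !(add1n,addn0,add0n) f2 f3 expr0 expr1 !divr1 mulr1 addr0.
    by rewrite /r0 !addrA !mulrA.
  have hr1 : `|r1| <= 2 * ca ^+ 6 * M * ell e ^+ 6.
    apply: le_trans (B 3%N isT); move: t1.
    rewrite !big_ord_recl big_ord0 /= /bump /= !(add1n,addn0,add0n) f2 expr0 expr1 !divr1 mulr1 addr0.
    by rewrite /r1 !addrA !mulrA.
  have hr2 : `|r2| <= 2 * ca ^+ 6 * M * ell e ^+ 6.
    apply: le_trans (B 2%N isT); move: t2.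
    by rewrite !big_ord_recl big_ord0 /= /bump /= !(add1n,addn0,add0n) expr0 expr1 !divr1 mulr1 addr0.
  have hr3 : `|r3| <= 2 * ca ^+ 6 * M * ell e ^+ 6.
    apply: le_trans (B 1%N isT); move: t3.
    by rewrite !big_ord_recl big_ord0 /= /bump /= !(add1n,addn0,add0n) expr0 !divr1 mulr1 addr0.
  have -> : corr D (step e v) (x + a e) - main e =
     r0 + u1 (step e v) * r1 + u2 (step e v) * r2 + u3 (step e v) * r3.
    by rewrite /corr /main /q1 /q2 /q3 /r0 /r1 /r2 /r3; field.
  set B6 := 2 * ca ^+ 6 * M * ell e ^+ 6 in hr0 hr1 hr2 hr3.
  have B60 : 0 <= B6 by apply: le_trans hr0; exact: normr_ge0.
  have hm (u r : R) : `|u| <= Ku -> `|r| <= B6 -> `|u * r| <= Ku * B6.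
    by move=> hu hr; rewrite normrM ler_pM.
  have -> : 8 * Ku * ca ^+ 6 * M * ell e ^+ 6 = Ku * B6 + Ku * B6 + Ku * B6 + Ku * B6.
    by rewrite /B6; ring.
  apply: le_trans (ler_normD _ _) (lerD _ (hm _ _ (bu3 _) hr3)).
  apply: le_trans (ler_normD _ _) (lerD _ (hm _ _ (bu2 _) hr2)).
  apply: le_trans (ler_normD _ _) (lerD _ (hm _ _ (bu1 _) hr1)).
  by apply: le_trans hr0 _; rewrite ler_peMl.
have idiff : mu.-integrable setT (EFin \o (fun e => corr D (step e v) (x + a e) - main e)).
  apply: (integrable_ell ell1 iell (p := 6) (K := 8 * Ku * ca ^+ 6 * M)) point => //.
  apply: measurable_funB => //; apply/measurable_EFinP; by have /integrableP[] := imain.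
have icorr : mu.-integrable setT (EFin \o (fun e => corr D (step e v) (x + a e))).
  by apply: iext (iD _ _ idiff imain) _ => e; rewrite subrK.
rewrite -RintegralB //.
apply: (Rint_ell_norm mell ell1 iell (p := 6)) => //.
- by apply/measurable_EFinP; have /integrableP[] := idiff.
- by rewrite !mulr_ge0 ?exprn_ge0 // (le_trans ler01 ca1).
Qed.

Definition UD (b : nat) (tau : R) (j : nat) : R -> R := U (b + j) tau.

(** The heat equation turns a time derivative into half a second space
    derivative. *)
Lemma heat_step (b : nat) : (b <= 3)%N -> exists2 K : R, 0 < K & forall tau v x, 1 <= tau ->
  `|corr (UD b (tau + sg2)) v x -
    (corr (UD b tau) v x + sg2 / 2 * (UD b tau 2 x + u1 v * UD b tau 3 x))|
  <= K * (iw tau ^+ (b + 4) * env (x * iw tau)).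
Proof.
move=> b3; have [C C0 hC] := @U_bound R.
pose K0 := C * (1 + sg2) * (sg2 ^+ 2 + sg2).
have sg20 := ltW sg2_gt0.
have Ku0 : 0 <= Ku by exact: le_trans ler01 Ku1.
have K00 : 0 < K0.
  by rewrite mulr_gt0 // ?addr_gt0 ?exprn_gt0 // mulr_gt0 // ltr_wpDr.
exists (4 * Ku * K0); first by rewrite mulr_gt0 // mulr_gt0 // (lt_le_trans ltr01 Ku1).
move=> tau v x t1; have t0 : 0 < tau by exact: lt_le_trans t1.
set W := iw tau ^+ (b + 4) * env (x * iw tau).
have W0 : 0 <= W by rewrite mulr_ge0 ?env_ge0 // exprn_ge0 // ltW // iw_gt0.
have Ut j t : (b + 4 <= j <= 8)%N -> 0 <= t <= 1 -> `|U j (tau + t * sg2) x| <= C * (1 + sg2) * W.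
  move=> /andP[jb j8] t01; have /andP[th0 th1] := t01.
  have tt : 1 <= tau + t * sg2 by apply: le_trans t1 _; rewrite lerDl mulr_ge0.
  apply: le_trans (hC _ _ x _ tt) _; first by rewrite j8 andbT (leq_trans _ jb) // addn4.
  rewrite -!mulrA ler_wpM2l ?(ltW C0) //.
  apply: (@le_trans _ _ (iw tau ^+ (b + 4) * ((1 + sg2) * env (x * iw tau)))); last first.
    by rewrite le_eqVlt; apply/orP; left; apply/eqP; rewrite /W; ring.
  have iw0 : 0 <= iw (tau + t * sg2) by apply/ltW/iw_gt0; exact: lt_le_trans tt.
  apply: ler_pM; rewrite ?env_ge0 ?exprn_ge0 //; last exact: env_time.
  apply: le_trans (iwX_le tt jb) _; rewrite lerXn2r ?nnegrE ?(ltW (iw_gt0 t0)) //.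
  by apply: iw_le => //; rewrite lerDl mulr_ge0.
have tpos (t : R) : 0 <= t <= 1 -> 0 < tau + t * sg2.
  by move=> /andP[th0 th1]; rewrite ltr_wpDr // mulr_ge0.
have CW0 : 0 <= C * (1 + sg2) * W.
  by rewrite mulr_ge0 // mulr_ge0 ?(ltW C0) // addr_ge0.
have K0E : K0 * W = C * (1 + sg2) * W * sg2 ^+ 2 + C * (1 + sg2) * W * sg2 by rewrite /K0; ring.
(* The terms of order b and b + 1 need a second-order expansion in time; for the
   other two the first-order error is already small enough. *)
have P2 j : (b + 4 <= j + 4 <= 8)%N ->
    `|U j (tau + sg2) x - (U j tau x + sg2 / 2 * U j.+2 tau x)| <= K0 * W.
  move=> jj.
  pose F i (th : R) := 2^-1 ^+ i * U (j + i.*2) th x.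
  have hF i (t : R) : 0 <= t <= 1 -> is_derive (tau + t * sg2) 1 (F i) (F i.+1 (tau + t * sg2)).
    move=> t01; have -> : F i = (2^-1 ^+ i) *: (fun th => U (j + i.*2) th x) by [].
    apply: (is_derive_eq (is_deriveZ _ (is_derive_U_tau (j + i.*2) x (tpos t t01)))).
    by rewrite /GRing.scale /= /F exprSr -mulrA doubleS !addnS.
  have hM (t : R) : 0 <= t <= 1 -> `|F 2%N (tau + t * sg2)| <= C * (1 + sg2) * W.
    move=> t01; rewrite /F normrM.
    have := Ut (j + 4)%N t jj t01.
    have -> : (j + 2.*2 = j + 4)%N by [].
    move=> h; rewrite -[X in _ <= X]mul1r; apply: ler_pM => //.
    by rewrite ger0_norm ?exprn_ge0 // exprn_ile1 // invf_le1 // ler1n.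
  have := taylor hF hM; rewrite !big_ord_recl big_ord0 /= /F /bump /= !(expr0,expr1,mul1r,divr1,addr0,addn0,add1n).
  rewrite mulr1 (ger0_norm sg20) !addnS addn0 => h.
  rewrite K0E; apply: le_trans (ler_wpDr _ _); last exact: h; last by rewrite mulr_ge0.
  by rewrite le_eqVlt; apply/orP; left; apply/eqP; congr (`|_ - (_ + _)|); ring.
have P1 j : (b + 4 <= j + 2 <= 8)%N -> `|U j (tau + sg2) x - U j tau x| <= K0 * W.
  move=> jj.
  have hM (t : R) : 0 <= t <= 1 -> `|2^-1 * U j.+2 (tau + t * sg2) x| <= C * (1 + sg2) * W.
    move=> t01; rewrite normrM; have := Ut (j + 2)%N t jj t01; rewrite addn2 => h.
    rewrite -[X in _ <= X]mul1r; apply: ler_pM => //.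
    by rewrite ger0_norm ?invr_ge0 // invf_le1 // ler1n.
  have := @mean_value R (U j ^~ x) (fun th => 2^-1 * U j.+2 th x) tau sg2 _
    (fun t t01 => is_derive_U_tau j x (tpos t t01)) hM.
  rewrite (ger0_norm sg20) => h; rewrite K0E; apply: (le_trans h).
  by rewrite lerDr mulr_ge0 // sqr_ge0.
have q0 := P2 b; have q1 := P2 b.+1; have q2 := P1 b.+2; have q3 := P1 b.+3.
have {}q0 : `|U b (tau + sg2) x - (U b tau x + sg2 / 2 * U b.+2 tau x)| <= K0 * W.
  by apply: q0; clear -b3; lia.
have {}q1 : `|U b.+1 (tau + sg2) x - (U b.+1 tau x + sg2 / 2 * U b.+3 tau x)| <= K0 * W.
  by apply: q1; clear -b3; lia.
have {}q2 : `|U b.+2 (tau + sg2) x - U b.+2 tau x| <= K0 * W by apply: q2; clear -b3; lia.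
have {}q3 : `|U b.+3 (tau + sg2) x - U b.+3 tau x| <= K0 * W by apply: q3; clear -b3; lia.
rewrite /corr /UD !(addnS,addn0).
have -> : forall p0 p1 p2 p3 m0 m1 m2 m3 v1 v2 v3 : R,
  p0 + v1 * p1 + v2 * p2 + v3 * p3 - (m0 + v1 * m1 + v2 * m2 + v3 * m3 + sg2 / 2 * (m2 + v1 * m3))
  = (p0 - (m0 + sg2 / 2 * m2)) + v1 * (p1 - (m1 + sg2 / 2 * m3)) + v2 * (p2 - m2) + v3 * (p3 - m3).
  by move=> *; ring.
have KW0 : 0 <= K0 * W by rewrite mulr_ge0 // ltW.
have hm (u r : R) : `|u| <= Ku -> `|r| <= K0 * W -> `|u * r| <= Ku * (K0 * W).
  by move=> hu hr; rewrite normrM ler_pM.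
have -> : 4 * Ku * K0 * W = Ku * (K0 * W) + Ku * (K0 * W) + Ku * (K0 * W) + Ku * (K0 * W) by ring.
apply: le_trans (ler_normD _ _) (lerD _ (hm _ _ (bu3 _) q3)).
apply: le_trans (ler_normD _ _) (lerD _ (hm _ _ (bu2 _) q2)).
apply: le_trans (ler_normD _ _) (lerD _ (hm _ _ (bu1 _) q1)).
by apply: le_trans q0 _; rewrite ler_peMl.
Qed.

(** The variance term of the expansion in space cancels against the expansion
    in time; the term in kap remains, of order three in 1 / sqrt tau. *)
Lemma corr_step (b : nat) : (b <= 3)%N -> exists2 K : R, 0 < K & forall tau v x, 1 <= tau ->
  `|\int[mu]_e corr (UD b tau) (step e v) (x + incr v e) -
    (corr (UD b (tau + sg2)) v x + kap * UD b tau 3 x)|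
  <= K * (iw tau ^+ (b + 4) * env (x * iw tau)).
Proof.
move=> b3; have [K1 K10 h1] := heat_step b3; have [K2 K20 h2] := taylor_step.
have [C C0 hC] := @U_bound R.
exists (K1 + K2 * (2 * C)); first by rewrite addr_gt0 // mulr_gt0 // mulr_gt0.
move=> tau v x t1; have t0 : 0 < tau by exact: lt_le_trans t1.
have {}h1 := h1 tau v x t1.
set W := iw tau ^+ (b + 4) * env (x * iw tau) in h1 *.
have W0 : 0 <= W by rewrite mulr_ge0 ?env_ge0 // exprn_ge0 // ltW // iw_gt0.
have hD i (y : R) : is_derive y 1 (UD b tau i) (UD b tau i.+1 y).
  by rewrite /UD addnS; exact: is_derive_U.
have hM h t : 0 <= t <= 1 -> `|UD b tau 4 (x + t * h)| <= 2 * C * W * (1 + h ^+ 2).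
  move=> t01; rewrite /UD; apply: le_trans (hC _ _ _ _ t1) _.
    by rewrite addn4 /= -addn4 (leq_trans (leq_add b3 (leqnn 4))).
  apply: le_trans (ler_wpM2l _ (env_space x h t1 t01)) _.
    by rewrite mulr_ge0 ?(ltW C0) // exprn_ge0 // ltW // iw_gt0.
  by rewrite le_eqVlt; apply/orP; left; apply/eqP; rewrite /W; ring.
have M0 : 0 <= 2 * C * W by rewrite mulr_ge0 // mulr_ge0 // ltW.
have mD i : measurable_fun setT (UD b tau i) by exact: measurable_U.
have {}h2 := h2 (UD b tau) _ v x M0 hD mD hM.
have -> : (K1 + K2 * (2 * C)) * W = K1 * W + K2 * (2 * C * W) by ring.
move: h1 h2; rewrite !ler_norml; lra.
Qed.

Local Notation Pn := (Pn mu step).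
Local Notation Pop := (Pop mu step).
Local Notation adm := (adm s).

Definition pos (k : nat) (y : R) (v : T) : R := s v - k%:R * lam - y.
Definition ev k y om v : R := env (pos k y v * om).

Lemma pos_step k y e v : pos k.+1 y (step e v) = pos k y v + incr v e.
Proof. by rewrite /pos /incr -natr1; ring. Qed.

Lemma measurable_pos k y : measurable_fun setT (pos k y).
Proof. by apply: measurable_funB => //; exact: measurable_funB. Qed.

Lemma adm_ev k y om : adm (ev k y om).
Proof.
apply: (@adm_bounded _ _ _ s _ 1).
  apply: measurableT_comp; first exact: measurable_env.
  by apply: measurable_funM => //; exact: measurable_pos.
by move=> v; rewrite ger0_norm ?env_ge0 ?env_le1.
Qed.

Lemma U_time : exists2 C : R, 0 < C & forall i j tau sg t (x : R), (i <= j)%N -> (0 < j <= 8)%N ->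
  1 <= tau -> 0 <= sg -> 0 <= t <= 1 ->
  `|U j (tau + t * sg) x| <= C * (1 + sg) * (iw tau ^+ i * env (x * iw tau)).
Proof.
have [C C0 hC] := @U_bound R; exists C => // i j tau sg t x ij j8 t1 sg0 t01.
have t0 : 0 < tau by exact: lt_le_trans t1.
have /andP[th0 th1] := t01.
have tt : 1 <= tau + t * sg by apply: le_trans t1 _; rewrite lerDl mulr_ge0.
apply: le_trans (hC _ _ x j8 tt) _.
rewrite -!mulrA ler_wpM2l ?(ltW C0) //.
rewrite mulrCA.
have iw0 : 0 <= iw (tau + t * sg) by apply/ltW/iw_gt0; exact: lt_le_trans tt.
apply: ler_pM; rewrite ?env_ge0 ?exprn_ge0 //; last exact: env_time.
apply: le_trans (iwX_le tt ij) _; rewrite lerXn2r ?nnegrE ?(ltW (iw_gt0 t0)) //.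
by apply: iw_le => //; rewrite lerDl mulr_ge0.
Qed.

Lemma corr_bound : exists2 C : R, 0 < C & forall b tau v (x : R), (b <= 3)%N -> 1 <= tau ->
  `|corr (UD b tau) v x - U b tau x| <= C * (iw tau ^+ b.+1 * env (x * iw tau)).
Proof.
have Ku0 : 0 <= Ku by exact: le_trans ler01 Ku1.
have [C C0 hC] := @U_bound R; exists (3 * Ku * C).
  by rewrite mulr_gt0 // mulr_gt0 // (lt_le_trans ltr01 Ku1).
move=> b tau v x b3 t1; have t0 : 0 < tau by exact: lt_le_trans t1.
set W := _ * env _.
have hU (j : nat) (u : R) : (b.+1 <= j <= b.+3)%N -> `|u| <= Ku -> `|u * U j tau x| <= Ku * (C * W).
  move=> jb hu; rewrite normrM; apply: ler_pM => //.
  apply: le_trans (hC _ _ _ _ t1) _; first by clear -jb b3; lia.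
  rewrite -mulrA ler_wpM2l ?(ltW C0) // ler_wpM2r ?env_ge0 //.
  by apply: iwX_le => //; clear -jb; lia.
have -> : corr (UD b tau) v x - U b tau x =
    u1 v * U b.+1 tau x + (u2 v * U b.+2 tau x + u3 v * U b.+3 tau x).
  by rewrite /corr /UD !(addnS,addn0); ring.
have -> : 3 * Ku * C * W = Ku * (C * W) + (Ku * (C * W) + Ku * (C * W)) by ring.
apply: le_trans (ler_normD _ _) (lerD (hU _ _ _ (bu1 v)) _); first by rewrite leqnn /= leqW.
apply: le_trans (ler_normD _ _) (lerD (hU _ _ _ (bu2 v)) (hU _ _ _ (bu3 v))).
- by rewrite !leqnSn.
- by rewrite leqnn andbT leqW.
Qed.

Lemma adm_U b tau k y : (b <= 8)%N -> 1 <= tau -> adm (fun v => U b tau (pos k y v)).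
Proof.
move=> b8 t1; have [C C0 hC] := @U_bound R.
apply: (@adm_bounded _ _ _ s _ (1 + C)).
  by apply: measurableT_comp; [exact: measurable_U | exact: measurable_pos].
move=> v; case: b b8 => [|b] b8; first by apply: le_trans (U0_norm _ _) _; rewrite lerDl ltW.
apply: le_trans (hC _ _ _ _ t1) _ => //; apply: (@le_trans _ _ C); last by rewrite lerDr.
rewrite -mulrA ler_piMr ?(ltW C0) // mulr_ile1 ?env_ge0 ?env_le1 //.
  by rewrite exprn_ge0 // ltW // iw_gt0 // (lt_le_trans _ t1).
by rewrite exprn_ile1 ?iw_le1 // ltW // iw_gt0 // (lt_le_trans _ t1).
Qed.

Lemma adm_corr b tau k y : (b <= 3)%N -> 1 <= tau ->
  adm (fun v => corr (UD b tau) v (pos k y v)).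
Proof.
move=> b3 t1; have [C C0 hC] := corr_bound.
have -> : (fun v => corr (UD b tau) v (pos k y v)) =
  fun v => (corr (UD b tau) v (pos k y v) - U b tau (pos k y v)) + U b tau (pos k y v).
  by apply/funext => v; rewrite subrK.
apply: admD; last by apply: adm_U => //; exact: leq_trans b3 _.
apply: (@adm_bounded _ _ _ s _ C).
  have mUp i : measurable_fun setT (fun v => UD b tau i (pos k y v)).
    by apply: measurableT_comp; [exact: measurable_U | exact: measurable_pos].
  apply: measurable_funB; last by have := mUp 0%N; rewrite /UD addn0.
  rewrite /corr; do 3 ?[apply: measurable_funD => //; last by apply: measurable_funM].
move=> v; apply: le_trans (hC b tau v _ b3 t1) _.
have w0 : 0 <= iw tau by rewrite ltW // iw_gt0 // (lt_le_trans _ t1).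
by rewrite ler_piMr ?(ltW C0) // mulr_ile1 ?env_ge0 ?env_le1 ?exprn_ge0 // exprn_ile1 ?iw_le1.
Qed.

Let tt (t0 : R) (m : nat) := t0 + sg2 * m%:R.

Let tt1 t0 m : 1 <= t0 -> 1 <= tt t0 m.
Proof. by move=> t1; apply: le_trans t1 _; rewrite lerDl mulr_ge0 // ltW. Qed.

Let ttS t0 m : tt t0 m.+1 = tt t0 m + sg2.
Proof. by rewrite /tt -addrA -natr1 mulrDr mulr1. Qed.

Let tt_iw t0 (m : nat) : 1 <= t0 -> m%:R * iw (tt t0 m) ^+ 2 <= sg2^-1.
Proof.
move=> t1; have := tt1 m t1 => h; have h0 : 0 < tt t0 m by exact: lt_le_trans h.
rewrite iw_sqr // ler_pdivrMr // mulrC ler_pdivlMr // mulrC /tt.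
by rewrite lerDr; exact: le_trans t1.
Qed.

(** The third-order terms in kap left by the n - k remaining steps are
    compensated by a multiple of the third derivative, itself a solution of the
    heat equation. *)
Definition lind t0 n y k v : R :=
  corr (UD 0 (tt t0 (n - k))) v (pos k y v) +
  (n - k)%:R * kap * corr (UD 3 (tt t0 (n - k))) v (pos k y v).

Lemma lind_step : exists2 K : R, 0 < K & forall t0 n y k v, 1 <= t0 -> (k < n)%N ->
  `|Pop (lind t0 n y k.+1) v - lind t0 n y k v| <=
  K * iw (tt t0 (n - k.+1)) ^+ 4 * ev k y (iw (tt t0 (n - k.+1))) v.
Proof.
have [K0 K00 h0] := corr_step (isT : (0 <= 3)%N).
have [K3 K30 h3] := corr_step (isT : (3 <= 3)%N).
have [C C0 hC] := U_time; have [B B0 hB] := corr_bound.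
have sg0 := ltW sg2_gt0.
have r0 : 0 <= sg2^-1 by rewrite invr_ge0.
pose K := K0 + `|kap| * sg2^-1 * K3 + `|kap| * (C * (1 + sg2) * sg2 + B * (1 + sg2)) + `|kap| ^+ 2 * sg2^-1 * (C * (1 + sg2)).
have sg10 : 0 <= 1 + sg2 by exact: addr_ge0.
have K_0 : 0 < K.
  rewrite /K -!addrA ltr_wpDr // !addr_ge0 // mulr_ge0 ?(ltW K30) ?mulr_ge0 ?exprn_ge0 //.
  - by rewrite addr_ge0 // ?mulr_ge0 // ?mulr_ge0 // ltW.
  - by rewrite ltW.
exists K => // t0 n y k v t1 kn.
set m := (n - k.+1)%N; set tau := tt t0 m.
have tau1 : 1 <= tau by exact: tt1.
have w0 : 0 <= iw tau by rewrite ltW // iw_gt0 // (lt_le_trans _ tau1).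
rewrite /lind -/m.
have -> : (n - k = m.+1)%N by rewrite /m subnSK.
rewrite ttS -/tau.
set x := pos k y v.
have -> : Pop (fun v => corr (UD 0 tau) v (pos k.+1 y v) + m%:R * kap * corr (UD 3 tau) v (pos k.+1 y v)) v =
  \int[mu]_e corr (UD 0 tau) (step e v) (x + incr v e) +
  m%:R * kap * \int[mu]_e corr (UD 3 tau) (step e v) (x + incr v e).
  have popE b : Pop (fun v => corr (UD b tau) v (pos k.+1 y v)) v =
      \int[mu]_e corr (UD b tau) (step e v) (x + incr v e).
    by apply: eq_Rintegral => e _; rewrite pos_step.
  have a0 := adm_corr k.+1 y (isT : (0 <= 3)%N) tau1.
  have a3 := adm_corr k.+1 y (isT : (3 <= 3)%N) tau1.
  rewrite (PopD mstep ell1 iell sstep a0 (admZ _ a3)) (PopZ mstep ell1 iell sstep _ a3).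
  by rewrite !popE.
have {}h0 := h0 tau v x tau1; have {}h3 := h3 tau v x tau1.
set I0 := \int[mu]_e _ in h0 *; set I3 := \int[mu]_e _ in h3 *.
set H0 := corr (UD 0 (tau + sg2)) v x in h0 *; set H3 := corr (UD 3 (tau + sg2)) v x in h3 *.
have hm : m%:R * iw tau ^+ 2 <= sg2^-1 by exact: tt_iw.
set e0 := env (x * iw tau) in h0 h3.
have e00 : 0 <= e0 by exact: env_ge0.
have -> : K * iw tau ^+ 4 * ev k y (iw tau) v = K * (iw tau ^+ 4 * e0) by rewrite /ev -/x -/e0 mulrA.
set W := iw tau ^+ 4 * e0.
have W0 : 0 <= W by rewrite mulr_ge0 // exprn_ge0.
have mW p (q : R) : (6 <= p)%N -> 0 <= q -> m%:R * (q * (iw tau ^+ p * e0)) <= q * sg2^-1 * W.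
  move=> p6 q0.
  have -> : m%:R * (q * (iw tau ^+ p * e0)) = q * (m%:R * iw tau ^+ p) * e0 by ring.
  have -> : q * sg2^-1 * W = q * (sg2^-1 * iw tau ^+ 4) * e0 by rewrite /W; ring.
  rewrite ler_wpM2r // ler_wpM2l //.
  apply: (@le_trans _ _ (m%:R * iw tau ^+ 6)); first by rewrite ler_wpM2l // iwX_le.
  by rewrite (exprD _ 2 4) mulrA ler_wpM2r // exprn_ge0.
have b3 : `|m%:R * kap * (I3 - (H3 + kap * UD 3 tau 3 x))| <= `|kap| * sg2^-1 * K3 * W.
  rewrite normrM normrM normr_nat; apply: le_trans (ler_wpM2l _ h3) _; first by rewrite mulr_ge0.
  have := @mW 7%N (`|kap| * K3) isT (mulr_ge0 (normr_ge0 _) (ltW K30)).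
  by rewrite !mulrA => h; apply: le_trans h _; rewrite le_eqVlt; apply/orP; left; apply/eqP; ring.
have b6 : `|m%:R * kap * (kap * UD 3 tau 3 x)| <= `|kap| ^+ 2 * sg2^-1 * (C * (1 + sg2)) * W.
  have hU := hC 6%N 6%N tau sg2 0 x isT isT tau1 sg0.
  rewrite lexx ler01 mul0r addr0 in hU; have {}hU := hU isT.
  rewrite !normrM normr_nat /UD.
  have := @mW 6%N (`|kap| ^+ 2 * (C * (1 + sg2))) isT (mulr_ge0 (exprn_ge0 _ (normr_ge0 _)) (mulr_ge0 (ltW C0) sg10)).
  move=> h; apply: (@le_trans _ _ (m%:R * (`|kap| ^+ 2 * (C * (1 + sg2)) * (iw tau ^+ 6 * e0)))).
    have -> : m%:R * `|kap| * (`|kap| * `|U (3 + 3) tau x|) = m%:R * `|kap| ^+ 2 * `|U 6 tau x| by rewrite /=; ring.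
    have -> : m%:R * (`|kap| ^+ 2 * (C * (1 + sg2)) * (iw tau ^+ 6 * e0)) =
      m%:R * `|kap| ^+ 2 * (C * (1 + sg2) * (iw tau ^+ 6 * e0)) by ring.
    by rewrite ler_wpM2l // mulr_ge0 // exprn_ge0.
  by apply: (le_trans h); rewrite le_eqVlt; apply/orP; left; apply/eqP; ring.
have bU : `|kap * (UD 0 tau 3 x - H3)| <= `|kap| * (C * (1 + sg2) * sg2 + B * (1 + sg2)) * W.
  rewrite normrM -mulrA ler_wpM2l //.
  have tpos t : 0 <= t <= 1 -> 0 < tau + t * sg2.
    by move=> /andP[t0' _]; rewrite ltr_wpDr ?mulr_ge0 // (lt_le_trans _ tau1).
  have hM (t : R) : 0 <= t <= 1 -> `|2^-1 * U 5 (tau + t * sg2) x| <= C * (1 + sg2) * W.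
    move=> t01; rewrite normrM; have := hC 4%N 5%N tau sg2 t x isT isT tau1 sg0 t01.
    move=> h; rewrite -[X in _ <= X]mul1r; apply: ler_pM => //.
    by rewrite ger0_norm ?invr_ge0 // invf_le1 // ler1n.
  have := @mean_value R (U 3 ^~ x) (fun th => 2^-1 * U 5 th x) tau sg2 _
    (fun t t01 => is_derive_U_tau 3 x (tpos t t01)) hM.
  rewrite (ger0_norm sg0) => hT.
  have ts1 : 1 <= tau + sg2 by apply: le_trans tau1 _; rewrite lerDl.
  have hB3 : `|H3 - U 3 (tau + sg2) x| <= B * (1 + sg2) * W.
    apply: le_trans (hB 3%N _ v x isT ts1) _; rewrite -[X in _ <= X]mulrA ler_wpM2l ?(ltW B0) //.
    rewrite /W mulrCA; apply: ler_pM.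
    - by rewrite exprn_ge0 // ltW // iw_gt0 // (lt_le_trans _ ts1).
    - exact: env_ge0.
    - rewrite lerXn2r ?nnegrE //; first by rewrite ltW // iw_gt0 // (lt_le_trans _ ts1).
      by apply: iw_le; rewrite ?lerDl // (lt_le_trans _ tau1).
    have := @env_time R x tau sg2 1 tau1 sg0; rewrite lexx ler01 mul1r; exact.
  have -> : UD 0 tau 3 x - H3 = - (U 3 (tau + sg2) x - U 3 tau x) - (H3 - U 3 (tau + sg2) x).
    by rewrite /UD; ring.
  apply: le_trans (ler_normB _ _) _; rewrite normrN mulrDl; apply: lerD => //.
  by apply: le_trans hT _; rewrite mulrAC.
have -> : I0 + m%:R * kap * I3 - (H0 + m.+1%:R * kap * H3) =
  (I0 - (H0 + kap * UD 0 tau 3 x)) + m%:R * kap * (I3 - (H3 + kap * UD 3 tau 3 x)) +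
  kap * (UD 0 tau 3 x - H3) + m%:R * kap * (kap * UD 3 tau 3 x).
  by rewrite -natr1; ring.
have -> : K * W = K0 * W + `|kap| * sg2^-1 * K3 * W +
  `|kap| * (C * (1 + sg2) * sg2 + B * (1 + sg2)) * W +
  `|kap| ^+ 2 * sg2^-1 * (C * (1 + sg2)) * W by rewrite /K; ring.
apply: le_trans (ler_normD _ _) (lerD _ b6).
apply: le_trans (ler_normD _ _) (lerD _ bU).
by apply: le_trans (ler_normD _ _) (lerD h0 b3).
Qed.

(** The law of the centred walk, smoothed by a Gaussian of variance t0, is
    compared with the heat kernel. *)
Lemma lindeberg : exists2 K : R, 0 < K & forall t0 n y v, 1 <= t0 ->
  `|Pn n (fun w => U 0 t0 (pos n y w)) v - U 0 (tt t0 n) (pos 0 y v)| <=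
  K * (iw (tt t0 n) + iw t0 * Pn n (ev n y (iw t0)) v +
       \sum_(k < n) iw (tt t0 (n - k.+1)) ^+ 4 * Pn k (ev k y (iw (tt t0 (n - k.+1)))) v).
Proof.
have [K1 K10 h1] := lind_step; have [B B0 hB] := corr_bound.
have [C C0 hC] := @U_bound R.
have r0 : 0 <= sg2^-1 by rewrite invr_ge0 ltW.
exists (K1 + B + `|kap| * sg2^-1 * (B + C)).
  by rewrite ltr_wpDr ?addr_gt0 // mulr_ge0 ?mulr_ge0 // ltW // addr_gt0.
move=> t0 n y v t1.
set K := _ + _ + _.
have tn1 := tt1 n t1.
have wn0 : 0 <= iw (tt t0 n) by rewrite ltW // iw_gt0 // (lt_le_trans _ tn1).
have w00 : 0 <= iw t0 by rewrite ltW // iw_gt0 // (lt_le_trans _ t1).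
have aV k : adm (lind t0 n y k).
  by apply: admD; [exact: adm_corr (tt1 _ t1) | apply: admZ; exact: adm_corr (tt1 _ t1)].
pose e k v := K1 * iw (tt t0 (n - k.+1)) ^+ 4 * ev k y (iw (tt t0 (n - k.+1))) v.
have ae k : adm (e k) by apply: admZ; exact: adm_ev.
have hT := telescope_Pn mstep mell ell1 iell sstep v aV ae (fun k w kn => h1 t0 n y k w t1 kn).
have {hT} hT : `|Pn n (lind t0 n y n) v - lind t0 n y 0 v| <= K1 *
   \sum_(k < n) iw (tt t0 (n - k.+1)) ^+ 4 * Pn k (ev k y (iw (tt t0 (n - k.+1)))) v.
  apply: le_trans hT _; rewrite mulr_sumr; apply: ler_sum => k _.
  by rewrite /e (PnZ mstep mell ell1 iell sstep _ _ (adm_ev _ _ _)) -mulrA.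
have aU : adm (fun w => U 0 t0 (pos n y w)) by exact: adm_U.
have hend : `|Pn n (lind t0 n y n) v - Pn n (fun w => U 0 t0 (pos n y w)) v| <=
    B * (iw t0 * Pn n (ev n y (iw t0)) v).
  have := PnB mstep mell ell1 iell sstep n (aV n) aU => /(congr1 (fun f => f v)) <-.
  have -> : B * (iw t0 * Pn n (ev n y (iw t0)) v) = Pn n (fun w => B * iw t0 * ev n y (iw t0) w) v.
    by rewrite (PnZ mstep mell ell1 iell sstep _ _ (adm_ev _ _ _)) mulrA.
  apply: (Pn_norm mstep mell ell1 iell sstep); [exact: admB | apply: admZ; exact: adm_ev |].
  move=> w; rewrite /lind subnn mul0r mul0r addr0 /tt mulr0 addr0 -mulrA.
  by have := hB 0%N t0 w (pos n y w) isT t1; rewrite expr1.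
have hbeg : `|lind t0 n y 0 v - U 0 (tt t0 n) (pos 0 y v)| <= (B + `|kap| * sg2^-1 * (B + C)) * iw (tt t0 n).
  rewrite /lind subn0 addrAC mulrDl; set x := pos 0 y v.
  apply: le_trans (ler_normD _ _) (lerD _ _).
    apply: le_trans (hB 0%N _ v x isT tn1) _.
    by rewrite expr1 ler_wpM2l ?(ltW B0) // ler_piMr // env_le1.
  rewrite normrM normrM normr_nat.
  have h3 : `|corr (UD 3 (tt t0 n)) v x| <= (B + C) * iw (tt t0 n) ^+ 3.
    have -> : corr (UD 3 (tt t0 n)) v x = (corr (UD 3 (tt t0 n)) v x - U 3 (tt t0 n) x) + U 3 (tt t0 n) x by rewrite subrK.
    rewrite mulrDl; apply: le_trans (ler_normD _ _) (lerD _ _).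
      apply: le_trans (hB 3%N _ v x isT tn1) _; rewrite ler_wpM2l ?(ltW B0) //.
      apply: (@le_trans _ _ (iw (tt t0 n) ^+ 4)); last exact: iwX_le.
      by rewrite ler_piMr ?env_le1 ?exprn_ge0.
    apply: le_trans (hC _ _ _ _ tn1) _ => //.
    by rewrite ler_piMr ?env_le1 // mulr_ge0 ?exprn_ge0 // ltW.
  apply: le_trans (ler_wpM2l _ h3) _; first by rewrite mulr_ge0.
  have hm := tt_iw n t1.
  have -> : n%:R * `|kap| * ((B + C) * iw (tt t0 n) ^+ 3) =
     (n%:R * iw (tt t0 n) ^+ 2) * (`|kap| * (B + C) * iw (tt t0 n)) by ring.
  have -> : `|kap| * sg2^-1 * (B + C) * iw (tt t0 n) = sg2^-1 * (`|kap| * (B + C) * iw (tt t0 n)) by ring.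
  by rewrite ler_wpM2r // !mulr_ge0 // addr_ge0 ?(ltW B0) ?(ltW C0).
set S := \sum_(k < n) _ in hT *.
set X := Pn n (lind _ _ _ _) v in hT hend; set Y := lind _ _ _ 0 v in hT hbeg.
set Z := Pn n (fun w => _) v in hend *.
have Pe0 k om : 0 <= Pn k (ev k y om) v.
  rewrite -[X in X <= _](congr1 (fun f => f v) (Pn_cst mu step k 0)).
  by apply: (Pn_le mstep mell ell1 iell sstep) => //; [exact: adm_cst | exact: adm_ev | move=> w; exact: env_ge0].
have S0 : 0 <= S.
  apply: sumr_ge0 => k _; rewrite mulr_ge0 // exprn_ge0 // ltW // iw_gt0 //.
  exact: lt_le_trans (tt1 _ t1).
have kk : 0 <= `|kap| * sg2^-1 * (B + C) by rewrite !mulr_ge0 // addr_ge0 // ltW.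
have T0 : 0 <= iw t0 * Pn n (ev n y (iw t0)) v by rewrite mulr_ge0.
have -> : Z - U 0 (tt t0 n) (pos 0 y v) = (X - Y) - (X - Z) + (Y - U 0 (tt t0 n) (pos 0 y v)) by ring.
apply: le_trans (ler_normD _ _) _.
apply: le_trans (lerD (ler_normB _ _) (lexx _)) _.
apply: le_trans (lerD (lerD hT hend) hbeg) _.
rewrite /K; set TT := iw t0 * _ in T0 *; set kap' := `|kap| * _ * _ in kk *.
have := mulr_ge0 kk T0; have := mulr_ge0 kk S0; have := mulr_ge0 (ltW B0) S0; have := mulr_ge0 (ltW K10) wn0;
 have := mulr_ge0 (ltW K10) T0. lra.
Qed.

Let Pn_mono n F G : adm F -> adm G -> (forall v, F v <= G v) -> forall v, Pn n F v <= Pn n G v :=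
  @Pn_le _ _ _ _ _ mu step s ell mstep mell ell1 iell sstep n F G.

Let PZ n c F : adm F -> Pn n (fun v => c * F v) = fun v => c * Pn n F v :=
  @PnZ _ _ _ _ _ mu step s ell mstep mell ell1 iell sstep n c F.
Let PD n F G : adm F -> adm G -> Pn n (fun v => F v + G v) = fun v => Pn n F v + Pn n G v :=
  @PnD _ _ _ _ _ mu step s ell mstep mell ell1 iell sstep n F G.
Let PB n F G : adm F -> adm G -> Pn n (fun v => F v - G v) = fun v => Pn n F v - Pn n G v :=
  @PnB _ _ _ _ _ mu step s ell mstep mell ell1 iell sstep n F G.
Let Pnorm n F G : adm F -> adm G -> (forall v, `|F v| <= G v) -> forall v, `|Pn n F v| <= Pn n G v :=
  @Pn_norm _ _ _ _ _ mu step s ell mstep mell ell1 iell sstep n F G.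

Definition ind (L : R) k y w : R := (`|pos k y w| <= L)%R%:R.

Lemma adm_ind L k y : adm (ind L k y).
Proof.
apply: (@adm_bounded _ _ _ s _ 1); last by move=> w; rewrite /ind; case: (`|_| <= L); rewrite ?normr1 ?normr0.
apply: measurable_natb; apply: measurable_fun_ler => //.
apply: measurableT_comp => //; exact: measurable_pos.
Qed.

Lemma adm_half k y : adm (fun w => (pos k y w <= 0)%R%:R).
Proof.
apply: (@adm_bounded _ _ _ s _ 1); last by move=> w; case: (pos k y w <= 0); rewrite ?normr1 ?normr0.
by apply: measurable_natb; apply: measurable_fun_ler => //; exact: measurable_pos.
Qed.

Lemma ind_cover k v L q : 0 < L -> (forall y, Pn k (ind L k y) v <= q) ->
  forall N y, Pn k (ind (N.+1%:R * L) k y) v <= N.+1%:R * q.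
Proof.
move=> L0 hq; elim => [|N ih] y; first by rewrite !mul1r.
apply: (@le_trans _ _ (Pn k (fun w => ind (N.+1%:R * L) k (y - L) w + ind L k (y + N.+1%:R * L) w) v)).
  apply: Pn_mono; [exact: adm_ind | by apply: admD; exact: adm_ind |].
  move=> w; rewrite /ind.
  have -> : pos k (y - L) w = pos k y w + L by rewrite /pos; ring.
  have -> : pos k (y + N.+1%:R * L) w = pos k y w - N.+1%:R * L by rewrite /pos; ring.
  move: (pos k y w) => x; rewrite -[N.+2%:R]natr1 mulrDl mul1r.
  have NL : 0 <= N.+1%:R * L by rewrite mulr_ge0 // ltW.
  have [h|//] := boolP (`|x| <= _); last by rewrite addr_ge0.
  have [h1|h1] := boolP (`|x + L| <= _); first by rewrite lerDl.
  have [h2|h2] := boolP (`|x - _| <= _); first by rewrite lerDr.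
  by exfalso; move: h h1 h2; rewrite !ler_norml !negb_and -!ltNge; lra.
rewrite (PD _ (adm_ind _ _ _) (adm_ind _ _ _)) -[N.+2%:R]natr1 mulrDl mul1r.
exact: lerD.
Qed.

Lemma ind_wide k v L q rho : 0 < L -> L <= rho -> 0 <= q -> (forall y, Pn k (ind L k y) v <= q) ->
  forall y, Pn k (ind rho k y) v <= 2 * (rho / L) * q.
Proof.
move=> L0 Lr q0 hq y.
have r0 : 1 <= rho / L by rewrite ler_pdivlMr // mul1r.
have r00 : 0 <= rho / L by exact: le_trans r0.
have /andP[h1 h2] := Num.Theory.truncn_itv r00.
set N := Num.truncn _ in h1 h2.
apply: (@le_trans _ _ (Pn k (ind (N.+1%:R * L) k y) v)).
  apply: Pn_mono; [exact: adm_ind | exact: adm_ind |].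
  move=> w; rewrite /ind; have [h|//] := boolP (`|pos k y w| <= rho).
  have -> // : `|pos k y w| <= N.+1%:R * L by apply: (le_trans h); rewrite -ler_pdivrMr // ltW.
apply: le_trans (ind_cover L0 hq N y) _; rewrite ler_wpM2r //.
rewrite -natr1; lra.
Qed.

(** env decreases like an inverse square: decomposed into dyadic windows, it is
    controlled by concentration at the single scale L. *)
Lemma env_of_conc k v L q om : 0 < L -> 0 < om -> om * L <= 1 -> 0 <= q ->
  (forall y, Pn k (ind L k y) v <= q) ->
  forall y, Pn k (ev k y om) v <= 16 * q / (om * L).
Proof.
move=> L0 om0 omL q0 hq y.
have oL0 : 0 < om * L by rewrite mulr_gt0.
have omn : om != 0 by rewrite gt_eqF.
have Ln : L != 0 by rewrite gt_eqF.
have D J : Pn k (ev k y om) v <= 16 * q / (om * L) + 4^-1 ^+ J.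
  apply: (@le_trans _ _ (Pn k (fun w => \sum_(j < J.+1) 4 * 4^-1 ^+ j * ind (2 ^+ j / om) k y w + 4^-1 ^+ J) v)).
    apply: Pn_mono; first exact: adm_ev.
      apply: admD; last exact: adm_cst.
      by apply: adm_sum => j; apply: admZ; exact: adm_ind.
    move=> w; apply: le_trans (env_dyadic J _) _; rewrite lerD2r.
    apply: ler_sum => j _; rewrite /ind normrM (gtr0_norm om0).
    by rewrite ler_pdivlMr.
  rewrite PD; last exact: adm_cst; last first.
    by apply: adm_sum => j; apply: admZ; exact: adm_ind.
  rewrite Pn_cst lerD2r.
  rewrite (@Pn_sum _ _ _ _ _ mu step s ell mstep mell ell1 iell sstep k _ (index_enum _)
     (fun (j : 'I_J.+1) w => 4 * 4^-1 ^+ j * ind (2 ^+ j / om) k y w)); last first.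
    by move=> j; apply: admZ; exact: adm_ind.
  have b0 : 0 <= 8 * q / (om * L) by rewrite divr_ge0 ?(ltW oL0) // mulr_ge0.
  apply: (@le_trans _ _ (\sum_(j < J.+1) 8 * q / (om * L) * 2^-1 ^+ j)).
    apply: ler_sum => j _; rewrite PZ; last exact: adm_ind.
    have rL : L <= 2 ^+ j / om.
      rewrite ler_pdivlMr // mulrC; apply: le_trans omL _.
      by rewrite exprn_ege1 // ler1n.
    apply: le_trans (ler_wpM2l _ (ind_wide L0 rL q0 hq y)) _.
      by rewrite mulr_ge0 // exprn_ge0 // invr_ge0.
    have -> : 4^-1 ^+ j = 2^-1 ^+ j * 2^-1 ^+ j :> R by rewrite -exprMn; congr (_ ^+ _); field.
    rewrite le_eqVlt; apply/orP; left; apply/eqP; rewrite exprVn; field.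
    by rewrite omn Ln expf_neq0.
  rewrite -mulr_sumr.
  have -> : 16 * q / (om * L) = 8 * q / (om * L) * 2 by field; rewrite omn Ln.
  rewrite ler_wpM2l //.
  have := subrX1 (2^-1 : R) J.+1 => hE.
  have : 0 <= 2^-1 ^+ J.+1 :> R by rewrite exprn_ge0 // invr_ge0.
  move: hE; set S := \sum_(i < _) _; set X := _ ^+ _; lra.
apply/ler_addgt0Pr => e e0.
have rn : `|4^-1 : R| < 1 by rewrite ger0_norm ?invr_ge0 // invf_lt1 // ltr1n.
have := @cvg_geometric R 1 _ rn.
move=> /cvgrPdist_lt /(_ e e0) [N _ /(_ N (leqnn N))] /=; rewrite sub0r normrN mul1r => h.
apply: le_trans (D N) _; rewrite lerD2l ltW //.
exact: le_lt_trans (ler_norm _) h.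
Qed.

(** Shifting env by one increment costs a factor quadratic in the increment,
    so concentration before time n reaches time n. *)
Lemma ev_back : exists2 C : R, 0 < C & forall n y om v, 0 <= om <= 1 ->
  Pn n.+1 (ev n.+1 y om) v <= C * Pn n (ev n y om) v.
Proof.
have LI := ellI_ge1 (mu := mu) ell1 iell.
pose A := 1 + `|lam|.
have A0 : 0 < A by rewrite /A ltr_pwDl.
exists (2 * (1 + A ^+ 2) * ellI mu ell).
  by rewrite mulr_gt0 ?(lt_le_trans ltr01 LI) // mulr_gt0 // ltr_pwDl // sqr_ge0.
move=> n y om v /andP[om0 om1]; rewrite Pn_S.
set C := _ * ellI mu ell.
have -> : C * Pn n (ev n y om) v = Pn n (fun w => C * ev n y om w) v.
  by rewrite PZ //; exact: adm_ev.
apply: Pn_mono.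
- by apply: (adm_Pop mstep mell ell1 iell sstep); exact: adm_ev.
- by apply: admZ; exact: adm_ev.
move=> w; rewrite /Pop; set x := pos n y w.
have mo : measurable_fun setT (fun e => ev n.+1 y om (step e w)).
  have [mm _] := adm_ev n.+1 y om.
  exact: measurableT_comp mm (mstep_v w).
have h : `|\int[mu]_e ev n.+1 y om (step e w)| <= 2 * (1 + A ^+ 2) * env (x * om) * ellI mu ell.
  apply: (Rint_ell_norm mell ell1 iell (p := 2)) => //.
    by rewrite mulr_ge0 ?env_ge0 // mulr_ge0 // addr_ge0 // sqr_ge0.
  move=> e; rewrite ger0_norm ?env_ge0 // /ev pos_step mulrDl.
  apply: le_trans (env_shift _ _) _; rewrite -/x [X in _ <= X]mulrAC; apply: ler_wpM2r; first exact: env_ge0.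
  rewrite -mulrA ler_wpM2l //.
  have h1 : (incr w e * om) ^+ 2 <= A ^+ 2 * ell e ^+ 2.
    rewrite exprMn; apply: (@le_trans _ _ (incr w e ^+ 2)).
      by rewrite ler_piMr ?sqr_ge0 // exprn_ile1.
    rewrite -[_ ^+ 2]real_normK ?num_real //; exact: incrX_le.
  have h2 : 1 <= ell e ^+ 2 by rewrite exprn_ege1.
  rewrite [X in _ <= X]mulrDl mul1r; exact: lerD.
apply: le_trans (ler_norm _) (le_trans h _).
by rewrite /ev -/x mulrAC.
Qed.

Let sg : R := Num.sqrt sg2.

Let iw_tt t0 n : 1 <= t0 -> (0 < n)%N -> iw (tt t0 n) <= sg^-1 * (Num.sqrt n%:R)^-1.
Proof.
move=> t1 n0; rewrite -invfM -sqrtrM ?(ltW sg2_gt0) //.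
have h : 0 < sg2 * n%:R by rewrite mulr_gt0 // ltr0n.
by apply: iw_le => //; rewrite /tt lerDr (le_trans ler01).
Qed.

(** Under a concentration bound at scale L for the first n steps, the heat
    kernel approximation has an error of order 1 / sqrt n, in which the
    concentration constant A is divided by L. *)
Lemma smoothed_clt : exists2 K : R, 0 < K & forall L A n v, 1 <= L -> 0 <= A ->
  (0 < n)%N ->
  (forall k y, (k < n)%N -> Pn k (ind L k y) v <= A * (Num.sqrt k.+1%:R)^-1) ->
  forall y, `|Pn n (fun w => U 0 (L ^+ 2) (pos n y w)) v - U 0 (tt (L ^+ 2) n) (pos 0 y v)| <=
    K * (1 + A / L) * (Num.sqrt n%:R)^-1.
Proof.
have [K K0 hK] := lindeberg; have [B B0 hB] := ev_back; have [C C0 hC] := sum_iw sg2_gt0.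
have si : 0 < sg^-1 by rewrite invr_gt0 sqrtr_gt0.
exists (K * (sg^-1 + 16 * B + 16 * C)).
  by rewrite mulr_gt0 // -addrA ltr_wpDr // addr_ge0 // mulr_ge0 // ltW.
move=> L A n v L1 A0 n0 hind y.
have L0 : 0 < L by exact: lt_le_trans L1.
have Ln : L != 0 by rewrite gt_eqF.
have t1 : 1 <= L ^+ 2 by rewrite exprn_ege1.
have wL : iw (L ^+ 2) = L^-1 by rewrite /iw sqrtr_sqr gtr0_norm.
have sn := sqrtn_gt0 (R := R) n0.
have Li1 : L^-1 <= 1 by rewrite invf_le1.
have Li0 : 0 < L^-1 by rewrite invr_gt0.
apply: le_trans (hK (L ^+ 2) n y v t1) _.
rewrite -!mulrA ler_wpM2l ?(ltW K0) //.
have T1 := iw_tt t1 n0.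
have T2 : iw (L ^+ 2) * Pn n (ev n y (iw (L ^+ 2))) v <= 16 * B * (A / L) * (Num.sqrt n%:R)^-1.
  rewrite wL; case: n n0 hind sn {T1} => // m _ hind sn.
  have om : 0 <= L^-1 <= 1 by rewrite Li1 ltW.
  apply: le_trans (ler_wpM2l (ltW Li0) (hB m y L^-1 v om)) _.
  have q0 : 0 <= A * (Num.sqrt m.+1%:R)^-1 by rewrite mulr_ge0 // invr_ge0 ltW.
  have := @env_of_conc m v L _ L^-1 L0 Li0 _ q0 (fun y => hind m y (ltnSn m)) y.
  rewrite mulVf // lexx divr1 => /(_ isT) h.
  apply: le_trans (ler_wpM2l (ltW Li0) (ler_wpM2l (ltW B0) h)) _.
  by rewrite le_eqVlt; apply/orP; left; apply/eqP; ring.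
have T3 : \sum_(k < n) iw (tt (L ^+ 2) (n - k.+1)) ^+ 4 * Pn k (ev k y (iw (tt (L ^+ 2) (n - k.+1)))) v
     <= 16 * C * (A / L) * (Num.sqrt n%:R)^-1.
  apply: (@le_trans _ _ (16 * (A / L) * \sum_(k < n) iw (tt (L ^+ 2) (n - k.+1)) ^+ 3 * (Num.sqrt (k.+1%:R))^-1)).
    rewrite mulr_sumr; apply: ler_sum => k _.
    set w := iw _.
    have t1' : L ^+ 2 <= tt (L ^+ 2) (n - k.+1) by rewrite lerDl mulr_ge0 // ltW.
    have w0 : 0 < w by rewrite iw_gt0 // (lt_le_trans _ t1') // exprn_gt0.
    have wl : w * L <= 1.
      rewrite -ler_pdivlMr // mul1r -wL; apply: iw_le => //; exact: exprn_gt0.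
    have k0 : 0 < Num.sqrt (k.+1%:R : R) by exact: sqrtn_gt0.
    have q0 : 0 <= A * (Num.sqrt k.+1%:R)^-1 by rewrite mulr_ge0 // invr_ge0 ltW.
    have h := @env_of_conc k v L _ w L0 w0 wl q0 (fun y => hind k y (ltn_ord k)) y.
    apply: le_trans (ler_wpM2l _ h) _; first by rewrite exprn_ge0 // ltW.
    rewrite le_eqVlt; apply/orP; left; apply/eqP; field.
    by rewrite !gt_eqF.
  have := hC (L ^+ 2) n t1 n0; rewrite wL => h.
  apply: le_trans (ler_wpM2l _ h) _; first by rewrite mulr_ge0 // divr_ge0 // ltW.
  have -> : 16 * (A / L) * (C * L^-1 * (Num.sqrt n%:R)^-1) =
    L^-1 * (16 * C * (A / L) * (Num.sqrt n%:R)^-1) by ring.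
  rewrite ler_piMl // mulr_ge0 ?invr_ge0 ?(ltW sn) // mulr_ge0 ?divr_ge0 // ?(ltW L0) //.
  by rewrite mulr_ge0 // ltW.
apply: le_trans (lerD (lerD T1 T2) T3) _.
rewrite -!mulrDl mulrA ler_wpM2r ?invr_ge0 ?(ltW sn) //.
have AL : 0 <= A / L by rewrite divr_ge0 // ltW.
have := mulr_ge0 (ltW si) AL; have := ltW B0; have := ltW C0; move: (A / L) AL => a; nra.
Qed.

(** Induction on n.  The difference of two smoothed half-line indicators, with
    thresholds y - L and y + L, dominates the indicator of the window.  By
    smoothed_clt its average is at most a constant plus Kb / L times the
    constant A of the earlier times; L makes this factor at most 1 / 2 and A
    then reproduces itself. *)
Lemma concentration : exists2 L : R, 1 <= L & exists2 A : R, 1 <= A &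
  forall n v y, Pn n (ind L n y) v <= A * (Num.sqrt n.+1%:R)^-1.
Proof.
have [K K0 hK] := smoothed_clt.
pose g : R := 2 * gdens 2.
have g0 : 0 < g by rewrite mulr_gt0 // gdens_gt0.
have gi0 : 0 < g^-1 by rewrite invr_gt0.
pose r2 : R := Num.sqrt 2.
have r20 : 0 < r2 by rewrite sqrtr_gt0.
have si : 0 < sg^-1 by rewrite invr_gt0 sqrtr_gt0.
pose Kb := r2 * g^-1 * (2 * K).
have Kb0 : 0 < Kb by rewrite mulr_gt0 // mulr_gt0.
pose L := 1 + 2 * Kb.
have L1 : 1 <= L by rewrite lerDl mulr_ge0 // ltW.
have L0 : 0 < L by exact: lt_le_trans L1.
have KL : Kb / L <= 2^-1 by rewrite ler_pdivrMr // /L; lra.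
pose A := 1 + 2 * (r2 * g^-1 * (2 * L * sg^-1) + Kb).
have A1 : 1 <= A.
  by rewrite lerDl mulr_ge0 // addr_ge0 ?(ltW Kb0) // !mulr_ge0 ?(ltW r20) ?(ltW gi0) ?(ltW L0) ?(ltW si).
have A0 : 0 <= A by exact: le_trans A1.
exists L => //; exists A => // n v; elim/ltn_ind: n => n ih y.
have [->|n0] := posnP n.
  rewrite sqrtr1 invr1 mulr1; apply: le_trans A1.
  by rewrite /= /ind; case: (`|_| <= L).
have sn := sqrtn_gt0 (R := R) n0.
have t1 : 1 <= L ^+ 2 by rewrite exprn_ege1.
have {}hK := hK L A n v L1 A0 n0 (fun k y kn => ih k kn y).
have hp := hK (y + L); have hm := hK (y - L).
have a0 (y' : R) : adm (fun w => U 0 (L ^+ 2) (pos n y' w)) by exact: adm_U.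
have hg : Pn n (fun w => g * ind L n y w) v <=
   Pn n (fun w => U 0 (L ^+ 2) (pos n (y + L) w) - U 0 (L ^+ 2) (pos n (y - L) w)) v.
  apply: Pn_mono; [apply: admZ; exact: adm_ind | exact: admB |].
  move=> w; rewrite /U sqrtr_sqr (gtr0_norm L0).
  have -> : - (pos n (y + L) w / L) = (- (pos n y w / L) - 1) + 2.
    by rewrite /pos; field; rewrite gt_eqF.
  have -> : - (pos n (y - L) w / L) = - (pos n y w / L) - 1.
    by rewrite /pos; field; rewrite gt_eqF.
  have [h1 h2] := Phi_gap (- (pos n y w / L) - 1).
  rewrite /ind; have [h|_] := boolP (`|_| <= L); last by rewrite mulr0.
  rewrite mulr1; apply: h2; rewrite subrK normrN normrM normfV (gtr0_norm L0).
  by rewrite ler_pdivrMr // mul1r.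
rewrite (PB _ (a0 _) (a0 _)) PZ in hg; last exact: adm_ind.
have hU : `|U 0 (tt (L ^+ 2) n) (pos 0 (y + L) v) - U 0 (tt (L ^+ 2) n) (pos 0 (y - L) v)|
    <= 2 * L * sg^-1 * (Num.sqrt n%:R)^-1.
  rewrite /U; apply: le_trans (Phi_lipschitz _ _) _.
  have -> : - (pos 0 (y + L) v / Num.sqrt (tt (L ^+ 2) n)) - - (pos 0 (y - L) v / Num.sqrt (tt (L ^+ 2) n)) =
     2 * L * iw (tt (L ^+ 2) n) by rewrite /iw /pos; ring.
  have w0 : 0 <= iw (tt (L ^+ 2) n).
    by rewrite ltW // iw_gt0 // ltr_wpDr ?mulr_ge0 ?(ltW sg2_gt0) // exprn_gt0.
  rewrite ger0_norm ?mulr_ge0 ?(ltW L0) // -[X in _ <= X]mulrA.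
  by rewrite ler_wpM2l ?mulr_ge0 ?(ltW L0) // iw_tt.
set rn := (Num.sqrt n%:R)^-1 in hp hm hU *.
have rn0 : 0 < rn by rewrite invr_gt0.
have hall : g * Pn n (ind L n y) v <= (2 * L * sg^-1 + 2 * K * (1 + A / L)) * rn.
  have -> : (2 * L * sg^-1 + 2 * K * (1 + A / L)) * rn =
    2 * L * sg^-1 * rn + 2 * (K * (1 + A / L) * rn) by ring.
  apply: (le_trans hg); move: hp hm hU; rewrite !ler_norml.
  move: (Pn n (fun w => U 0 _ (pos n (y + L) w)) v) (Pn n (fun w => U 0 _ (pos n (y - L) w)) v).
  move: (U 0 _ (pos 0 (y + L) v)) (U 0 _ (pos 0 (y - L) v)) (K * (1 + A / L) * rn) => a b c p q.
  by move: (2 * L * sg^-1 * rn) => z; lra.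
rewrite mulrC -ler_pdivlMr // in hall.
apply: (le_trans hall).
have h2 := invsqrtS (R := R) n0; rewrite -/rn -/r2 in h2.
have fac : 0 <= (2 * L * sg^-1 + 2 * K * (1 + A / L)) / g.
  have AL : 0 <= A / L by rewrite divr_ge0 // ltW.
  apply: divr_ge0; last exact: ltW.
  apply: addr_ge0; first by rewrite mulr_ge0 ?(ltW si) // mulr_ge0 // ltW.
  by rewrite mulr_ge0 ?addr_ge0 // mulr_ge0 // ltW.
rewrite mulrAC; apply: le_trans (ler_wpM2l fac h2) _.
rewrite mulrA ler_wpM2r ?invr_ge0 ?sqrtr_ge0 //.
have -> : (2 * L * sg^-1 + 2 * K * (1 + A / L)) / g * r2 = (r2 * g^-1 * (2 * L * sg^-1) + Kb) + A * (Kb / L).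
  by rewrite /Kb; ring.
have h3 : A * (Kb / L) <= A * 2^-1 by rewrite ler_wpM2l.
have eA : A = 1 + 2 * (r2 * g^-1 * (2 * L * sg^-1) + Kb) by [].
move: h3 eA; move: (A * (Kb / L)) (_ + Kb) => z X h3 eA; lra.
Qed.

Lemma ev_concentration : exists2 C : R, 0 < C & forall n v y om, 0 < om <= 1 ->
  Pn n (ev n y om) v <= C / om * (Num.sqrt n.+1%:R)^-1.
Proof.
have [L L1 [A A1 hA]] := concentration.
have L0 : 0 < L by exact: lt_le_trans L1.
have A0 : 0 < A by exact: lt_le_trans A1.
exists (16 * A); first exact: mulr_gt0.
move=> n v y om /andP[om0 om1].
have oL0 : 0 < om / L by rewrite divr_gt0.
have sn : 0 < Num.sqrt (n.+1%:R : R) by exact: sqrtn_gt0.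
have q0 : 0 <= A * (Num.sqrt n.+1%:R)^-1 by rewrite mulr_ge0 ?invr_ge0 ?(ltW sn) ?(ltW A0).
have := env_of_conc L0 oL0 _ q0 (hA n v) y.
rewrite divfK ?gt_eqF // => /(_ om1) h.
apply: le_trans (_ : _ <= Pn n (ev n y (om / L)) v) _.
  apply: Pn_mono; [exact: adm_ev | exact: adm_ev |] => w.
  rewrite /ev; apply: env_decr; rewrite !normrM ler_wpM2l //.
  by rewrite ler_piMr // normfV invf_le1 ?normr_gt0 ?gt_eqF // gtr0_norm.
by apply: (le_trans h); rewrite le_eqVlt; apply/orP; left; apply/eqP; ring.
Qed.

Lemma ind_concentration (c : R) : 0 <= c -> exists2 C : R, 0 < C & forall n v y,
  Pn n (ind c n y) v <= C * (Num.sqrt n.+1%:R)^-1.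
Proof.
move=> c0; have [C C0 hC] := ev_concentration.
have c1 : 0 < 1 + c ^+ 2 by rewrite ltr_pwDl // sqr_ge0.
exists ((1 + c ^+ 2) * C); first by rewrite mulr_gt0.
move=> n v y; rewrite -mulrA.
have h := hC n v y 1; rewrite ltr01 lexx divr1 in h.
apply: le_trans (ler_wpM2l (ltW c1) (h isT)).
have -> : (1 + c ^+ 2) * Pn n (ev n y 1) v = Pn n (fun w => (1 + c ^+ 2) * ev n y 1 w) v.
  by rewrite PZ //; exact: adm_ev.
apply: Pn_mono; [exact: adm_ind | apply: admZ; exact: adm_ev |].
move=> w; rewrite /ind /ev mulr1; have [h1|_] := boolP (`|_| <= c).
  rewrite /env ler_pdivlMr ?ltr_pwDl ?sqr_ge0 // mul1r lerD2l.
  by rewrite -[pos n y w ^+ 2]real_normK ?num_real // lerXn2r ?nnegrE.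
by rewrite mulr_ge0 ?env_ge0 // ltW.
Qed.

(** The smoothed and the sharp half-line indicators differ only near the
    threshold, where concentration applies. *)
Lemma clt : exists2 C : R, 0 < C & forall n y v, (0 < n)%N ->
  `|Pn n (fun w => (pos n y w <= 0)%R%:R) v - Phi (- (pos 0 y v / Num.sqrt (sg2 * n%:R)))|
    <= C * (Num.sqrt n%:R)^-1.
Proof.
have [L L1 [A A1 hA]] := concentration.
have [K K0 hK] := smoothed_clt.
have [D D0 hD] := ev_concentration; have [S S0 hS] := @U0_step R.
have [C2 C20 hC2] := @U_env R 2 isT.
have L0 : 0 < L by exact: lt_le_trans L1.
have A0 : 0 < A by exact: lt_le_trans A1.
have LL0 : 0 <= L ^+ 2 by exact: sqr_ge0.
exists (S * (D * L) + K * (1 + A / L) + C2 * L ^+ 2 / sg2).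
  rewrite ltr_wpDr ?addr_gt0 //.
  - by rewrite divr_ge0 ?(ltW sg2_gt0) // mulr_ge0 // ltW.
  - by rewrite !mulr_gt0.
  - by rewrite mulr_gt0 // ltr_wpDr // divr_ge0 // ltW.
move=> n y v n0.
have sn := sqrtn_gt0 (R := R) n0.
have nn0 : 0 < n%:R :> R by rewrite ltr0n.
have t1 : 1 <= L ^+ 2 by rewrite exprn_ege1.
have t0 : 0 < L ^+ 2 by rewrite exprn_gt0.
set rn := (Num.sqrt n%:R)^-1.
have rn0 : 0 < rn by rewrite invr_gt0.
have h1 : `|Pn n (fun w => (pos n y w <= 0)%R%:R) v - Pn n (fun w => U 0 (L ^+ 2) (pos n y w)) v| <=
    S * (D * L) * rn.
  have aH := adm_half n y; have aU := @adm_U 0 _ n y isT t1.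
  have := PB n aH aU => /(congr1 (fun f => f v)) <-.
  have om : 0 < L^-1 <= 1 by rewrite invr_gt0 L0 invf_le1.
  have h := hD n v y L^-1 om; rewrite invrK in h.
  have hr : (Num.sqrt n.+1%:R)^-1 <= rn.
    by rewrite lef_pV2 ?posrE ?sqrtn_gt0 // ler_wsqrtr // ler_nat.
  apply: le_trans (_ : _ <= Pn n (fun w => S * ev n y L^-1 w) v) _.
    apply: Pnorm; [exact: admB | apply: admZ; exact: adm_ev |].
    move=> w; have := hS (L ^+ 2) (pos n y w) t0.
    by rewrite sqrtr_sqr (gtr0_norm L0).
  rewrite PZ; last exact: adm_ev.
  rewrite -mulrA ler_wpM2l ?(ltW S0) //; apply: (le_trans h).
  by rewrite ler_wpM2l // mulr_ge0 // ltW.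
have h2 := hK L A n v L1 (ltW A0) n0 (fun k y _ => hA k v y) y.
have h3 : `|U 0 (L ^+ 2 + sg2 * n%:R) (pos 0 y v) - U 0 (sg2 * n%:R) (pos 0 y v)| <= C2 * L ^+ 2 / sg2 * rn.
  have sn0 : 0 < sg2 * n%:R by rewrite mulr_gt0.
  have tp (t : R) : 0 <= t <= 1 -> 0 < sg2 * n%:R + t * L ^+ 2.
    by move=> /andP[t00 _]; rewrite ltr_wpDr // mulr_ge0.
  have hM (t : R) : 0 <= t <= 1 -> `|2^-1 * U 2 (sg2 * n%:R + t * L ^+ 2) (pos 0 y v)| <= C2 / (sg2 * n%:R).
    move=> t01; have tp0 := tp t t01; rewrite normrM -[X in _ <= X]mul1r; apply: ler_pM => //.
      by rewrite ger0_norm ?invr_ge0 // invf_le1 // ler1n.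
    apply: le_trans (hC2 _ _ tp0) _; rewrite exprVn sqr_sqrtr ?(ltW tp0) // -mulrA ler_wpM2l ?(ltW C20) //.
    apply: (@le_trans _ _ (sg2 * n%:R + t * L ^+ 2)^-1); first by rewrite ler_piMr ?env_le1 // invr_ge0 ltW.
    rewrite lef_pV2 ?posrE // lerDl mulr_ge0 //; by case/andP: t01.
  have := @mean_value R (U 0 ^~ (pos 0 y v)) (fun th => 2^-1 * U 2 th (pos 0 y v)) (sg2 * n%:R) (L ^+ 2) _
    (fun t t01 => is_derive_U_tau 0 (pos 0 y v) (tp t t01)) hM.
  rewrite (ger0_norm LL0) [sg2 * _ + _]addrC => h; apply: (le_trans h).
  have -> : C2 / (sg2 * n%:R) * L ^+ 2 = C2 * L ^+ 2 / sg2 * n%:R^-1.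
    by field; rewrite !gt_eqF.
  rewrite ler_wpM2l //; first by rewrite divr_ge0 ?(ltW sg2_gt0) // mulr_ge0 // ltW.
  rewrite lef_pV2 ?posrE // -[X in _ <= X]sqr_sqrtr // expr2 ler_peMl ?(ltW sn) //.
  by rewrite -[X in X <= _]sqrtr1 ler_wsqrtr // ler1n.
have -> : Phi (- (pos 0 y v / Num.sqrt (sg2 * n%:R))) = U 0 (sg2 * n%:R) (pos 0 y v) by [].
rewrite !mulrDl -/rn.
move: h1 h2 h3; rewrite -/rn.
set a := Pn n _ v; set b := Pn n _ v; set c := U 0 _ _; set d := U 0 _ _ => h1 h2 h3.
have -> : a - d = (a - b) + (b - c) + (c - d) by ring.
apply: le_trans (ler_normD _ _) (lerD _ h3).
apply: le_trans (ler_normD _ _) (lerD h1 _).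
exact: h2.
Qed.

(** Functions of the endpoint that relax exponentially fast decorrelate from
    the half-line event: shifting the event by one step at time k costs the
    probability that the walk is within one increment of its boundary. *)
Lemma target (q : R) : 0 <= q < 1 -> exists2 C : R, 0 < C &
  forall (psi : nat -> T -> R) (H : R) n y v, (0 < n)%N -> 0 <= H ->
   (forall j, measurable_fun setT (psi j)) ->
   (forall j w, `|psi j w| <= H * q ^+ j) ->
   (forall j w, psi j.+1 w = Pop (psi j) w) ->
  `|Pn n (fun w => psi 0%N w * (pos n y w <= 0)%R%:R) v| <= C * H * (Num.sqrt n%:R)^-1.
Proof.
move=> q01; have /andP[q0 q1] := q01.
have [D D0 hD] := ev_concentration; have [G G0 hG] := sum_geo q01.
have LI := ellI_ge1 (mu := mu) ell1 iell.
have LI0 : 0 < ellI mu ell by exact: lt_le_trans LI.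
pose A := 1 + `|lam|.
have A0 : 0 < A by rewrite /A ltr_pwDl.
pose B := (1 + A ^+ 2) * ellI mu ell.
have B0 : 0 < B by rewrite mulr_gt0 // ltr_pwDl // sqr_ge0.
exists (B * D * G + G); first by rewrite addr_gt0 // mulr_gt0 // mulr_gt0.
move=> psi H n y v n0 H0 mpsi bpsi Ppsi.
pose F k w := psi (n - k)%N w * (pos k y w <= 0)%R%:R.
have bF k w : `|F k w| <= H.
  rewrite /F normrM; apply: (@le_trans _ _ (H * q ^+ (n - k) * 1)).
    apply: ler_pM => //; by case: (pos k y w <= 0); rewrite ?normr1 ?normr0.
  by rewrite mulr1 ler_piMr // exprn_ile1 // ltW.
have aF k : adm (F k).
  apply: adm_bounded (bF k); apply: measurable_funM => //.
  by have [] := adm_half k y.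
pose e k w := H * q ^+ (n - k.+1) * B * ev k y 1 w.
have ae k : adm (e k) by apply: admZ; exact: adm_ev.
have hstep k w : (k < n)%N -> `|Pop (F k.+1) w - F k w| <= e k w.
  move=> kn; rewrite /F.
  have -> : (n - k = (n - k.+1).+1)%N by rewrite subnSK.
  set m := (n - k.+1)%N.
  rewrite Ppsi /Pop; set x := pos k y w; set i0 : R := (x <= 0)%R%:R.
  have mps : measurable_fun setT (fun e => psi m (step e w)).
    exact: measurableT_comp (mpsi m) (mstep_v w).
  have mh : measurable_fun setT (fun e => (x + incr w e <= 0)%R%:R : R).
    apply: measurable_natb; apply: measurable_fun_ler => //.
    apply: measurable_funD => //; exact: measurable_incr.
  have Hq0 : 0 <= H * q ^+ m by rewrite mulr_ge0 // exprn_ge0.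
  have ipsi : mu.-integrable setT (EFin \o (fun e => psi m (step e w))).
    by apply: (integrable_ell ell1 iell (p := 0) (K := H * q ^+ m)) => // e'; rewrite mulr1.
  have i01 (b : bool) : `|(b%:R : R)| <= 1 by case: b; rewrite ?normr1 ?normr0.
  have ih : mu.-integrable setT (EFin \o (fun e => psi m (step e w) * (x + incr w e <= 0)%R%:R)).
    apply: (integrable_ell ell1 iell (p := 0) (K := H * q ^+ m * 1)) => //.
      exact: measurable_funM.
    by move=> e'; rewrite normrM expr0 [X in _ <= X]mulr1; apply: ler_pM => //.
  have ih0 : mu.-integrable setT (EFin \o (fun e => psi m (step e w) * i0)).
    apply: (integrable_ell ell1 iell (p := 0) (K := H * q ^+ m * 1)) => //.
      exact: measurable_funM.
    by move=> e'; rewrite normrM expr0 [X in _ <= X]mulr1; apply: ler_pM => //; exact: i01.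
  rewrite -RintegralZr //.
  under [X in `|X - _|]eq_Rintegral do rewrite pos_step -/x.
  have := @Rint_ell_dist _ _ E mu ell mell ell1 iell 2 _ _ (H * q ^+ m * ((1 + A ^+ 2) * env x)) isT _ _ _ ih ih0.
  rewrite /e /ev -/x mulr1 -/m => h; apply: le_trans (h _ _ _ _) _.
  - exact: measurable_funM.
  - exact: measurable_funM.
  - by rewrite mulr_ge0 // mulr_ge0 ?env_ge0 // addr_ge0 // sqr_ge0.
  - move=> e'; rewrite -mulrBr normrM.
    rewrite -[X in _ <= X]mulrA; apply: ler_pM => //.
    have LE : 1 <= ell e' ^+ 2 by rewrite exprn_ege1.
    have aux : x ^+ 2 <= incr w e' ^+ 2 -> 1 <= (1 + A ^+ 2) * env x * ell e' ^+ 2.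
      move=> hx; rewrite /env mulrAC ler_pdivlMr ?ltr_pwDl ?sqr_ge0 // mul1r mulrDl mul1r.
      apply: lerD => //; apply: (le_trans hx).
      rewrite -[incr _ _ ^+ 2]real_normK ?num_real //; exact: incrX_le.
    have pos0 : 0 <= (1 + A ^+ 2) * env x * ell e' ^+ 2.
      by rewrite mulr_ge0 ?sqr_ge0 // mulr_ge0 ?env_ge0 // addr_ge0 // sqr_ge0.
    rewrite /i0; set a := incr w e'.
    have [h1|h1] := leP (x + a) 0; have [h2|h2] := leP x 0; rewrite ?subrr ?normr0 //.
      rewrite subr0 normr1; apply: aux; rewrite -/a.
      have : 0 <= (- a - x) * (x - a) by rewrite mulr_ge0 //; lra.
      nra.
    rewrite sub0r normrN normr1; apply: aux; rewrite -/a.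
    have : 0 <= (a + x) * (a - x) by rewrite mulr_ge0 //; lra.
    nra.
  by rewrite le_eqVlt; apply/orP; left; apply/eqP; rewrite /B; ring.
have hT := telescope_Pn mstep mell ell1 iell sstep v aF ae hstep.
have sn := sqrtn_gt0 (R := R) n0.
have FE : Pn n (fun w => psi 0%N w * (pos n y w <= 0)%R%:R) v = Pn n (F n) v.
  by congr (Pn _ _ v); apply/funext => w; rewrite /F subnn.
have hsum : \sum_(k < n) Pn k (e k) v <= B * D * G * H * (Num.sqrt n%:R)^-1.
  apply: (@le_trans _ _ (H * B * D * \sum_(k < n) q ^+ (n - k.+1) * (Num.sqrt (k.+1%:R))^-1)).
    rewrite mulr_sumr; apply: ler_sum => k _; rewrite PZ; last exact: adm_ev.
    have h := hD k v y 1; rewrite ltr01 lexx divr1 in h.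
    apply: le_trans (ler_wpM2l _ (h isT)) _.
      by rewrite mulr_ge0 ?(ltW B0) // mulr_ge0 // exprn_ge0.
    by rewrite le_eqVlt; apply/orP; left; apply/eqP; ring.
  apply: le_trans (ler_wpM2l _ (hG n n0)) _; first by rewrite mulr_ge0 ?(ltW D0) // mulr_ge0 // ltW.
  by rewrite le_eqVlt; apply/orP; left; apply/eqP; ring.
have h0 : `|F 0%N v| <= G * H * (Num.sqrt n%:R)^-1.
  rewrite /F subn0 normrM.
  have : `|psi n v| * `|(pos 0 y v <= 0)%R%:R| <= H * q ^+ n * 1.
    by apply: ler_pM => //; case: (pos 0 y v <= 0); rewrite ?normr1 ?normr0.
  move=> h; apply: (le_trans h); rewrite mulr1 [G * H]mulrC -mulrA ler_wpM2l //.
  apply: le_trans (hG n n0); case: n n0 {hT sn FE hsum F bF aF e ae hstep h} => // n _.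
  rewrite big_ord_recl /= subSS subn0 sqrtr1 invr1 mulr1.
  apply: ler_wpDr; last by rewrite ler_wiXn2l // ltW.
  by apply: sumr_ge0 => k _; rewrite mulr_ge0 ?exprn_ge0 // invr_ge0 sqrtr_ge0.
rewrite FE mulrDl mulrDl.
have -> : Pn n (F n) v = (Pn n (F n) v - F 0%N v) + F 0%N v by rewrite subrK.
by apply: le_trans (ler_normD _ _) (lerD (le_trans hT hsum) h0).
Qed.

End Lindeberg.

(** * Correctors and the limit theorem for contracting cocycles *)

Section Variance.
Context {R : realType} {dE dT : measure_display}.
Context {E : measurableType dE} {T : measurableType dT}.
Variable mu : probability E R.
Variables (step : E -> T -> T) (s : T -> R) (ell : E -> R).
Hypothesis mstep : measurable_fun setT (fun p : T * E => step p.2 p.1).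
Hypothesis ms : measurable_fun setT s.
Hypothesis mell : measurable_fun setT ell.
Hypothesis ell1 : forall e, 1 <= ell e.
Hypothesis iell : mu.-integrable setT (EFin \o (fun e => ell e ^+ 8)).
Hypothesis sstep : forall e v, `|s (step e v) - s v| <= ell e.
Variables (lam sg2 : R) (u1 u2 : T -> R) (Ku : R).
Hypothesis Ku1 : 1 <= Ku.
Hypotheses (mu1 : measurable_fun setT u1) (mu2 : measurable_fun setT u2).
Hypotheses (bu1 : forall v, `|u1 v| <= Ku) (bu2 : forall v, `|u2 v| <= Ku).
Local Notation incr := (incr step s lam).
Hypothesis eq_u1 : forall v, \int[mu]_e (incr v e + u1 (step e v)) = u1 v.
Hypothesis eq_u2 : forall v,
  \int[mu]_e (incr v e ^+ 2 / 2 + incr v e * u1 (step e v) + u2 (step e v)) =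
  u2 v + sg2 / 2.
Local Notation Pn := (Pn mu step).
Local Notation Pop := (Pop mu step).
Local Notation adm := (adm s).
Local Notation pos := (pos s lam).

Lemma adm_poly (a b : R) (f : T -> R) K k y : measurable_fun setT f -> (forall v, `|f v| <= K) ->
  adm (fun w => a * pos k y w ^+ 2 + b * (pos k y w * f w)).
Proof.
move=> mf bf; have mp := @measurable_pos _ _ _ s ms lam k y.
split.
  apply: measurable_funD; first by apply: measurable_funM => //; exact: measurable_funX.
  by apply: measurable_funM => //; exact: measurable_funM.
pose c := `|k%:R * lam + y|.
pose M := (2 + 2 * c ^+ 2) + K ^+ 2.
have c0 : 0 <= c by exact: normr_ge0.
exists (`|a| * (2 + 2 * c ^+ 2) + `|b| * M).
  have h1 : 0 <= 2 + 2 * c ^+ 2 by have := sqr_ge0 c; lra.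
  have hM : 0 <= M by have := sqr_ge0 K; rewrite /M; lra.
  by rewrite addr_ge0 // mulr_ge0.
move=> v; have hp : pos k y v ^+ 2 <= (2 + 2 * c ^+ 2) * (1 + s v ^+ 2).
  rewrite /pos real_normK ?num_real //; set d := _ + y.
  have -> : s v - k%:R * lam - y = s v - d by rewrite /d; ring.
  have := sqr_ge0 (s v + d); have := mulr_ge0 (sqr_ge0 d) (sqr_ge0 (s v)).
  nra.
apply: le_trans (ler_normD _ _) _; rewrite [X in _ <= X]mulrDl; apply: lerD.
  by rewrite normrM normrX -mulrA ler_wpM2l // real_normK ?num_real.
rewrite normrM -mulrA ler_wpM2l // normrM.
have K2 : `|f v| ^+ 2 <= K ^+ 2 by rewrite lerXn2r ?nnegrE // (le_trans _ (bf v)).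
have P0 := sqr_ge0 (pos k y v).
have X2 : `|pos k y v| * `|f v| <= (pos k y v ^+ 2 + `|f v| ^+ 2) / 2.
  rewrite -[pos k y v ^+ 2]real_normK ?num_real //.
  by have := sqr_ge0 (`|pos k y v| - `|f v|); move: (`|pos k y v|) (`|f v|) => p g; nra.
have K3 := mulr_ge0 (sqr_ge0 K) (sqr_ge0 (s v)).
apply: (le_trans X2); rewrite /M [X in _ <= X]mulrDl [K ^+ 2 * _]mulrDr mulr1.
have K4 := sqr_ge0 K.
move: hp K2 P0 K3 K4; move: ((2 + 2 * c ^+ 2) * (1 + s v ^+ 2)) => Z.
move: (pos k y v ^+ 2) (`|f v| ^+ 2) (K ^+ 2 * s v ^+ 2) (K ^+ 2) => p g z k2 h1 h2 h3 h4 h5; lra.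
Qed.

Let mom v p (f : T -> R) := @integrable_moment _ _ _ _ _ mu step s ell mstep ms ell1 iell sstep lam Ku v p f.

(** The square of the position, corrected so that each step raises its average
    by exactly sg2. *)
Definition quad k w := 1 * pos k 0 w ^+ 2 + 2 * (pos k 0 w * u1 w) + 2 * u2 w.

Lemma adm_quad k : adm (quad k).
Proof.
apply: admD; first exact: (@adm_poly 1 2 u1 Ku).
by apply: admZ; exact: adm_bounded bu2.
Qed.

Lemma Pop_quad k w : Pop (quad k.+1) w = quad k w + sg2.
Proof.
set x := pos k 0 w.
pose q1 e := incr w e + u1 (step e w).
pose q2 e := incr w e ^+ 2 / 2 + incr w e * u1 (step e w) + u2 (step e w).
have one8 (v' : T) : `|(fun=> 1 : R) v'| <= Ku by rewrite normr1.
have m1 := @mom w _ (fun=> 1) _ (measurable_cst _) one8.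
have iD (f g : E -> R) : mu.-integrable setT (EFin \o f) -> mu.-integrable setT (EFin \o g) ->
   mu.-integrable setT (EFin \o (fun e => f e + g e)).
  by move=> fi gi; have := integrableD measurableT fi gi; exact: eq_integrable.
have iZ c (f : E -> R) : mu.-integrable setT (EFin \o f) ->
   mu.-integrable setT (EFin \o (fun e => c * f e)).
  by move=> fi; have := integrableZl measurableT c fi; exact: eq_integrable.
have iext (f g : E -> R) : mu.-integrable setT (EFin \o f) -> f =1 g -> mu.-integrable setT (EFin \o g).
  by move=> fi fg; apply: eq_integrable fi => // e _ /=; rewrite fg.
have iq1 : mu.-integrable setT (EFin \o q1).
  apply: iext (iD _ _ (m1 1%N isT) (@mom w 0%N u1 isT mu1 bu1)) _ => e.
  by rewrite /q1 expr1 expr0 !(mulr1,mul1r).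
have iq2 : mu.-integrable setT (EFin \o q2).
  apply: iext (iD _ _ (iD _ _ (iZ 2^-1 _ (m1 2%N isT)) (@mom w 1%N u1 isT mu1 bu1))
    (@mom w 0%N u2 isT mu2 bu2)) _ => e.
  by rewrite /q2 expr1 expr0 !(mulr1,mul1r) [2^-1 * _]mulrC.
have ic : mu.-integrable setT (EFin \o (fun _ : E => x ^+ 2)).
  by apply: (integrable_ell ell1 iell (p := 0) (K := `|x ^+ 2|)) => // e; rewrite mulr1.
have E1 : \int[mu]_e q1 e = u1 w := eq_u1 w.
have E2 : \int[mu]_e q2 e = u2 w + sg2 / 2 := eq_u2 w.
rewrite /Pop.
have -> : \int[mu]_e quad k.+1 (step e w) = \int[mu]_e (x ^+ 2 + (2 * x) * q1 e + 2 * q2 e).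
  by apply: eq_Rintegral => e _; rewrite /quad pos_step -/x /q1 /q2; field.
rewrite RintegralD //; [|exact: iD ic (iZ _ _ iq1)|exact: iZ].
rewrite RintegralD //; [|exact: iZ].
have Z1 : \int[mu]_e (2 * x * q1 e) = 2 * x * \int[mu]_e q1 e by exact: RintegralZl.
have Z2 : \int[mu]_e (2 * q2 e) = 2 * \int[mu]_e q2 e by exact: RintegralZl.
by rewrite Z1 Z2 E1 E2 Rint_cst /quad -/x; field.
Qed.

Lemma Pn_quad n v : Pn n (quad n) v = quad 0 v + n%:R * sg2.
Proof.
elim: n => [|n ih]; first by rewrite mul0r addr0.
rewrite Pn_S (_ : Pop (quad n.+1) = fun w => quad n w + sg2); last first.
  by apply/funext => w; exact: Pop_quad.
rewrite (PnD mstep mell ell1 iell sstep n (adm_quad n) (adm_cst s sg2)) ih Pn_cst.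
by rewrite -natr1; ring.
Qed.

Lemma second_moment v : exists2 c : R, 0 <= c & forall n (delta : R), 0 < delta ->
  `|Pn n (fun w => pos n 0 w ^+ 2) v - n%:R * sg2| <=
    delta * Pn n (fun w => pos n 0 w ^+ 2) v + (c + Ku ^+ 2 / delta).
Proof.
have Ku0 : 0 <= Ku by exact: le_trans ler01 Ku1.
exists (`|quad 0 v| + 2 * Ku); first by rewrite addr_ge0 // mulr_ge0.
move=> n delta d0.
have z0 : (fun w => pos n 0 w ^+ 2) = fun w => 1 * pos n 0 w ^+ 2 + 0 * (pos n 0 w * u1 w).
  by apply/funext => w; rewrite mul1r mul0r addr0.
have asq : adm (fun w => pos n 0 w ^+ 2) by rewrite z0; exact: adm_poly bu1.
have ax : adm (fun w => 2 * (pos n 0 w * u1 w)).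
  have -> : (fun w => 2 * (pos n 0 w * u1 w)) = fun w => 0 * pos n 0 w ^+ 2 + 2 * (pos n 0 w * u1 w).
    by apply/funext => w; rewrite mul0r add0r.
  exact: adm_poly bu1.
have au2 : adm u2 by exact: adm_bounded bu2.
have Equad : Pn n (quad n) v = Pn n (fun w => pos n 0 w ^+ 2) v +
   Pn n (fun w => 2 * (pos n 0 w * u1 w)) v + 2 * Pn n u2 v.
  have -> : quad n = fun w => (pos n 0 w ^+ 2 + 2 * (pos n 0 w * u1 w)) + 2 * u2 w.
    by apply/funext => w; rewrite /quad mul1r.
  rewrite (PnD mstep mell ell1 iell sstep n (admD asq ax) (admZ 2 au2)).
  by rewrite (PnD mstep mell ell1 iell sstep n asq ax) (PnZ mstep mell ell1 iell sstep n 2 au2).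
have h1 : `|Pn n (fun w => 2 * (pos n 0 w * u1 w)) v| <= delta * Pn n (fun w => pos n 0 w ^+ 2) v + Ku ^+ 2 / delta.
  have -> : delta * Pn n (fun w => pos n 0 w ^+ 2) v + Ku ^+ 2 / delta =
    Pn n (fun w => delta * pos n 0 w ^+ 2 + Ku ^+ 2 / delta) v.
    rewrite (PnD mstep mell ell1 iell sstep n (admZ delta asq) (adm_cst s _)).
    by rewrite (PnZ mstep mell ell1 iell sstep n delta asq) Pn_cst.
  apply: (Pn_norm mstep mell ell1 iell sstep) => //.
    by apply: admD; [exact: admZ | exact: adm_cst].
  move=> w; rewrite normrM normrM (@ger0_norm _ 2) //.
  have hu := bu1 w; have := sqr_ge0 (delta * `|pos n 0 w| - `|u1 w|).
  rewrite -[pos n 0 w ^+ 2]real_normK ?num_real //.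
  have K2 : `|u1 w| ^+ 2 <= Ku ^+ 2 by rewrite lerXn2r ?nnegrE.
  move: (`|pos n 0 w|) (`|u1 w|) K2 => x u K2 h.
  have -> : delta * x ^+ 2 + Ku ^+ 2 / delta = (delta ^+ 2 * x ^+ 2 + Ku ^+ 2) / delta.
    by field; rewrite gt_eqF.
  rewrite ler_pdivlMr //; nra.
have h2 : `|Pn n u2 v| <= Ku.
  exact: (Pn_bound mstep mell ell1 iell sstep n au2 bu2 v).
move: (Pn_quad n v) h1 h2 (ler_norm (quad 0 v)) (ler_norm (- quad 0 v)); rewrite Equad normrN !ler_norml.
move: (delta * _) (_ / delta) => a b.
move: (Pn n (fun w => pos n 0 w ^+ 2) v) (Pn n (fun w => 2 * _) v) (Pn n u2 v) (quad 0 v) => p q r z.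
lra.
Qed.

End Variance.

Section Package.
Context {R : realType} {dE dT : measure_display}.
Context {E : measurableType dE} {T : measurableType dT}.
Variable mu : probability E R.
Variables (step : E -> T -> T) (s : T -> R) (ell : E -> R).
Hypothesis mstep : measurable_fun setT (fun p : T * E => step p.2 p.1).
Hypothesis ms : measurable_fun setT s.
Hypothesis mell : measurable_fun setT ell.
Hypothesis ell1 : forall e, 1 <= ell e.
Hypothesis iell : mu.-integrable setT (EFin \o (fun e => ell e ^+ 8)).
Hypothesis sstep : forall e v, `|s (step e v) - s v| <= ell e.
Variables (dist : T -> T -> R) (Delta r : R).
Hypothesis dist_ge0 : forall v w, 0 <= dist v w.
Hypothesis dist_le : forall v w, dist v w <= Delta.
Hypothesis r01 : 0 <= r < 1.
Hypothesis dist_step : forall e v w, dist (step e v) (step e w) <= r * dist v w.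
Hypothesis slip : forall e v w,
  `|(s (step e v) - s v) - (s (step e w) - s w)| <= ell e * dist v w.
Local Notation lipb := (lipb dist).

(** Integrands G v e of polynomial order p in the noise, with the same order
    for their Lipschitz constants in v; the class is stable under products. *)
Definition plip (p : nat) (K : R) (G : T -> E -> R) := [/\ 0 <= K,
  measurable_fun setT (fun q : T * E => G q.1 q.2),
  (forall v e, `|G v e| <= K * ell e ^+ p) &
  (forall v w e, `|G v e - G w e| <= K * ell e ^+ p * dist v w)].

Let l0 e : 0 <= ell e. Proof. exact: le_trans ler01 (ell1 e). Qed.

Lemma plipM p q K L G H : plip p K G -> plip q L H ->
  plip (p + q) (2 * (K * L)) (fun v e => G v e * H v e).
Proof.
move=> [K0 mG bG lG] [L0 mH bH lH]; split.
- by rewrite mulr_ge0 // mulr_ge0.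
- exact: measurable_funM.
- move=> v e; rewrite normrM exprD; apply: le_trans (ler_pM _ _ (bG v e) (bH v e)) _ => //.
  have : 0 <= K * ell e ^+ p * (L * ell e ^+ q) by rewrite !mulr_ge0 ?exprn_ge0.
  have -> : 2 * (K * L) * (ell e ^+ p * ell e ^+ q) = 2 * (K * ell e ^+ p * (L * ell e ^+ q)) by ring.
  lra.
move=> v w e.
have -> : G v e * H v e - G w e * H w e = (G v e - G w e) * H v e + G w e * (H v e - H w e) by ring.
have h1 : `|(G v e - G w e) * H v e| <= K * ell e ^+ p * dist v w * (L * ell e ^+ q).
  by rewrite normrM; exact: ler_pM.
have h2 : `|G w e * (H v e - H w e)| <= K * ell e ^+ p * (L * ell e ^+ q * dist v w).
  by rewrite normrM; exact: ler_pM.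
apply: le_trans (ler_normD _ _) (le_trans (lerD h1 h2) _).
by rewrite exprD le_eqVlt; apply/orP; left; apply/eqP; ring.
Qed.

Lemma plipD p q m K L G H : (p <= m)%N -> (q <= m)%N -> plip p K G -> plip q L H ->
  plip m (K + L) (fun v e => G v e + H v e).
Proof.
move=> pm qm [K0 mG bG lG] [L0 mH bH lH].
have e1 e : K * ell e ^+ p <= K * ell e ^+ m by rewrite ler_wpM2l //; exact: ler_weXn2l.
have e2 e : L * ell e ^+ q <= L * ell e ^+ m by rewrite ler_wpM2l //; exact: ler_weXn2l.
split.
- exact: addr_ge0.
- exact: measurable_funD.
- move=> v e; apply: le_trans (ler_normD _ _) _; rewrite mulrDl; apply: lerD.
    exact: le_trans (bG v e) (e1 e).
  exact: le_trans (bH v e) (e2 e).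
move=> v w e.
have -> : G v e + H v e - (G w e + H w e) = (G v e - G w e) + (H v e - H w e) by ring.
apply: le_trans (ler_normD _ _) _; rewrite 2!mulrDl; apply: lerD.
  by apply: le_trans (lG v w e) _; rewrite ler_wpM2r.
by apply: le_trans (lH v w e) _; rewrite ler_wpM2r.
Qed.

Lemma plipZ c p K G : plip p K G -> plip p (`|c| * K) (fun v e => c * G v e).
Proof.
move=> [K0 mG bG lG]; split.
- exact: mulr_ge0.
- exact: measurable_funM.
- by move=> v e; rewrite normrM -mulrA ler_wpM2l.
by move=> v w e; rewrite -mulrBr normrM -!mulrA ler_wpM2l // mulrA.
Qed.

Lemma lipb_ge0 K f : T -> lipb K f -> 0 <= K.
Proof. by move=> x [_ bf _]; apply: le_trans (bf x). Qed.

Lemma plip_comp K f : T -> lipb K f -> plip 0 K (fun v e => f (step e v)).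
Proof.
move=> x lf; have K0 := lipb_ge0 x lf; have [mf bf hf] := lf; have /andP[r0 r1] := r01.
split=> //.
- exact: measurableT_comp.
- by move=> v e; rewrite expr0 mulr1.
move=> v w e; rewrite expr0 mulr1; apply: le_trans (hf _ _) _; rewrite ler_wpM2l //.
by apply: le_trans (dist_step _ _ _) _; rewrite ler_piMl // ltW.
Qed.

Lemma plip_incr lam : plip 1 (1 + `|lam|) (incr step s lam).
Proof.
split.
- by rewrite addr_ge0.
- apply: measurable_funB => //; apply: measurable_funB.
    exact: measurableT_comp ms mstep.
  exact: measurableT_comp ms (measurable_fst).
- by move=> v e; rewrite expr1; exact: incr_le.
move=> v w e; rewrite expr1 /incr.
have -> : s (step e v) - s v - lam - (s (step e w) - s w - lam) =
  (s (step e v) - s v) - (s (step e w) - s w) by ring.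
apply: le_trans (slip e v w) _; rewrite -mulrA ler_peMl ?mulr_ge0 //.
by rewrite lerDl.
Qed.

Lemma plip_lipb p K G : plip p K G -> (p <= 8)%N ->
  lipb (K * ellI mu ell) (fun v => \int[mu]_e G v e).
Proof. by move=> [K0 mG bG lG] p8; exact: (lipb_int mell ell1 iell dist_ge0 p8 K0 mG bG lG). Qed.

Lemma lipbB K L c f g : T -> lipb K f -> lipb L g -> lipb (K + `|c| * L) (fun v => f v - c * g v).
Proof.
move=> x lf lg; have K0 := lipb_ge0 x lf; have L0 := lipb_ge0 x lg.
case: lf lg => [mf bf hf] [mg bg hg]; split.
- by apply: measurable_funB => //; exact: measurable_funM.
- move=> v; apply: le_trans (ler_normB _ _) _; rewrite lerD // normrM ler_wpM2l //.
move=> v w; have -> : f v - c * g v - (f w - c * g w) = (f v - f w) - c * (g v - g w) by ring.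
apply: le_trans (ler_normB _ _) _; rewrite mulrDl lerD // normrM -mulrA ler_wpM2l //.
Qed.

Lemma plip_integrable p K G v : plip p K G -> (p <= 8)%N -> mu.-integrable setT (EFin \o G v).
Proof.
move=> [K0 mG bG lG] p8; apply: (integrable_ell ell1 iell p8) (bG v).
exact: (@measurable_fun_pair2 _ _ _ _ _ _ _ v mG).
Qed.

(** Each equation is a Poisson equation whose right-hand side is a polynomial in
    the increment and the previous correctors; such functions stay bounded and
    Lipschitz after averaging. *)
Lemma correctors : T -> exists (lam sg2 kap : R) (u1 u2 u3 : T -> R) (Ku : R),
  [/\ 1 <= Ku,
    [/\ measurable_fun setT u1, measurable_fun setT u2 & measurable_fun setT u3],
    [/\ forall v, `|u1 v| <= Ku, forall v, `|u2 v| <= Ku & forall v, `|u3 v| <= Ku] &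
    [/\ forall v, \int[mu]_e (incr step s lam v e + u1 (step e v)) = u1 v,
      forall v, \int[mu]_e (incr step s lam v e ^+ 2 / 2 + incr step s lam v e * u1 (step e v) +
         u2 (step e v)) = u2 v + sg2 / 2 &
      forall v, \int[mu]_e (incr step s lam v e ^+ 3 / 6 +
         incr step s lam v e ^+ 2 / 2 * u1 (step e v) +
         incr step s lam v e * u2 (step e v) + u3 (step e v)) =
         u3 v + sg2 / 2 * u1 v + kap]].
Proof.
move=> x0.
have poi K f := @poisson _ _ _ _ _ mu step s ell mstep mell ell1 iell sstep dist Delta r
   dist_ge0 dist_le r01 dist_step K f x0.
have iDE (f g : E -> R) : mu.-integrable setT (EFin \o f) -> mu.-integrable setT (EFin \o g) ->
   \int[mu]_e (f e + g e) = \int[mu]_e f e + \int[mu]_e g e.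
  by move=> fi gi; exact: RintegralD.
have pi0 := plip_incr 0.
have [lam [u1 [K1 L1] e1]] := poi _ _ (plip_lipb pi0 isT).
have pa := plip_incr lam.
pose a := incr step s lam.
have pu1 := plip_comp x0 L1.
have E1 v : \int[mu]_e (a v e + u1 (step e v)) = u1 v.
  rewrite iDE ?(plip_integrable v pa isT) ?(plip_integrable v pu1 isT) //.
  have -> : \int[mu]_e a v e = \int[mu]_e incr step s 0 v e - lam.
    have -> : a v = fun e => incr step s 0 v e - lam.
      by apply/funext => e; rewrite /a /incr subr0.
    rewrite RintegralB ?Rint_cst //; first exact: plip_integrable pi0 _.
    by apply: (integrable_ell ell1 iell (p := 0) (K := `|lam|)) => // e; rewrite mulr1.
  by have := e1 v; rewrite /Pop; lra.
have paa := plipZ 2^-1 (plipM pa pa).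
have pf2 := plipD (leqnn 2) (isT : (1 + 0 <= 2)%N) paa (plipM pa pu1).
have [c2 [u2 [K2 L2] e2]] := poi _ _ (plip_lipb pf2 isT).
have pu2 := plip_comp x0 L2.
pose sg2 := 2 * c2.
have E2 v : \int[mu]_e (a v e ^+ 2 / 2 + a v e * u1 (step e v) + u2 (step e v)) = u2 v + sg2 / 2.
  have -> : (fun e => a v e ^+ 2 / 2 + a v e * u1 (step e v) + u2 (step e v)) =
     fun e => (2^-1 * (a v e * a v e) + a v e * u1 (step e v)) + u2 (step e v).
    by apply/funext => e; rewrite expr2 [2^-1 * _]mulrC.
  rewrite iDE ?(plip_integrable v pf2 isT) ?(plip_integrable v pu2 isT) //.
  by have := e2 v; rewrite /Pop /sg2; lra.
have p3a := plipZ 6^-1 (plipM pa (plipM pa pa)).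
have p3b := plipM paa pu1.
have p3 := plipD (leqnn 3) (isT : (1 + 0 <= 3)%N)
  (plipD (isT : (1 + (1 + 1) <= 3)%N) (isT : ((1 + 1) + 0 <= 3)%N) p3a p3b) (plipM pa pu2).
have L3' := lipbB (sg2 / 2) x0 (plip_lipb p3 isT) L1.
have [kap [u3 [K3 L3] e3]] := poi _ _ L3'.
have pu3 := plip_comp x0 L3.
have E3 v : \int[mu]_e (a v e ^+ 3 / 6 + a v e ^+ 2 / 2 * u1 (step e v) +
    a v e * u2 (step e v) + u3 (step e v)) = u3 v + sg2 / 2 * u1 v + kap.
  have -> : (fun e => a v e ^+ 3 / 6 + a v e ^+ 2 / 2 * u1 (step e v) + a v e * u2 (step e v) + u3 (step e v)) =
     fun e => (6^-1 * (a v e * (a v e * a v e)) + 2^-1 * (a v e * a v e) * u1 (step e v) +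
       a v e * u2 (step e v)) + u3 (step e v).
    by apply/funext => e; congr (_ + _ + _ + _); rewrite ?exprS ?expr0; field.
  rewrite iDE ?(plip_integrable v p3 isT) ?(plip_integrable v pu3 isT) //.
  by have := e3 v; rewrite /Pop; lra.
case: L1 L2 L3 => [m1 b1 _] [m2 b2 _] [m3 b3 _].
exists lam, sg2, kap, u1, u2, u3, (1 + `|K1| + `|K2| + `|K3|); split=> //.
- by rewrite -!addrA lerDl !addr_ge0.
- have n1 := ler_norm K1; have n2 := ler_norm K2; have n3 := ler_norm K3.
  have p1 := normr_ge0 K1; have p2 := normr_ge0 K2; have p3' := normr_ge0 K3.
  by split=> v; [apply: le_trans (b1 v) _|apply: le_trans (b2 v) _|apply: le_trans (b3 v) _]; lra.
Qed.

Local Notation Pn := (Pn mu step).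

(** lam and sg2 are the solvability constants of the first two Poisson
    equations.  The first conclusion ties them to the growth of second moments;
    the others bound window probabilities, half-line probabilities and the
    correlations of half-line events with functions psi 0 whose averages psi j
    decay geometrically. *)
Theorem contracting_cocycle_clt : T -> exists lam sg2 : R,
  (forall v, exists2 c : R, 0 <= c & forall n (delta : R), 0 < delta <= 1 ->
    `|Pn n (fun w => pos s lam n 0 w ^+ 2) v - n%:R * sg2| <=
    delta * Pn n (fun w => pos s lam n 0 w ^+ 2) v + c / delta) /\
  (0 < sg2 ->
   [/\ (forall c : R, 0 <= c -> exists2 C : R, 0 < C & forall n v y,
          Pn n (ind s lam c n y) v <= C * (Num.sqrt n.+1%:R)^-1),
       (exists2 C : R, 0 < C & forall n y v, (0 < n)%N ->
          `|Pn n (fun w => (pos s lam n y w <= 0)%R%:R) v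
             - Phi (- (pos s lam 0 y v / Num.sqrt (sg2 * n%:R)))|
          <= C * (Num.sqrt n%:R)^-1) &
       (forall q : R, 0 <= q < 1 -> exists2 C : R, 0 < C &
          forall (psi : nat -> T -> R) (H : R) n y v, (0 < n)%N -> 0 <= H ->
          (forall j, measurable_fun setT (psi j)) ->
          (forall j w, `|psi j w| <= H * q ^+ j) ->
          (forall j w, psi j.+1 w = Pop mu step (psi j) w) ->
          `|Pn n (fun w => psi 0%N w * (pos s lam n y w <= 0)%R%:R) v|
             <= C * H * (Num.sqrt n%:R)^-1)]).
Proof.
move=> x0; have [lam [sg2 [kap [u1 [u2 [u3 [Ku]]]]]]] := correctors x0.
move=> [Ku1 [m1 m2 m3] [b1 b2 b3] [e1 e2 e3]].
exists lam, sg2; split.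
  move=> v; have [c c0 hc] := second_moment mstep ms mell ell1 iell sstep Ku1 m1 m2 b1 b2 e1 e2 v.
  exists (c + Ku ^+ 2); first by rewrite addr_ge0 // sqr_ge0.
  move=> n delta /andP[d0 d1]; apply: le_trans (hc n delta d0) _.
  by rewrite lerD2l mulrDl lerD2r ler_peMr // invf_ge1.
move=> sg0; split.
- exact: (ind_concentration mstep ms mell ell1 iell sstep sg0 Ku1 m1 m2 m3 b1 b2 b3 e1 e2 e3).
- exact: (clt mstep ms mell ell1 iell sstep sg0 Ku1 m1 m2 m3 b1 b2 b3 e1 e2 e3).
- exact: (target mstep ms mell ell1 iell sstep sg0 Ku1 m1 m2 m3 b1 b2 b3 e1 e2 e3).
Qed.

End Package.

(** * Borel sets of matrices *)

Section BorelMatrix.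
Context {R : realType} {m n : nat}.
Local Notation MX := ('M[R]_(m, n)).

Lemma measurable_entry (i : 'I_m) (j : 'I_n) :
  measurable_fun setT (fun A : borel MX => A i j).
Proof.
apply: (measurability _ (RGenOpens.measurableE R)).
move=> _ [_ [a [b ->]] <-]; rewrite setTI.
apply: sub_sigma_algebra; apply: open_comp; last exact: interval_open.
by move=> A _; exact: coord_continuous.
Qed.

Definition box (q : 'M[rat]_(m, n)) (k : nat) : set MX :=
  [set A | forall i j, `|A i j - ratr (q i j)| < k.+1%:R^-1].

Lemma box_basis (U : set MX) (A : MX) : open U -> U A ->
  exists q k, box q k A /\ box q k `<=` U.
Proof.
move=> oU UA; have /nbhs_ballP[e /= e0 eU] : nbhs A U by exact: open_nbhs_nbhs.
have e20 : 0 < e / 2 by rewrite divr_gt0.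
pose k := Num.bound (e / 2)^-1.
have hk : k.+1%:R^-1 < e / 2.
  rewrite -[e / 2]invrK ltf_pV2 ?posrE ?invr_gt0 //.
  apply: lt_trans (archi_boundP _) _; first by rewrite invr_ge0 ltW.
  by rewrite ltr_nat.
have kp : 0 < k.+1%:R^-1 :> R by rewrite invr_gt0.
have /choice[q hq] : forall p : 'I_m * 'I_n, exists q : rat, `|A p.1 p.2 - ratr q| < k.+1%:R^-1.
  move=> [i j] /=; have h : A i j - k.+1%:R^-1 < A i j + k.+1%:R^-1.
    by rewrite ltrBlDr -addrA ltrDl addr_gt0.

  have [q] := rat_in_itvoo h; rewrite in_itv /= => /andP[q1 q2].
  exists q; move: (k.+1%:R^-1) q1 q2 => x q1 q2; rewrite ltr_norml; lra.
exists (\matrix_(i, j) q (i, j)), k; split.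
  by move=> i j; rewrite mxE; have := hq (i, j).
move=> B hB; apply: eU; split=> // i j; rewrite /ball /=.
have := hB i j; rewrite mxE => h1; have := hq (i, j) => /= h2.
rewrite (_ : A i j - B i j = (A i j - ratr (q (i, j))) - (B i j - ratr (q (i, j)))); last by ring.
apply: le_lt_trans (ler_normB _ _) _; move: (k.+1%:R^-1) hk h1 h2 => x; lra.
Qed.

Lemma measurable_forall2 d (T : measurableType d) (P : 'I_m -> 'I_n -> set T) :
  (forall i j, measurable (P i j)) -> measurable [set t | forall i j, P i j t].
Proof.
move=> mP.
have -> : [set t | forall i j, P i j t] =
   \bigcap_(p in [set: 'I_m * 'I_n]) P p.1 p.2.
  by apply/seteqP; split=> t /= h; [move=> [i j] _; exact: h | move=> i j; exact: (h (i, j))].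
by apply: fin_bigcap_measurable => // p _; exact: mP.
Qed.

Lemma measurable_box_preimage d (T : measurableType d) (f : T -> MX) q k :
  (forall i j, measurable_fun setT (fun t => f t i j)) -> measurable (f @^-1` box q k).
Proof.
move=> mf; apply: measurable_forall2 => i j.
have mg : measurable_fun setT (fun t => `|f t i j - ratr (q i j)|).
  by apply: measurableT_comp => //; exact: measurable_funB.
have := measurable_fun_ltr mg (measurable_cst (k.+1%:R^-1 : R)).
move=> /(_ measurableT [set true] I); rewrite setTI.
by congr (measurable _).
Qed.

(** Rational boxes form a countable basis, so measurable entries are enough. *)
Lemma measurable_mx d (T : measurableType d) (f : T -> borel MX) :
  (forall i j, measurable_fun setT (fun t => f t i j)) -> measurable_fun setT f.
Proof.
move=> mf; apply: (@measurability _ _ _ _ setT f (@open MX)) => // _ [U oU <-].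
rewrite setTI.
have -> : f @^-1` U = \bigcup_(p in [set: 'M[rat]_(m, n) * nat])
    (if `[< box p.1 p.2 `<=` U >] then f @^-1` box p.1 p.2 else set0).
  apply/seteqP; split=> [t Ut|t [[q k] _ /=]]; last first.
    by case: asboolP => // h; exact: h.
  have [q [k [h1 h2]]] := box_basis oU Ut.
  by exists (q, k) => //=; case: asboolP.
apply: countable_bigcupT_measurable; first exact: countableP.
move=> [q k] /=; case: asboolP => // _.
exact: measurable_box_preimage.
Qed.

Lemma measurable_box q k : measurable (box q k : set (borel MX)).
Proof.
have := @measurable_box_preimage _ (borel MX) id q k (fun i j => measurable_entry i j).
by rewrite preimage_id.
Qed.

(** The topology has a countable basis, so a Borel measure is carried by its support. *)
Lemma support_full (mu : probability (borel MX) R) (A : set (borel MX)) :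
  measurable A -> msupport mu `<=` A -> mu (~` A) = 0%E.
Proof.
move=> mA hA.
pose F (p : 'M[rat]_(m, n) * nat) : set (borel MX) :=
  if `[< mu (box p.1 p.2) = 0%E >] then box p.1 p.2 else set0.
have mF p : measurable (F p) by rewrite /F; case: asboolP => // _; exact: measurable_box.
have F0 p : mu (F p) = 0%E by rewrite /F; case: asboolP => // _; exact: measure0.
have cov : ~` A `<=` \bigcup_p F p.
  move=> a nAa; have : ~ msupport mu a by move=> /hA.
  rewrite /msupport /= => /existsNP[U] /not_implyP[oU] /not_implyP[Ua] /negP.
  rewrite -leNgt => U0.
  have [q [k [h1 h2]]] := box_basis oU Ua.
  exists (q, k) => //; rewrite /F /=.
  have -> : `[< mu (box q k) = 0%E >] = true; last by [].
  apply/asboolP/eqP; rewrite -measure_le0; apply: le_trans U0.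
  by apply: le_measure; rewrite ?inE //; [exact: measurable_box | exact: sub_sigma_algebra].
apply/eqP; rewrite -measure_le0.
apply: le_trans (_ : _ <= mu (\bigcup_p F p))%E _.
  apply: le_measure; rewrite ?inE //; first exact: measurableC.
  by apply: countable_bigcupT_measurable => //; exact: countableP.
have : mu.-negligible (\bigcup_(k in [set: nat]) (if choice.unpickle k is Some p then F p else set0)).
  apply: negligible_bigcup => k; case: (choice.unpickle k) => [p|]; last exact: negligible_set0.
  by exists (F p); split; [exact: mF|exact: F0|].
have -> : \bigcup_(k in [set: nat]) (if choice.unpickle k is Some p then F p else set0) = \bigcup_p F p.
  apply/seteqP; split=> [a [k _]|a [p _ Fp]].
    by case: (choice.unpickle k) => // p Fp; exists p.
  by exists (choice.pickle p) => //; rewrite choice.pickleK.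
move=> /negligibleP -> //.
by apply: countable_bigcupT_measurable => //; exact: countableP.
Qed.

End BorelMatrix.

(** * The projective action of positive matrices *)

Section Cone.
Context {R : realType} {d : nat}.
Variable C : R.
Hypothesis hd : (0 < d)%N.
Hypothesis C1 : 1 <= C.
Implicit Types (g : 'M[R]_d) (v w : 'cV[R]_d).

Let C0 : 0 < C. Proof. exact: lt_le_trans C1. Qed.
Let i0 : 'I_d := Ordinal hd.

Definition good g : Prop := forall i j, 0 < g i j /\ forall k, g i j <= C * g k j.
Definition tau g : 'M[R]_d := if `[< good g >] then g else const_mx 1.
Definition pcone v : Prop := (forall i, 0 <= v i 0) /\ exists i, 0 < v i 0.
Definition kap v : 'cV[R]_d := if `[< pcone v >] then v else const_mx 1.
(** tau and kap replace bad matrices and vectors by constant ones, so that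
    every step contracts; almost surely nothing is replaced along the walk. *)
Definition wstep g v : 'cV[R]_d := tau g *m kap v.
Definition onorm v : R := \sum_i v i 0.
Definition slog v : R := ln (onorm (kap v)).
(** The positive vectors whose entries are comparable: good matrices send the
    whole cone there. *)
Definition core v : Prop := forall i, 0 < v i 0 /\ forall k, v i 0 <= C * v k 0.

Lemma good_tau g : good (tau g).
Proof.
rewrite /tau; case: asboolP => // _ i j; rewrite !mxE; split=> // k.
by rewrite mxE mulr1.
Qed.

Lemma cone_kap v : pcone (kap v).
Proof.
rewrite /kap; case: asboolP => // _; split=> [i|]; first by rewrite mxE.
by exists i0; rewrite mxE.
Qed.

Lemma core_cone v : core v -> pcone v.
Proof. by move=> h; split=> [i|]; [rewrite ltW //; case: (h i)|exists i0; case: (h i0)]. Qed.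

Lemma tau_id g : good g -> tau g = g.
Proof. by move=> h; rewrite /tau asboolT. Qed.

Lemma kap_id v : pcone v -> kap v = v.
Proof. by move=> h; rewrite /kap asboolT. Qed.

Lemma core_mul g v : good g -> pcone v -> core (g *m v).
Proof.
move=> hg [v0 [j vj]] i; split=> [|k]; rewrite !mxE.
  rewrite (bigD1 j) //= ltr_pwDl //; first by rewrite mulr_gt0 //; case: (hg i j).
  by apply: sumr_ge0 => l _; rewrite mulr_ge0 // ltW //; case: (hg i l).
rewrite mulr_sumr; apply: ler_sum => l _; rewrite mulrA ler_wpM2r //.
by have [_] := hg i l; apply.
Qed.

Lemma core_step g v : core (wstep g v).
Proof. by apply: core_mul; [exact: good_tau | exact: cone_kap]. Qed.

Lemma kap_step g v : kap (wstep g v) = wstep g v.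
Proof. by apply: kap_id; apply: core_cone; exact: core_step. Qed.

Lemma good_mul g g' : good g -> good g' -> good (g *m g').
Proof.
move=> hg hg' i j; split=> [|k]; rewrite !mxE.
  rewrite (bigD1 i0) //= ltr_pwDl //; first by rewrite mulr_gt0 //; [case: (hg i i0)|case: (hg' i0 j)].
  by apply: sumr_ge0 => l _; rewrite mulr_ge0 // ltW //; [case: (hg i l)|case: (hg' l j)].
rewrite mulr_sumr; apply: ler_sum => l _; rewrite mulrA ler_wpM2r //.
  by rewrite ltW //; case: (hg' l j).
by have [_] := hg i l; apply.
Qed.

Lemma onorm_gt0 v : pcone v -> 0 < onorm v.
Proof.
move=> [v0 [j vj]]; rewrite /onorm (bigD1 j) //= ltr_pwDl //.
by apply: sumr_ge0.
Qed.

Lemma onorm_mul g v : onorm (g *m v) = \sum_j (\sum_i g i j) * v j 0.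
Proof.
rewrite /onorm; under eq_bigr do rewrite mxE.
rewrite exchange_big /=; apply: eq_bigr => j _; by rewrite mulr_suml.
Qed.

Lemma slog_step g v : slog (wstep g v) = ln (onorm (wstep g v)).
Proof. by rewrite /slog kap_step. Qed.

Definition csum g (j : 'I_d) : R := \sum_i g i j.
Definition lsize g : R := 1 + \sum_j `|ln (csum (tau g) j)|.

Lemma lsize_ge1 g : 1 <= lsize g.
Proof. by rewrite lerDl sumr_ge0. Qed.

Lemma csum_gt0 g j : good g -> 0 < csum g j.
Proof.
move=> hg; rewrite /csum (bigD1 i0) //= ltr_pwDl //; first by case: (hg i0 j).
by apply: sumr_ge0 => i _; rewrite ltW //; case: (hg i j).
Qed.

(** onorm (g *m v) / onorm v is an average of the column sums of g. *)
Lemma slog_incr g v : `|slog (wstep g v) - slog v| <= lsize g.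
Proof.
rewrite slog_step /slog.
have hg := good_tau g; have hv := cone_kap v; have [v0 _] := hv.
have n0 := onorm_gt0 hv.
have m0 : 0 < onorm (wstep g v) by apply: onorm_gt0; apply: core_cone; exact: core_step.
rewrite -lnV ?posrE // -lnM ?posrE ?invr_gt0 //.
pose L := \sum_j `|ln (csum (tau g) j)|.
have hL j : `|ln (csum (tau g) j)| <= L.
  by rewrite /L (bigD1 j) //= lerDl sumr_ge0.
have hj j : expR (- L) <= csum (tau g) j <= expR L.
  have c0 := csum_gt0 j hg.
  have := hL j; rewrite ler_norml => /andP[h1 h2].
  by rewrite -[csum _ _]lnK ?posrE // !ler_expR h1 h2.
have hlo : expR (- L) <= onorm (wstep g v) / onorm (kap v).
  rewrite ler_pdivlMr // /wstep onorm_mul /onorm mulr_sumr; apply: ler_sum => j _.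
  by rewrite ler_wpM2r //; case/andP: (hj j).
have hhi : onorm (wstep g v) / onorm (kap v) <= expR L.
  rewrite ler_pdivrMr // /wstep onorm_mul /onorm mulr_sumr; apply: ler_sum => j _.
  by rewrite ler_wpM2r //; case/andP: (hj j).
have q0 : 0 < onorm (wstep g v) / onorm (kap v) by rewrite divr_gt0.
apply: (@le_trans _ _ L); last by rewrite /lsize lerDr.
by rewrite ler_norml -(expRK (- L)) -[X in _ && (_ <= X)]expRK !ler_ln ?posrE ?expR_gt0 // hlo.
Qed.

(** The projective distance max_(i,j) (v_i w_j) / (w_i v_j) - 1, whose
    logarithm would be the Hilbert metric. *)
Definition pd v w : R :=
  \big[Num.max/1]_(p : 'I_d * 'I_d) (v p.1 0 * w p.2 0 / (w p.1 0 * v p.2 0)) - 1.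

Definition pos_vec v : Prop := forall i, 0 < v i 0.

Lemma core_pos v : core v -> pos_vec v.
Proof. by move=> h i; case: (h i). Qed.

Lemma pd_ge0 v w : 0 <= pd v w.
Proof. by rewrite /pd subr_ge0; exact: bigmax_ge_id. Qed.

Lemma pdP v w i j : pos_vec v -> pos_vec w ->
  v i 0 * w j 0 <= (1 + pd v w) * (w i 0 * v j 0).
Proof.
move=> hv hw; rewrite -ler_pdivrMr ?mulr_gt0 // /pd addrC subrK.
exact: (@le_bigmax _ _ _ _ (fun p : 'I_d * 'I_d => v p.1 0 * w p.2 0 / (w p.1 0 * v p.2 0)) (i, j)).
Qed.

Lemma pd_le v w x : pos_vec v -> pos_vec w -> 0 <= x ->
  (forall i j, v i 0 * w j 0 <= (1 + x) * (w i 0 * v j 0)) -> pd v w <= x.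
Proof.
move=> hv hw x0 h; rewrite /pd lerBlDr; apply: bigmax_le => [|[i j] _ /=].
  by rewrite lerDr.
by rewrite ler_pdivrMr ?mulr_gt0 // addrC.
Qed.

Lemma pd_core v w : core v -> core w -> pd v w <= C ^+ 2.
Proof.
move=> hv hw; have pv := core_pos hv; have pw := core_pos hw.
apply: pd_le => // [|i j]; first exact: sqr_ge0.
have [_ h1] := hv i; have [_ h2] := hw j.
apply: (@le_trans _ _ ((C * v j 0) * (C * w i 0))).
  by apply: ler_pM => //; exact: ltW.
have := mulr_gt0 (pw i) (pv j); rewrite mulrDl mul1r => h.
apply: (@le_trans _ _ (C ^+ 2 * (w i 0 * v j 0))); last by rewrite lerDr ltW.
by rewrite le_eqVlt; apply/orP; left; apply/eqP; ring.
Qed.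

Definition rate : R := Num.max (1 - (C ^+ 2)^-1) 2^-1.

Let e := (C ^+ 2)^-1.
Let e0 : 0 < e. Proof. by rewrite invr_gt0 exprn_gt0. Qed.
Let e1 : e <= 1. Proof. by rewrite invf_le1 ?exprn_gt0 // exprn_ege1. Qed.

Lemma rate_lt1 : 0 <= rate < 1.
Proof.
rewrite /rate le_max gt_max invr_ge0 ler0n orbT /=.
apply/andP; split; first by have := e0; rewrite /e; lra.
by rewrite invf_lt1 // ltr1n.
Qed.

(** The rows of g, weighted by w, are probability vectors that dominate
    e times one another; this common part is forgotten. *)
Lemma pd_contract g v w : good g -> pos_vec v -> pos_vec w ->
  pd (g *m v) (g *m w) <= (1 - e) * pd v w.
Proof.
move=> hg hv hw.
have cv := core_mul hg (_ : pcone v); have cw := core_mul hg (_ : pcone w).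
have pcv : pcone v by split=> [i|]; [exact: ltW | exists i0].
have pcw : pcone w by split=> [i|]; [exact: ltW | exists i0].
have {}cv := cv pcv; have {}cw := cw pcw.
have pv := core_pos cv; have pw := core_pos cw.
have D0 := pd_ge0 v w.
have e1' : 0 <= 1 - e by rewrite subr_ge0.
apply: pd_le => // [|i k]; first exact: mulr_ge0.
(* v lies between m w and (1 + pd v w) m w *)
have [j0 _ hj0] := @arg_minP _ R 'I_d i0 xpredT (fun j => v j 0 / w j 0) isT.
pose m := v j0 0 / w j0 0.
have lo j : m * w j 0 <= v j 0 by rewrite -ler_pdivlMr //; exact: hj0.
have hi j : v j 0 <= (1 + pd v w) * m * w j 0.
  have := pdP j j0 hv hw; rewrite -ler_pdivlMr // => h; apply: (le_trans h).
  by rewrite le_eqVlt; apply/orP; left; apply/eqP; rewrite /m; ring.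
have m0 : 0 < m by rewrite divr_gt0.
pose V l := (g *m v) l 0; pose W l := (g *m w) l 0.
have VE l : V l = \sum_j g l j * v j 0 by rewrite /V mxE.
have WE l : W l = \sum_j g l j * w j 0 by rewrite /W mxE.
rewrite -/(V i) -/(W k) -/(W i) -/(V k).
have W0 l : 0 < W l by exact: pw.
have lV l : m * W l <= V l.
  by rewrite VE WE mulr_sumr; apply: ler_sum => j _; rewrite mulrCA ler_wpM2l // ltW //; case: (hg l j).
have dom j : e * (g k j * W i) <= g i j * W k.
  have [_ hg1] := hg k j; have [_ hW] := cw i.
  have gk0 : 0 < g k j by case: (hg k j).
  have gi0 : 0 < g i j by case: (hg i j).
  rewrite /e mulrC ler_pdivrMr ?exprn_gt0 //.
  apply: (@le_trans _ _ ((C * g i j) * (C * W k))).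
    by apply: ler_pM; rewrite ?(ltW gk0) ?(ltW (W0 _)) //; exact: hW.
  by rewrite le_eqVlt; apply/orP; left; apply/eqP; ring.
have step1 : \sum_j (g i j * W k - e * (g k j * W i)) * v j 0 <=
    \sum_j (g i j * W k - e * (g k j * W i)) * ((1 + pd v w) * m * w j 0).
  by apply: ler_sum => j _; rewrite ler_wpM2l // subr_ge0.
have lin (f : 'I_d -> R) : \sum_j (g i j * W k - e * (g k j * W i)) * f j =
   W k * (\sum_j g i j * f j) - e * W i * (\sum_j g k j * f j).
  by rewrite !mulr_sumr -sumrB; apply: eq_bigr => j _; ring.
have linm l : \sum_j g l j * ((1 + pd v w) * m * w j 0) = (1 + pd v w) * m * W l.
  by rewrite WE mulr_sumr; apply: eq_bigr => j _; ring.
rewrite !lin !linm -!VE in step1.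
have lVk := lV k; set D := pd v w in step1 D0 *.
have q : (1 - e) * (1 + D) * W i * (m * W k) <= (1 - e) * (1 + D) * W i * V k.
  by rewrite ler_wpM2l // mulr_ge0 ?(ltW (W0 _)) // mulr_ge0 // addr_ge0.
move: step1 q; move: (V i) (V k) (W i) (W k) => Vi Vk Wi Wk; nra.
Qed.

(** Scale invariance makes pd a distance between directions; the factor
    onorm v / onorm w is controlled as well. *)
Lemma pd_onorm g v w : good g -> pos_vec v -> pos_vec w ->
  onorm (g *m v) * onorm w <= (1 + pd v w) * (onorm (g *m w) * onorm v).
Proof.
move=> hg hv hw; rewrite !onorm_mul /onorm !big_distrlr /= mulr_sumr.
apply: ler_sum => k _; rewrite mulr_sumr; apply: ler_sum => j _.
rewrite -!mulrA [X in _ <= X]mulrCA ler_wpM2l //; last exact: pdP.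
by apply: sumr_ge0 => i _; rewrite ltW //; case: (hg i k).
Qed.

Lemma pd_sym v w : pos_vec v -> pos_vec w -> pd w v <= pd v w.
Proof.
move=> hv hw; apply: pd_le => //; first exact: pd_ge0.
move=> i j; have := pdP j i hv hw.
by rewrite [v j 0 * _]mulrC [w j 0 * _]mulrC.
Qed.

Definition maxdist : R := 2 + 2 * C ^+ 2.
(** Off the core the distance is a constant so large that the first step,
    which lands in the core, still contracts. *)
Definition pdist v w : R := if `[< core v /\ core w >] then pd v w else maxdist.

Lemma pdist_ge0 v w : 0 <= pdist v w.
Proof.
rewrite /pdist; case: asboolP => _; first exact: pd_ge0.
by rewrite /maxdist; have := sqr_ge0 C; lra.
Qed.

Lemma pdist_le v w : pdist v w <= maxdist.
Proof.
rewrite /pdist; case: asboolP => // -[hv hw]; apply: le_trans (pd_core hv hw) _.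
by rewrite /maxdist; have := sqr_ge0 C; lra.
Qed.

Lemma pdist_core v w : core v -> core w -> pdist v w = pd v w.
Proof. by move=> hv hw; rewrite /pdist asboolT. Qed.

Lemma pdist_step g v w : pdist (wstep g v) (wstep g w) <= rate * pdist v w.
Proof.
rewrite pdist_core; [|exact: core_step|exact: core_step].
have [[hv hw]|h] := pselect (core v /\ core w).
  rewrite pdist_core // /wstep !kap_id; [|exact: core_cone|exact: core_cone].
  apply: le_trans (pd_contract (good_tau g) (core_pos hv) (core_pos hw)) _.
  by rewrite ler_wpM2r ?pd_ge0 // /rate le_max lexx.
rewrite /pdist asboolF //.
apply: le_trans (pd_core (core_step _ _) (core_step _ _)) _.
apply: (@le_trans _ _ (2^-1 * maxdist)).
  by rewrite /maxdist; have := sqr_ge0 C; lra.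
by rewrite ler_wpM2r /rate ?le_max ?lexx ?orbT // /maxdist; have := sqr_ge0 C; lra.
Qed.

Lemma slog_lip g v w :
  `|(slog (wstep g v) - slog v) - (slog (wstep g w) - slog w)| <= lsize g * pdist v w.
Proof.
have L1 := lsize_ge1 g; have L0 : 0 <= lsize g by exact: le_trans L1.
have [[hv hw]|h] := pselect (core v /\ core w); last first.
  rewrite /pdist asboolF //; apply: le_trans (ler_normB _ _) _.
  apply: le_trans (lerD (slog_incr g v) (slog_incr g w)) _.
  by rewrite /maxdist; have := mulr_ge0 L0 (sqr_ge0 C); lra.
rewrite pdist_core //; apply: (@le_trans _ _ (pd v w)); last by rewrite ler_peMl // pd_ge0.
have pv := core_pos hv; have pw := core_pos hw.
have key v' w' : core v' -> core w' ->
    (slog (wstep g v') - slog v') - (slog (wstep g w') - slog w') <= pd v' w'.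
  move=> hv' hw'; have cv := core_cone hv'; have cw := core_cone hw'.
  rewrite !slog_step /slog /wstep !kap_id //.
  have hg := good_tau g.
  have n1 := onorm_gt0 cv; have n2 := onorm_gt0 cw.
  have n3 := onorm_gt0 (core_cone (core_mul hg cv)); have n4 := onorm_gt0 (core_cone (core_mul hg cw)).
  have := pd_onorm hg (core_pos hv') (core_pos hw').
  have D1 : 0 < 1 + pd v' w' by rewrite ltr_pwDl // pd_ge0.
  rewrite -ler_ln ?posrE ?mulr_gt0 // !lnM ?posrE ?mulr_gt0 //.
  have : ln (1 + pd v' w') <= pd v' w'.
    by rewrite -ler_expR lnK ?posrE // expR_ge1Dx.
  lra.
rewrite ler_norml; apply/andP; split; last exact: key.
by have := key w v hw hv; have := pd_sym pv pw; lra.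
Qed.

End Cone.

(** * Walks driven by independent noise *)

Section Link.
Context {R : realType} {dO dE dT : measure_display}.
Context {Omega : measurableType dO} {E : measurableType dE} {T : measurableType dT}.
Variables (P : probability Omega R) (mu : probability E R) (g : nat -> {RV P >-> E}).
Hypothesis g_iid : iid mu g.
Variable step : E -> T -> T.
Hypothesis mstep : measurable_fun setT (fun p : T * E => step p.2 p.1).
Variable x : T.

Fixpoint walk n (w : Omega) : T :=
  if n is n'.+1 then step (g n' w) (walk n' w) else x.

Let mg n : measurable_fun setT (g n). Proof. exact: measurable_funPT. Qed.

Lemma measurable_walk n : measurable_fun setT (walk n).
Proof.
elim: n => [|n ih]; first exact: measurable_cst.
have mp : measurable_fun setT (fun w => (walk n w, g n w)) by exact: measurable_fun_pair.
exact: measurableT_comp mstep mp.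
Qed.

Definition future (J : {fset nat}) (B : nat -> set E) : set Omega :=
  \bigcap_(k in [set` J]) (g k @^-1` B k).

Lemma measurable_future J B : (forall k, measurable (B k)) -> measurable (future J B).
Proof.
move=> mB; apply: fin_bigcap_measurable; first exact: finite_fset.
by move=> k _; rewrite -[X in measurable X]setTI; exact: mg.
Qed.

Lemma future_cons n J B A : n \notin J ->
  future (n |` J)%fset (fun k => if k == n then A else B k) = g n @^-1` A `&` future J B.
Proof.
move=> nJ; apply/seteqP; split=> w.
  move=> h; split.
    by have := h n; rewrite /= in_fset1U eqxx; exact.
  move=> k /= kJ; have := h k; rewrite /= in_fset1U kJ orbT => /(_ isT).
  by case: eqP => // kn; rewrite -kn kJ in nJ.
move=> [h1 h2] k /=; rewrite in_fset1U; case: eqP => [->//|_] /= kJ.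
exact: h2.
Qed.

Lemma future_indep n J B A : n \notin J -> measurable A -> (forall k, measurable (B k)) ->
  P (g n @^-1` A `&` future J B) = (mu A * P (future J B))%E.
Proof.
move=> nJ mA mB; have [g1 g2] := g_iid.
have mB' k : measurable (if k == n then A else B k) by case: ifP.
rewrite -future_cons // (g2 _ _ mB') (g2 _ _ mB) big_fsetU1 //= eqxx g1 //.
congr (_ * _)%E; apply: eq_fbigr => k kJ _ /=.
by case: eqP => // kn; rewrite -kn kJ in nJ.
Qed.

(** Rectangles generate the product sigma-algebra and are stable under
    intersection. *)
Lemma rectangles_determine (m1 m2 : {measure set (T * E) -> \bar R}) :
  (m1 setT < +oo)%E ->
  (forall A B, measurable A -> measurable B -> m1 (A `*` B) = m2 (A `*` B)) ->
  forall X, measurable X -> m1 X = m2 X.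
Proof.
move=> m1T h X mX.
apply: (measure_unique [set A `*` B | A in measurable & B in measurable] (fun=> setT)) => //.
- exact: measurable_prod_measurableType.
- move=> _ _ [A1 mA1 [A2 mA2 <-]] [B1 mB1 [B2 mB2 <-]].
  exists (A1 `&` B1); first exact: measurableI.
  exists (A2 `&` B2); first exact: measurableI.
  by rewrite setXI.
- by move=> _; exists setT => //; exists setT => //; rewrite setXTT.
- by rewrite bigcup_const.
- by move=> _ [A mA [B mB <-]]; exact: h.
Qed.

Definition walkRV n : {RV P >-> T} :=
  HB.pack (walk n) (isMeasurableFun.Build _ _ _ _ _ (measurable_walk n)).

(** The state at time n is independent of the noise from time n on; in the
    induction the law of (walk n, g n), restricted to a later event, is a
    multiple of a product measure because the two agree on rectangles. *)
Lemma walk_indep n : forall A J B, measurable A -> (forall k, measurable (B k)) ->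
  (forall k, k \in J -> (n <= k)%N) ->
  P (walk n @^-1` A `&` future J B) = (P (walk n @^-1` A) * P (future J B))%E.
Proof.
elim: n => [|n ih] A J B mA mB hJ.
  have [xA|xA] := pselect (A x).
    have -> : walk 0 @^-1` A = setT by apply/seteqP; split.
    by rewrite setTI probability_setT mul1e.
  have -> : walk 0 @^-1` A = set0 by apply/seteqP; split.
  by rewrite set0I measure0 mul0e.
pose XY w := (walk n w, g n w).
have mXY : measurable_fun setT XY by exact: measurable_fun_pair (measurable_walk n) (mg n).
pose law := (distribution P (walkRV n) \x mu)%E.
have joint (J' : {fset nat}) : (forall k, k \in J' -> (n < k)%N) -> forall X, measurable X ->
    P (XY @^-1` X `&` future J' B) = (P (future J' B) * law X)%E.
  move=> hJ' X mX; have mF := measurable_future J' mB.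
  pose m1' := [the {measure set (T * E) -> \bar R} of pushforward (mrestr P mF) XY].
  pose m1 := m1' mXY.
  have r0 : 0 <= fine (P (future J' B)) by rewrite fine_ge0.
  have rE : (fine (P (future J' B)))%:E = P (future J' B) by rewrite fineK // fin_num_measure.
  pose m2 := [the {measure set (T * E) -> \bar R} of mscale (NngNum r0) law].
  have : m1 X = m2 X.
    apply: rectangles_determine => //.
      rewrite /m1 /= /pushforward /mrestr preimage_setT setTI.
      by apply: le_lt_trans (probability_le1 P mF) (ltry _).
    move=> A1 A2 mA1 mA2; rewrite /m1 /m2 /= /mscale /pushforward /mrestr /= rE /law product_measure1E //.
    have nJ : n \notin J' by apply/negP => /hJ'; rewrite ltnn.
    have -> : XY @^-1` (A1 `*` A2) `&` future J' B =
        walk n @^-1` A1 `&` future (n |` J')%fset (fun k => if k == n then A2 else B k).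
      by rewrite future_cons // setIA.
    rewrite ih //.
    - by rewrite future_cons // future_indep // muleA [RHS]muleC.
    - by move=> k; case: ifP.
    - by move=> k; rewrite in_fset1U => /predU1P[->//|/hJ'/ltnW].
  by rewrite /m1 /m2 /= /mscale /pushforward /mrestr /= rE.
have mpre : measurable ((fun p : T * E => step p.2 p.1) @^-1` A).
  by rewrite -[X in measurable X]setTI; exact: mstep.
have -> : walk n.+1 @^-1` A = XY @^-1` ((fun p : T * E => step p.2 p.1) @^-1` A) by [].
rewrite (joint J hJ _ mpre).
have := joint fset0 _ _ mpre.
have -> : future fset0 B = setT by apply/seteqP; split=> // w _ k.
by rewrite setIT probability_setT mul1e => -> //; rewrite muleC.
Qed.

Lemma walk_joint n (X : set (T * E)) : measurable X ->
  P ((fun w => (walk n w, g n w)) @^-1` X) = (distribution P (walkRV n) \x mu)%E X.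
Proof.
move=> mX; pose XY w := (walk n w, g n w).
have mXY : measurable_fun setT XY by exact: measurable_fun_pair (measurable_walk n) (mg n).
pose m1' := [the {measure set (T * E) -> \bar R} of pushforward P XY].
pose m1 := m1' mXY.
pose m2 := [the {measure set (T * E) -> \bar R} of (distribution P (walkRV n) \x mu)%E].
have : m1 X = m2 X; last by [].
apply: rectangles_determine => //.
  by rewrite /m1 /= /pushforward preimage_setT probability_setT ltry.
move=> A1 A2 mA1 mA2; rewrite /m1 /m2 /= /pushforward product_measure1E //.
have [g1 g2] := g_iid.
have mB k : measurable (if k == n then A2 else setT) by case: ifP.
have := @walk_indep n A1 [fset n]%fset _ mA1 mB.
have -> : future [fset n]%fset (fun k => if k == n then A2 else setT) = g n @^-1` A2.
  apply/seteqP; split=> w.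
    by move=> h; have := h n; rewrite /= inE eqxx; exact.
  by move=> h k /=; rewrite inE => /eqP ->; rewrite eqxx.
move=> h; transitivity (P (walk n @^-1` A1) * P (g n @^-1` A2))%E.
  by apply: h => k; rewrite inE => /eqP ->.
by congr (_ * _)%E; exact: g1.
Qed.

Lemma walk_step n (F : T -> \bar R) : measurable_fun setT F -> (forall v, 0 <= F v)%E ->
  (\int[P]_w F (walk n.+1 w) = \int[P]_w \int[mu]_e F (step e (walk n w)))%E.
Proof.
move=> mF F0.
pose XY w := (walk n w, g n w).
have mXY : measurable_fun setT XY by exact: measurable_fun_pair (measurable_walk n) (mg n).
pose G (p : T * E) := F (step p.2 p.1).
have mG : measurable_fun setT G by exact: measurableT_comp.
have e1 := @ge0_integral_pushforward _ _ _ _ R XY mXY P setT G measurableT mG (fun y _ => F0 _).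
rewrite preimage_setT in e1.
have -> : (\int[P]_w F (walk n.+1 w) = \int[P]_w (G \o XY) w)%E by [].
rewrite -e1.
transitivity (\int[distribution P (walkRV n) \x mu]_p G p)%E.
  apply: eq_measure_integral => A mA _; exact: walk_joint.
rewrite fubini_tonelli1 //; last by move=> p; exact: F0.
have mI : measurable_fun setT (fun v => \int[mu]_e G (v, e))%E.
  by have := measurable_fun_fubini_tonelli_F (m2 := mu) G mG (fun _ => F0 _).
have I0 v : (0 <= \int[mu]_e G (v, e))%E by apply: integral_ge0 => e _; exact: F0.
by rewrite (@ge0_integral_distribution _ _ _ _ _ P (walkRV n) _ mI I0).
Qed.

End Link.

Section LinkPn.
Context {R : realType} {dO dE dT : measure_display}.
Context {Omega : measurableType dO} {E : measurableType dE} {T : measurableType dT}.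
Variables (P : probability Omega R) (mu : probability E R) (g : nat -> {RV P >-> E}).
Hypothesis g_iid : iid mu g.
Variables (step : E -> T -> T) (s : T -> R) (ell : E -> R).
Hypothesis mstep : measurable_fun setT (fun p : T * E => step p.2 p.1).
Hypothesis ms : measurable_fun setT s.
Hypothesis mell : measurable_fun setT ell.
Hypothesis ell1 : forall e, 1 <= ell e.
Hypothesis iell : mu.-integrable setT (EFin \o (fun e => ell e ^+ 8)).
Hypothesis sstep : forall e v, `|s (step e v) - s v| <= ell e.
Variable x : T.

(** The last factor is independent of the walk, so integrating it first applies
    the transfer operator once. *)
Lemma link n : forall F, adm s F -> (forall v, 0 <= F v) ->
  (\int[P]_w (F (walk g step x n w))%:E = (Pn mu step n F x)%:E)%E.
Proof.
elim: n => [|n ih] F aF F0.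
  have -> : (fun w => (F (walk g step x 0 w))%:E) = cst (F x)%:E by [].
  rewrite integral_cst //. by rewrite [X in (_ * X)%E](_ : _ = 1%E) ?mule1 //; exact: probability_setT.
have mF : measurable_fun setT (EFin \o F) by apply/measurable_EFinP; case: aF.
have aP := adm_Pop mstep mell ell1 iell sstep aF.
rewrite (walk_step g_iid mstep x n mF (fun v => _ : (0 <= (EFin \o F) v)%E)); last first.
  by move=> v; rewrite lee_fin.
rewrite Pn_S -ih //; last by move=> v; apply: Rintegral_ge0.
apply: eq_integral => w _; rewrite /Pop /Rintegral fineK //.
apply: integrable_fin_num => //.
exact: (adm_step mstep ell1 iell sstep (walk g step x n w) aF).
Qed.

Lemma link_real n F : adm s F ->
  P.-integrable setT (EFin \o (fun w => F (walk g step x n w))) /\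
  \int[P]_w F (walk g step x n w) = Pn mu step n F x.
Proof.
move=> aF; have [mF [K K0 hK]] := aF.
pose Fp v := (F v + `|F v|) / 2; pose Fm v := (`|F v| - F v) / 2.
have aN := adm_norm aF.
have aFp : adm s Fp.
  have := admZ 2^-1 (admD aF aN); congr (adm s _).
  by apply/funext => v; rewrite /Fp mulrC.
have aFm : adm s Fm.
  have := admZ 2^-1 (admB aN aF); congr (adm s _).
  by apply/funext => v; rewrite /Fm mulrC.
have Fp0 v : 0 <= Fp v by rewrite /Fp divr_ge0 //; have := ler_norm (- F v); rewrite normrN; lra.
have Fm0 v : 0 <= Fm v by rewrite /Fm divr_ge0 // subr_ge0 ler_norm.
have FE v : F v = Fp v - Fm v by rewrite /Fp /Fm; field.
have mw := measurable_walk g mstep x n.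
have ip (G : T -> R) : adm s G -> (forall v, 0 <= G v) ->
    P.-integrable setT (EFin \o (fun w => G (walk g step x n w))).
  move=> aG G0; apply/integrableP; split.
    by apply/measurable_EFinP; apply: measurableT_comp mw; case: aG.
  under eq_integral do rewrite /= ger0_norm //.
  by rewrite link // ltry.
have e : (fun w => F (walk g step x n w)) = fun w => Fp (walk g step x n w) - Fm (walk g step x n w).
  by apply/funext => w; rewrite FE.
split.
  rewrite e; have := integrableB measurableT (ip _ aFp Fp0) (ip _ aFm Fm0).
  exact: eq_integrable.
rewrite e RintegralB //; [|exact: ip|exact: ip].
rewrite /Rintegral !link //=.
have -> : F = fun v => Fp v - Fm v by apply/funext => v; rewrite FE.
by rewrite (PnB mstep mell ell1 iell sstep n aFp aFm).
Qed.

End LinkPn.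

(** * Measurability of the projective action *)

Section MeasurableCone.
Context {R : realType} {d : nat}.
Variable C : R.
Hypothesis hd : (0 < d)%N.
Local Notation MX := (borel 'M[R]_d).
Local Notation VX := (borel 'cV[R]_d).

Lemma measurable_ltS dT (T : measurableType dT) (f h : T -> R) :
  measurable_fun setT f -> measurable_fun setT h -> measurable [set t | f t < h t].
Proof.
move=> mf mh; have := measurable_fun_ltr mf mh measurableT (I : measurable [set true]).
by rewrite setTI; congr (measurable _).
Qed.

Lemma measurable_leS dT (T : measurableType dT) (f h : T -> R) :
  measurable_fun setT f -> measurable_fun setT h -> measurable [set t | f t <= h t].
Proof.
move=> mf mh; have := measurable_fun_ler mf mh measurableT (I : measurable [set true]).
by rewrite setTI; congr (measurable _).
Qed.

Lemma measurable_asbool dT (T : measurableType dT) (A : set T) :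
  measurable A -> measurable_fun setT (fun t => `[< A t >]).
Proof.
move=> mA; apply: (measurable_fun_bool true).
rewrite setTI; rewrite (_ : _ @^-1` _ = A) //.
by apply/seteqP; split=> t /= /asboolP.
Qed.

Lemma measurable_ifS dT dU (T : measurableType dT) (U : measurableType dU) (A : set T)
    (f h : T -> U) : measurable A -> measurable_fun setT f -> measurable_fun setT h ->
  measurable_fun setT (fun t => if `[< A t >] then f t else h t).
Proof. by move=> mA mf mh; apply: measurable_fun_ifT => //; exact: measurable_asbool. Qed.

Lemma measurable_good : measurable ([set g | good C g] : set MX).
Proof.
apply: (@measurable_forall2 d d _ MX (fun i j => [set g : MX | 0 < g i j /\ forall k, g i j <= C * g k j])).
move=> i j; apply: measurableI.
  by apply: measurable_ltS; [exact: measurable_cst|exact: measurable_entry].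
rewrite [X in measurable X](_ : _ =
   \bigcap_(k in [set: 'I_d]) [set g : MX | g i j <= C * g k j]); last first.
  by apply/seteqP; split=> t /= h; [move=> k _; exact: h | move=> k; exact: (h k)].
apply: fin_bigcap_measurable => // k _.
apply: measurable_leS; first exact: measurable_entry.
by apply: measurable_funM; [exact: measurable_cst|exact: measurable_entry].
Qed.

Lemma measurable_tau : measurable_fun setT (tau C : MX -> MX).
Proof. by apply: measurable_ifS; [exact: measurable_good|exact: measurable_id|exact: measurable_cst]. Qed.

Lemma measurable_onorm : measurable_fun setT (@onorm R d : VX -> R).
Proof. by apply: measurable_sum => i; exact: measurable_entry. Qed.

Lemma measurable_cone_set : measurable ([set v | pcone v] : set VX).
Proof.
rewrite (_ : [set v | pcone v] = (\bigcap_(i in [set: 'I_d]) [set v : VX | 0 <= v i 0]) `&`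
    [set v : VX | 0 < onorm v]).
  apply: measurableI.
    apply: fin_bigcap_measurable => // i _.
    by apply: measurable_leS; [exact: measurable_cst|exact: measurable_entry].
  by apply: measurable_ltS; [exact: measurable_cst|exact: measurable_onorm].
apply/seteqP; split=> v /=.
  by move=> hv; split; [move=> i _; exact: hv.1 | exact: onorm_gt0].
move=> [h1 h2]; split=> [i|]; first exact: (h1 i).
apply: contrapT => /forallNP h; move: h2; rewrite /onorm big1 ?ltxx // => i _.
by apply/eqP; rewrite eq_le (h1 i I) andbT leNgt; apply/negP; exact: h.
Qed.

Lemma measurable_kap : measurable_fun setT (kap : VX -> VX).
Proof.
by apply: measurable_ifS; [exact: measurable_cone_set|exact: measurable_id|exact: measurable_cst].
Qed.

Lemma measurable_mulmx dT (T : measurableType dT) m n p (A : T -> borel 'M[R]_(m, n))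
    (B : T -> borel 'M[R]_(n, p)) :
  measurable_fun setT A -> measurable_fun setT B ->
  measurable_fun setT (fun t => (A t : 'M[R]_(m, n)) *m (B t : 'M[R]_(n, p)) : borel 'M[R]_(m, p)).
Proof.
move=> mA mB; apply: measurable_mx => i j; under eq_fun do rewrite mxE.
apply: measurable_sum => k; apply: measurable_funM.
  exact: measurableT_comp (measurable_entry i k) mA.
exact: measurableT_comp (measurable_entry k j) mB.
Qed.

Lemma measurable_wstep : measurable_fun setT (fun p : VX * MX => wstep C p.2 p.1 : VX).
Proof.
apply: measurable_mulmx.
  exact: measurableT_comp measurable_tau measurable_snd.
exact: measurableT_comp measurable_kap measurable_fst.
Qed.

Lemma measurable_slog : measurable_fun setT (@slog R d : VX -> R).
Proof.
apply: measurableT_comp; first exact: measurable_ln.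
exact: measurableT_comp measurable_onorm measurable_kap.
Qed.

Lemma measurable_lsize : measurable_fun setT (@lsize R d C : MX -> R).
Proof.
apply: measurable_funD; first exact: measurable_cst.
apply: measurable_sum => j; apply: measurableT_comp => //.
apply: measurableT_comp; first exact: measurable_ln.
apply: measurable_sum => i.
exact: measurableT_comp (measurable_entry i j) measurable_tau.
Qed.

Lemma measurable_enorm : measurable_fun setT (@enorm R d : VX -> R).
Proof.
apply: measurableT_comp; first by apply: continuous_measurable_fun => x; exact: sqrt_continuous.
by apply: measurable_sum => i; apply: measurable_funM; exact: measurable_entry.
Qed.

Lemma measurable_sphere : measurable (@sphere_pos R d : set VX).
Proof.
rewrite (_ : sphere_pos = (\bigcap_(i in [set: 'I_d]) [set v : VX | 0 <= v i 0]) `&`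
    ([set v : VX | enorm v <= 1] `&` [set v : VX | 1 <= enorm v])).
  apply: measurableI.
    apply: fin_bigcap_measurable => // i _.
    by apply: measurable_leS; [exact: measurable_cst|exact: measurable_entry].
  by apply: measurableI; apply: measurable_leS;
    [exact: measurable_enorm|exact: measurable_cst|exact: measurable_cst|exact: measurable_enorm].
apply/seteqP; split=> v /=.
  by move=> [h1 ->]; split; [move=> i _; exact: h1 | rewrite lexx].
by move=> [h1 [h2 h3]]; split=> [i|]; [exact: h1|apply/eqP; rewrite eq_le h2].
Qed.

Lemma measurable_nonneg : measurable (nonneg_mx : set MX).
Proof.
apply: (@measurable_forall2 d d _ MX (fun i j => [set g : MX | 0 <= g i j])) => i j.
by apply: measurable_leS; [exact: measurable_cst|exact: measurable_entry].
Qed.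

End MeasurableCone.

(** * Integrals of functions without measurability *)

Section Sandwich.
Context {R : realType} {dO : measure_display} {Omega : measurableType dO}.
Variable P : probability Omega R.

(** The integral of a nonnegative function is a supremum over simple minorants,
    and a minorant of f is a minorant of h. *)
Lemma le_integral_any (f h : Omega -> \bar R) :
  (forall w, 0 <= f w)%E -> (forall w, f w <= h w)%E -> (\int[P]_w f w <= \int[P]_w h w)%E.
Proof.
move=> f0 fh; rewrite !ge0_integralTE //; last by move=> w; apply: le_trans (fh w).
apply: le_ereal_sup => _ [k /= hk <-]; exists k => //= w.
exact: le_trans (hk w) (fh w).
Qed.

Lemma ae_le_integral_l (f h : Omega -> \bar R) : measurable_fun setT f ->
  (forall w, 0 <= f w)%E -> (forall w, 0 <= h w)%E -> {ae P, forall w, (f w <= h w)%E} ->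
  (\int[P]_w f w <= \int[P]_w h w)%E.
Proof.
move=> mf f0 h0 [N [mN N0 hN]].
rewrite (ge0_negligible_integral mN) // setTD integral_mkcond.
apply: le_integral_any => w; rewrite /patch; case: ifPn => // /set_mem nN.
by apply: contrapT => nfh; apply: nN; exact: hN.
Qed.

Lemma ae_le_integral_r (f h : Omega -> \bar R) : measurable_fun setT h ->
  (forall w, 0 <= f w)%E -> (forall w, 0 <= h w)%E -> {ae P, forall w, (f w <= h w)%E} ->
  (\int[P]_w f w <= \int[P]_w h w)%E.
Proof.
move=> mh f0 h0 [N [mN N0 hN]].
pose h' w := if `[< N w >] then +oo%E else h w.
have mh' : measurable_fun setT h' by apply: measurable_ifS => //; exact: measurable_cst.
apply: (@le_trans _ _ (\int[P]_w h' w)%E).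
  apply: le_integral_any => // w; rewrite /h'; case: asboolP => [_|nN]; first exact: leey.
  by apply: contrapT => nfh; apply: nN; exact: hN.
apply: ae_ge0_le_integral => //.
  by move=> w _; rewrite /h'; case: ifP.
exists N; split=> // w /= /not_implyP[_].
by rewrite /h'; case: asboolP => // _; rewrite lexx.
Qed.

Lemma bounded_integrable (f : Omega -> R) H : measurable_fun setT f ->
  (forall w, `|f w| <= H) -> P.-integrable setT (EFin \o f).
Proof.
move=> mf hf.
apply: (@le_integrable _ _ _ P setT measurableT _ (EFin \o cst H)).
- exact/measurable_EFinP.
- move=> w _; rewrite /= lee_fin; apply: le_trans (hf w) _; exact: ler_norm.
- exact: finite_measure_integrable_cst.
Qed.

Section Half.
Variables (b lo hi : Omega -> bool).
Hypothesis mlo : measurable_fun setT lo.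
Hypothesis mhi : measurable_fun setT hi.
Local Notation u := (fun w => (hi w && ~~ lo w)%:R : R).

Let mu_ : measurable_fun setT u.
Proof.
apply: measurable_natb; apply: (measurable_fun_bool true); rewrite setTI.
rewrite (_ : _ @^-1` _ = (hi @^-1` [set true]) `&` (lo @^-1` [set false])).
  by apply: measurableI; rewrite -[X in measurable X]setTI; [exact: mhi|exact: mlo].
by apply/seteqP; split=> w /=; case: (hi w); case: (lo w) => // -[].
Qed.

Lemma sandwich_half (p : Omega -> R) (X : Omega -> \bar R) H :
  measurable_fun setT p -> (forall w, 0 <= p w <= H) -> (forall w, 0 <= X w)%E ->
  {ae P, forall w, [/\ X w = (p w * (b w)%:R)%:E, lo w ==> b w & b w ==> hi w]} ->
  exists2 a, (\int[P]_w X w)%E = a%:E &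
    \int[P]_w (p w * (lo w)%:R) <= a <= \int[P]_w (p w * (lo w)%:R) + H * \int[P]_w u w.
Proof.
move=> mp pH X0 hae.
have p0 w : 0 <= p w by case/andP: (pH w).
have p1 w : p w <= H by case/andP: (pH w).
have ml := measurable_natb mlo.
have mpl : measurable_fun setT (fun w => p w * (lo w)%:R) by exact: measurable_funM.
have mpu : measurable_fun setT (fun w => p w * u w).
  by apply: measurable_funM => //; exact: mu_.
have nat01 (c : bool) : 0 <= (c%:R : R) <= 1 by case: c; rewrite ?lexx ?ler01.
have bd (c : bool) w : `|p w * c%:R| <= H.
  by case: c; rewrite ?mulr1 ?mulr0 ?normr0 ?ger0_norm // (le_trans (p0 w)).
have il := bounded_integrable mpl (fun w => bd (lo w) w).
have iu := bounded_integrable mpu (fun w => bd (hi w && ~~ lo w) w).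
have ius := bounded_integrable mu_ (_ : forall w, `|u w| <= 1).
have {}ius : P.-integrable setT (EFin \o u) by apply: ius => w; case: (_ && _); rewrite ?normr1 ?normr0.
pose L := \int[P]_w (p w * (lo w)%:R); pose V := \int[P]_w (p w * u w).
have LE : (\int[P]_w (p w * (lo w)%:R)%:E)%E = L%:E by rewrite fineK // integrable_fin_num.
have hlo : (L%:E <= \int[P]_w X w)%E.
  rewrite -LE; apply: ae_le_integral_l => //.
  - exact/measurable_EFinP.
  - by move=> w; rewrite lee_fin mulr_ge0.
  - apply: filterS hae => w [-> h _]; rewrite lee_fin ler_wpM2l //.
    by move: h; case: (lo w); case: (b w).
have hhi : (\int[P]_w X w <= (L + V)%:E)%E.
  rewrite /L /V -RintegralD //.
  rewrite -[X in (_ <= X)%E](_ : (\int[P]_w (p w * (lo w)%:R + p w * u w)%:E)%E = _); last first.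
    rewrite fineK // integrable_fin_num //.
    by have := integrableD measurableT il iu; apply: eq_integrable.
  apply: ae_le_integral_r => //.
  - by apply/measurable_EFinP; exact: measurable_funD.
  - by move=> w; rewrite lee_fin addr_ge0 // mulr_ge0.
  - apply: filterS hae => w [-> h1 h2]; rewrite lee_fin -mulrDr ler_wpM2l //.
    by move: h1 h2; case: (lo w); case: (b w); case: (hi w); rewrite //= ?addr0 ?add0r ?lexx ?ler01.
have fX : (\int[P]_w X w)%E \is a fin_num.
  by rewrite fin_numElt (lt_le_trans _ hlo) ?ltNyr // (le_lt_trans hhi) ?ltry.
exists (fine (\int[P]_w X w)); first by rewrite fineK.
apply/andP; split; rewrite -lee_fin (fineK fX); first exact: hlo.
apply: (le_trans hhi); rewrite lee_fin lerD2l /V -RintegralZl //; apply: le_Rintegral => //.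
  by have := integrableZl measurableT H ius; apply: eq_integrable.
by move=> w _; rewrite ler_wpM2r //; case: (_ && _).
Qed.

(** The positive and negative parts of f are treated separately, by monotonicity
    of the integral of nonnegative functions, whether b is measurable or not. *)
Lemma sandwich (f F : Omega -> R) H : measurable_fun setT f -> (forall w, `|f w| <= H) ->
  {ae P, forall w, [/\ F w = f w, lo w ==> b w & b w ==> hi w]} ->
  `|\int[P]_w (F w * (b w)%:R) - \int[P]_w (f w * (lo w)%:R)| <= H * \int[P]_w u w.
Proof.
move=> mf fH hae.
pose p w := Num.max (f w) 0; pose n w := Num.max (- f w) 0.
have mp : measurable_fun setT p by apply: measurable_maxr => //; exact: measurable_cst.
have mn : measurable_fun setT n.
  by apply: measurable_maxr; [exact: measurableT_comp|exact: measurable_cst].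
have pH w : 0 <= p w <= H.
  rewrite /p le_max lexx orbT ge_max (le_trans _ (fH w)) ?ler_norm //=.
  exact: le_trans (fH w).
have nH w : 0 <= n w <= H.
  rewrite /n le_max lexx orbT ge_max (le_trans (normr_ge0 _) (fH w)) andbT /=.
  by apply: le_trans (fH w); rewrite -normrN ler_norm.
pose X := EFin \o (fun w => F w * (b w)%:R).
have [||ap aE ha] := @sandwich_half p (X^\+)%E H mp pH.
- by move=> w; exact: funepos_ge0.
- apply: filterS hae => w [FE h1 h2]; split=> //.
  rewrite funeposE /X /= FE /p; case: (b w); rewrite ?mulr1 ?mulr0 -EFin_max //.
  by rewrite maxxx.
have [||an aE' ha'] := @sandwich_half n (X^\-)%E H mn nH.
- by move=> w; exact: funeneg_ge0.
- apply: filterS hae => w [FE h1 h2]; split=> //.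
  rewrite funenegE /X /= FE /n; case: (b w); rewrite ?mulr1 ?mulr0 -?EFinN -EFin_max //.
  by rewrite oppr0 maxxx.
have -> : \int[P]_w (F w * (b w)%:R) = ap - an.
  by rewrite /Rintegral -/X integralE aE aE'.
have -> : \int[P]_w (f w * (lo w)%:R) = \int[P]_w (p w * (lo w)%:R) - \int[P]_w (n w * (lo w)%:R).
  have ml := measurable_natb mlo.
  have bd (q : Omega -> R) w : 0 <= q w <= H -> `|q w * (lo w)%:R| <= H.
    move=> /andP[q0 q1].
    by case: (lo w); rewrite ?mulr1 ?mulr0 ?normr0 ?ger0_norm // (le_trans q0).
  rewrite -RintegralB //.
  - apply: eq_Rintegral => w _; rewrite -mulrBl; congr (_ * _); rewrite /p /n.
    have [h|h] := leP (f w) 0; have [h'|h'] := leP (- f w) 0; lra.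
  - by apply: (@bounded_integrable _ H) => [|w]; [exact: measurable_funM|exact: bd].
  - by apply: (@bounded_integrable _ H) => [|w]; [exact: measurable_funM|exact: bd].
move: ha ha' => /andP[h1 h2] /andP[h3 h4]; rewrite ler_norml; lra.
Qed.

End Half.
End Sandwich.

(** * Norms, the Hilbert metric and the spectral radius *)

Section Norms.
Context {R : realType} {d : nat}.
Implicit Types (g : 'M[R]_d) (v w x y : 'cV[R]_d).

Lemma dotv_ge0 v : 0 <= dotv v v.
Proof. by apply: sumr_ge0 => i _; rewrite -expr2 sqr_ge0. Qed.

Lemma entry_enorm v i : `|v i 0| <= enorm v.
Proof.
rewrite -sqrtr_sqr /enorm ler_sqrt ?dotv_ge0 // /dotv (bigD1 i) //= -expr2 lerDl.
by apply: sumr_ge0 => k _; rewrite -expr2 sqr_ge0.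
Qed.

Lemma onorm_ge0 v : (forall i, 0 <= v i 0) -> 0 <= onorm v.
Proof. by move=> v0; exact: sumr_ge0. Qed.

Lemma entry_onorm v i : (forall i, 0 <= v i 0) -> v i 0 <= onorm v.
Proof. by move=> v0; rewrite /onorm (bigD1 i) //= lerDl sumr_ge0. Qed.

Lemma enorm_onorm v : (forall i, 0 <= v i 0) -> enorm v <= onorm v.
Proof.
move=> v0; rewrite -[onorm v]ger0_norm ?onorm_ge0 // -sqrtr_sqr /enorm ler_sqrt ?sqr_ge0 //.
rewrite expr2 {1}/onorm /dotv mulr_suml; apply: ler_sum => i _.
by rewrite ler_wpM2l // entry_onorm.
Qed.

Lemma onorm_enorm v : onorm v <= d%:R * enorm v.
Proof.
rewrite /onorm; apply: (@le_trans _ _ (\sum_(i < d) enorm v)).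
  by apply: ler_sum => i _; apply: le_trans (entry_enorm v i); exact: ler_norm.
by rewrite sumr_const card_ord mulr_natl.
Qed.

Lemma enormZ a v : 0 <= a -> enorm (a *: v) = a * enorm v.
Proof.
move=> a0; rewrite /enorm /dotv; under eq_bigr do rewrite !mxE mulrACA.
by rewrite -mulr_sumr -expr2 sqrtrM ?sqr_ge0 // sqrtr_sqr ger0_norm.
Qed.

Lemma enorm_gt0 v : pcone v -> 0 < enorm v.
Proof.
by move=> [v0 [i vi]]; apply: lt_le_trans vi _; apply: le_trans (entry_enorm v i); exact: ler_norm.
Qed.

Lemma sphere_cone x : sphere_pos x -> pcone x.
Proof.
move=> [x0 x1]; split=> //; apply: contrapT => /forallNP h.
have : enorm x = 0; last by rewrite x1 => /eqP; rewrite oner_eq0.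
rewrite /enorm /dotv big1 ?sqrtr0 // => i _.
have -> : x i 0 = 0; last by rewrite mul0r.
by apply/eqP; rewrite eq_le x0 andbT leNgt; apply/negP; exact: h.
Qed.

Lemma sphere_entry x i : sphere_pos x -> x i 0 <= 1.
Proof. by move=> [x0 <-]; apply: le_trans (entry_enorm x i); exact: ler_norm. Qed.

Lemma sphere_onorm x : sphere_pos x -> 1 <= onorm x <= d%:R.
Proof.
move=> hx; have [x0 x1] := hx; rewrite -{1}x1 enorm_onorm //=.
by have := onorm_enorm x; rewrite x1 mulr1.
Qed.

Lemma normalize_sphere v : pcone v -> sphere_pos ((enorm v)^-1 *: v).
Proof.
move=> hv; have n0 := enorm_gt0 hv; have [v0 _] := hv; split=> [i|].
  by rewrite mxE mulr_ge0 // invr_ge0 ltW.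
by rewrite enormZ ?invr_ge0 ?ltW // mulVf ?gt_eqF.
Qed.

Definition basis_vec (j : 'I_d) : 'cV[R]_d := \col_i (i == j)%:R.

Lemma basis_sphere j : sphere_pos (basis_vec j).
Proof.
split=> [i|]; first by rewrite mxE.
rewrite /enorm /dotv (bigD1 j) //= big1 ?addr0 => [|i ij]; last by rewrite !mxE (negPf ij) mul0r.
by rewrite !mxE eqxx mulr1 sqrtr1.
Qed.

Lemma onorm_basis g j : onorm (g *m basis_vec j) = csum g j.
Proof.
rewrite onorm_mul (bigD1 j) //= [X in _ + X]big1 ?addr0 => [|i ij].
  by rewrite /basis_vec mxE eqxx mulr1.
by rewrite /basis_vec mxE (negPf ij) mulr0.
Qed.

End Norms.

Section Size.
Context {R : realType} {d : nat}.
Variable C : R.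
Hypothesis hd : (0 < d)%N.
Implicit Types (g : 'M[R]_d) (v w x y : 'cV[R]_d).
Let i0 : 'I_d := Ordinal hd.

Lemma mul_ge0 g v i : (forall i j, 0 <= g i j) -> (forall i, 0 <= v i 0) -> 0 <= (g *m v) i 0.
Proof. by move=> g0 v0; rewrite mxE; apply: sumr_ge0 => k _; rewrite mulr_ge0. Qed.

Lemma good_ge0 g : good C g -> forall i j, 0 <= g i j.
Proof. by move=> h i j; rewrite ltW //; case: (h i j). Qed.

Lemma csum_le_N g j : good C g -> csum g j <= d%:R * mx_N g.
Proof.
move=> hg; have g0 := good_ge0 hg; have hb := @basis_sphere R d j; have [b0 b1] := hb.
rewrite -onorm_basis; apply: le_trans (onorm_enorm _) _; rewrite ler_wpM2l //.
rewrite /mx_N le_max; apply/orP; left; apply: ub_le_sup; last by exists (basis_vec j) => //.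
exists (\sum_k csum g k) => _ [x hx <-]; have [x0 _] := hx.
apply: le_trans (enorm_onorm (fun i => mul_ge0 i g0 x0)) _.
rewrite onorm_mul; apply: ler_sum => k _; rewrite -[X in _ <= X]mulr1 ler_wpM2l //.
  exact: sumr_ge0.
exact: sphere_entry.
Qed.

(** mx_iota g is positive for a good g and at most the norm of each column. *)
Lemma csum_N_ge1 g j : good C g -> 1 <= csum g j * mx_N g.
Proof.
move=> hg; have g0 := good_ge0 hg.
pose c := \big[Num.min/1]_k g i0 k.
have c0 : 0 < c by apply: lt_bigmin => // k _; case: (hg i0 k).
have cg k : c <= g i0 k by exact: bigmin_le_cond.
have lb x : sphere_pos x -> c <= enorm (g *m x).
  move=> hx; have [x0 _] := hx; have /andP[x1 _] := sphere_onorm hx.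
  apply: le_trans (le_trans (ler_norm _) (entry_enorm _ i0)); rewrite mxE.
  apply: (@le_trans _ _ (\sum_k c * x k 0)).
    by rewrite -mulr_sumr -[X in X <= _]mulr1 ler_wpM2l // ltW.
  by apply: ler_sum => k _; rewrite ler_wpM2r.
have hb := @basis_sphere R d j; have [b0 _] := hb.
have ci : c <= mx_iota g.
  apply: lb_le_inf; first by exists (enorm (g *m basis_vec j)), (basis_vec j).
  by move=> _ [x hx <-]; exact: lb.
have i0' : 0 < mx_iota g by exact: lt_le_trans ci.
have ie : mx_iota g <= csum g j.
  apply: (@le_trans _ _ (enorm (g *m basis_vec j))).
    apply: ge_inf; last by exists (basis_vec j).
    by exists c => _ [x hx <-]; exact: lb.
  by rewrite -onorm_basis; apply: enorm_onorm => i; exact: mul_ge0.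
apply: (@le_trans _ _ (mx_iota g * (mx_iota g)^-1)); first by rewrite mulfV ?gt_eqF.
apply: ler_pM; [exact: ltW|by rewrite invr_ge0 ltW|exact: ie|].
by rewrite /mx_N le_max lexx orbT.
Qed.

(** Column sums and their inverses are at most d N(g), so that ln of a column
    sum grows slower than any power of N(g). *)
Lemma lsize_moment eta : 0 < eta -> exists2 K, 0 < K &
  forall g, good C g -> lsize C g ^+ 8 <= K * mx_N g `^ eta.
Proof.
move=> eta0; pose s := eta / 8.
have s0 : 0 < s by rewrite divr_gt0.
have dp : 0 < d%:R :> R by rewrite ltr0n.
have A0 : 0 < 1 + d%:R / s by rewrite addr_gt0 // divr_gt0.
exists ((1 + d%:R / s) ^+ 8 * d%:R `^ eta); first by rewrite mulr_gt0 ?exprn_gt0 ?powR_gt0.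
move=> g hg; set N := mx_N g.
have h1 := csum_le_N i0 hg; have h2 := csum_N_ge1 i0 hg; rewrite -/N in h1 h2.
have c0 := csum_gt0 hd i0 hg.
have N0 : 0 < N by rewrite -(pmulr_rgt0 _ c0) (lt_le_trans _ h2).
have d1 : 1 <= d%:R :> R by rewrite ler1n.
pose Y := d%:R * N.
have Y0 : 0 < Y by rewrite mulr_gt0.
have Y1 : 1 <= Y.
  have : 1 <= Y ^+ 2; last by rewrite expr_ge1 // ltW.
  apply: le_trans h2 _; apply: le_trans (ler_wpM2r (ltW N0) h1) _.
  by rewrite expr2 -mulrA /Y -mulrA ler_wpM2l ?(ltW dp) // mulrCA ler_peMl // mulr_ge0 // ltW.
have lnY j : `|ln (csum g j)| <= ln Y.
  have cj := csum_gt0 hd j hg; have l1 := csum_le_N j hg; have l2 := csum_N_ge1 j hg.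
  rewrite ler_norml -lnV ?posrE // !ler_ln ?posrE ?invr_gt0 // l1 andbT.
  rewrite invf_ple ?posrE // -[X in X <= _]mul1r ler_pdivrMr //.
  apply: le_trans l2 _; rewrite mulrC ler_wpM2r // ?(ltW cj) //.
  by rewrite /Y ler_peMl // ltW.
pose Z := Y `^ s.
have Z1 : 1 <= Z by rewrite -(powRr0 Y) ler_powR // ltW.
have lnZ : ln Y <= Z / s.
  by rewrite ler_pdivlMr // mulrC -ln_powR ltW // ln_sublinear // (lt_le_trans _ Z1).
have lZ : lsize C g <= (1 + d%:R / s) * Z.
  rewrite /lsize tau_id // mulrDl mul1r; apply: lerD => //.
  apply: (@le_trans _ _ (\sum_(j < d) (Z / s))).
    by apply: ler_sum => j _; apply: le_trans lnZ.
  by rewrite sumr_const card_ord -mulr_natl le_eqVlt; apply/orP; left; apply/eqP; ring.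
have l0 : 0 <= lsize C g by apply: le_trans (lsize_ge1 C g); exact: ler01.
apply: (@le_trans _ _ (((1 + d%:R / s) * Z) ^+ 8)).
  by rewrite lerXn2r // ?nnegrE // (le_trans l0).
rewrite exprMn -[X in _ <= X]mulrA; apply: ler_wpM2l; first by rewrite exprn_ge0 // ltW.
rewrite -powR_mulrn ?(le_trans _ Z1) // -powRrM /s divfK ?pnatr_eq0 //.
by rewrite /Y powRM // ltW.
Qed.

End Size.

Section HilbertMetric.
Context {R : realType} {d : nat}.
Hypothesis hd : (0 < d)%N.
Implicit Types (g : 'M[R]_d) (v w x y : 'cV[R]_d).
Let i0 : 'I_d := Ordinal hd.

Lemma ratio_sup_le x y i : pos_vec x -> pos_vec y -> ratio_sup x y * y i 0 <= x i 0.
Proof.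
move=> hx hy; rewrite -ler_pdivlMr //; apply: ge_sup; last first.
  by move=> a [_ /(_ i)]; rewrite -ler_pdivlMr.
have [j _ hj] := @arg_minP _ R 'I_d i0 xpredT (fun j => x j 0 / y j 0) isT.
exists (x j 0 / y j 0); split; first exact: divr_gt0.
by move=> k; rewrite -ler_pdivlMr //; exact: hj.
Qed.

Lemma ratio_sup_ge x y a : pos_vec x -> pos_vec y -> 0 < a ->
  (forall i, a * y i 0 <= x i 0) -> a <= ratio_sup x y.
Proof.
move=> hx hy a0 ha; apply: ub_le_sup => //.
by exists (x i0 0 / y i0 0) => b [_ /(_ i0)]; rewrite -ler_pdivlMr.
Qed.

Lemma ratio_sup_gt0 x y : pos_vec x -> pos_vec y -> 0 < ratio_sup x y.
Proof.
move=> hx hy; have [j _ hj] := @arg_minP _ R 'I_d i0 xpredT (fun j => x j 0 / y j 0) isT.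
apply: (@lt_le_trans _ _ (x j 0 / y j 0)); first exact: divr_gt0.
by apply: ratio_sup_ge => // [|k]; [exact: divr_gt0|rewrite -ler_pdivlMr //; exact: hj].
Qed.

(** If both ratios multiply to 1, then x and y are proportional, hence equal on
    the sphere. *)
Lemma hilbert_gt0 x y : pos_vec x -> pos_vec y -> enorm x = 1 -> enorm y = 1 -> x <> y ->
  0 < hilbert_dist x y.
Proof.
move=> hx hy nx ny xy; rewrite /hilbert_dist.
have m1 := ratio_sup_gt0 hx hy; have m2 := ratio_sup_gt0 hy hx.
have h1 i := ratio_sup_le i hx hy; have h2 i := ratio_sup_le i hy hx.
move: (ratio_sup x y) (ratio_sup y x) m1 m2 h1 h2 => m m' m0 m0' h1 h2.
have m2 := mulr_gt0 m0 m0'; apply: divr_gt0; last by rewrite addr_gt0.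
rewrite subr_gt0 lt_neqAle.
have le1 i : m * m' * x i 0 <= m * y i 0 by rewrite -mulrA ler_wpM2l // ltW.
apply/andP; split.
  apply/negP => /eqP mm; apply: xy.
  have e : x = m *: y.
    apply/colP => i; rewrite mxE; apply/eqP; rewrite eq_le h1 andbT.
    by have := le1 i; rewrite mm mul1r.
  have : enorm x = m by rewrite e enormZ ?ny ?mulr1 // ltW.
  by rewrite nx => m1; rewrite e -m1 scale1r.
by rewrite -(ler_pM2r (hx i0)) mul1r; apply: le_trans (le1 i0) (h1 i0).
Qed.

Lemma hilbert_le x y D : pos_vec x -> pos_vec y -> 0 <= D ->
  (forall i j, x i 0 * y j 0 <= (1 + D) * (y i 0 * x j 0)) -> hilbert_dist x y <= D.
Proof.
move=> hx hy D0 h; rewrite /hilbert_dist.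
have D1 : 0 < 1 + D by rewrite ltr_pwDl.
have [j _ hj] := @arg_minP _ R 'I_d i0 xpredT (fun j => x j 0 / y j 0) isT.
pose a := x j 0 / y j 0.
have a0 : 0 < a by exact: divr_gt0.
have h1 : a <= ratio_sup x y.
  by apply: ratio_sup_ge => // k; rewrite -ler_pdivlMr //; exact: hj.
have h2 : ((1 + D) * a)^-1 <= ratio_sup y x.
  apply: ratio_sup_ge => // [|i]; first by rewrite invr_gt0 mulr_gt0.
  rewrite ler_pdivrMl; last exact: mulr_gt0.
  have yj : 0 < y j 0 by exact: hy.
  have := h i j; rewrite -ler_pdivlMr // => /le_trans; apply.
  by rewrite le_eqVlt; apply/orP; left; apply/eqP; rewrite /a; ring.
have m12 : (1 + D)^-1 <= ratio_sup x y * ratio_sup y x.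
  apply: (@le_trans _ _ (a * ((1 + D) * a)^-1)).
    by rewrite invfM mulrCA mulfV ?gt_eqF ?mulr1.
  have q0 : 0 <= ((1 + D) * a)^-1 by rewrite invr_ge0 ltW // mulr_gt0.
  exact: ler_pM (ltW a0) q0 h1 h2.
have p0 : 0 < (1 + D)^-1 by rewrite invr_gt0.
move: (ratio_sup x y * ratio_sup y x) m12 => m m12.
have m0 : 0 < m by exact: lt_le_trans m12.
rewrite ler_pdivrMr ?addr_gt0 //.
have : 1 <= (1 + D) * m by rewrite -ler_pdivrMl // mulr1.
by nra.
Qed.

End HilbertMetric.

Section Spectral.
Context {R : realType} {d : nat}.
Hypothesis hd : (0 < d)%N.
Variable g : 'M[R]_d.
Hypothesis g0 : forall i j, 0 <= g i j.
Local Notation gC := (map_mx (real_complex R) g).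
Local Notation s := (\sum_i \sum_j g i j).

Lemma normc_sum (I : Type) (r : seq I) (F : I -> R[i]) :
  normc (\sum_(i <- r) F i) <= \sum_(i <- r) normc (F i).
Proof.
elim/big_rec2: _ => [|i y x _ h]; first by rewrite normc0.
by apply: le_trans (le_normcD _ _) _; rewrite lerD2l.
Qed.

Lemma normc_real (a : R) : 0 <= a -> normc (real_complex R a) = a.
Proof. by move=> a0; rewrite /normc /= expr0n addr0 sqrtr_sqr ger0_norm. Qed.

Lemma normc_ge0 (z : R[i]) : 0 <= normc z.
Proof. by case: z => a b; rewrite /normc sqrtr_ge0. Qed.

(** Multiplication by g increases the l1 norm of a row vector at most by the factor s. *)
Lemma eigenvalue_le z : eigenvalue gC z -> normc z <= s.
Proof.
move=> /eigenvalueP[v vE v0].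
pose n1 := \sum_j normc (v 0 j).
have n0 : 0 < n1.
  rewrite lt_neqAle sumr_ge0 ?andbT; last by move=> j _; exact: normc_ge0.
  apply/negP => /eqP h; case/eqP: v0; apply/rowP => j; rewrite mxE.
  apply: (@eq0_normc R); apply/eqP; rewrite eq_le normc_ge0 andbT h /n1 (bigD1 j) //= lerDl.
  by apply: sumr_ge0 => k _; exact: normc_ge0.
rewrite -(ler_pM2r n0).
have -> : normc z * n1 = \sum_j normc ((v *m gC) 0 j).
  by rewrite mulr_sumr; apply: eq_bigr => j _; rewrite vE mxE normcM.
apply: (@le_trans _ _ (\sum_j \sum_i normc (v 0 i) * g i j)).
  apply: ler_sum => j _; rewrite mxE; apply: le_trans (normc_sum _ _) _.
  by apply: ler_sum => i _; rewrite normcM mxE normc_real.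
rewrite exchange_big /= mulrC mulr_suml; apply: ler_sum => i _.
rewrite -mulr_sumr; apply: ler_wpM2l; first exact: normc_ge0.
rewrite [X in _ <= X](bigD1 i) //= lerDl.
by apply: sumr_ge0 => k _; exact: sumr_ge0.
Qed.

(** The trace is the sum of the d roots of the characteristic polynomial, so one
    of them has modulus at least its average. *)
Lemma eigenvalue_trace : exists2 z, eigenvalue gC z & \tr g <= d%:R * normc z.
Proof.
have [r rE] := closed_field_poly_normal (char_poly gC).
rewrite (monicP (char_poly_monic gC)) scale1r in rE.
have sr : size r = d.
  by apply/eqP; rewrite -eqSS -(size_prod_XsubC r id) -rE size_char_poly.
have trE : \sum_(z <- r) z = real_complex R (\tr g).
  have := char_poly_trace gC hd; rewrite rE -{1}sr coefPn_prod_XsubC ?sr -?lt0n //.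
  by move=> /oppr_inj ->; rewrite trace_map_mx.
apply: contrapT => h.
have small z : z \in r -> normc z < \tr g / d%:R.
  move=> zr; rewrite ltNge; apply/negP => hz; apply: h; exists z.
    by rewrite eigenvalue_root_char rE root_prod_XsubC.
  by rewrite mulrC -ler_pdivrMr ?ltr0n.
have tr0 : 0 <= \tr g by apply: sumr_ge0.
have : normc (\sum_(z <- r) z) <= \sum_(z <- r) normc z by exact: normc_sum.
rewrite trE normc_real //; apply/negP; rewrite -ltNge.
have dp : 0 < d%:R :> R by rewrite ltr0n.
have -> : \tr g = \sum_(z <- r) (\tr g / d%:R).
  by rewrite big_const_seq count_predT sr iter_addr_0 -[RHS]mulr_natr divfK // gt_eqF.
rewrite big_seq [X in _ < X]big_seq.
apply: ltr_sum => //.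
by apply/hasP; case: (r) sr hd => [<-//|z r' _ _]; exists z; rewrite ?inE ?eqxx.
Qed.

Lemma spectral_radius_bounds :
  spectral_radius g <= s /\ \tr g <= d%:R * spectral_radius g.
Proof.
have [z hz htr] := eigenvalue_trace.
split.
  by apply: ge_sup; [exists (normc z), z | move=> _ [w hw <-]; exact: eigenvalue_le].
apply: (le_trans htr); rewrite ler_wpM2l //; apply: ub_le_sup; last by exists z.
by exists s => _ [w hw <-]; exact: eigenvalue_le.
Qed.

End Spectral.

Lemma compact_interior_lb {R : realType} {d : nat} (K : set 'cV[R]_d) : compact K ->
  K `<=` sphere_pos_int -> exists2 k, 0 < k & forall x i, K x -> k <= x i 0.
Proof.
move=> cK Ki.
have [[x0 Kx0]|K0] := pselect (K !=set0); last first.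
  by exists 1 => // x i Kx; case: K0; exists x.
have /choice[f hf] : forall i : 'I_d, exists a, 0 < a /\ forall x, K x -> a <= x i 0.
  move=> i.
  have [||c /set_mem Kc hc] := @compact_EVT_min 'cV[R]_d R (fun x => x i 0) K _ cK.
  - by exists x0.
  - by apply: continuous_subspaceT => x; exact: coord_continuous.
  - exists (c i 0); split; first by case: (Ki _ Kc).
    by move=> x Kx; apply: hc; exact: mem_set.
exists (\big[Num.min/1]_i f i).
  by apply: lt_bigmin => // i _; case: (hf i).
move=> x i Kx; apply: (@le_trans _ _ (f i)); first exact: bigmin_le_cond.
by case: (hf i) => _; exact.
Qed.

(** * The stationary measure *)

Section Stationary.
Context {R : realType} {d : nat}.
Variable C : R.
Hypothesis hd : (0 < d)%N.
Hypothesis C1 : 1 <= C.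
Local Notation MX := (borel 'M[R]_d).
Local Notation VX := (borel 'cV[R]_d).
Implicit Types (F : 'cV[R]_d -> R).

Definition nrm (v : 'cV[R]_d) : 'cV[R]_d := (enorm (kap v))^-1 *: kap v.

Lemma nrm_sphere v : sphere_pos (nrm v).
Proof. exact: normalize_sphere (cone_kap hd v). Qed.

Lemma nrm_id x : sphere_pos x -> nrm x = x.
Proof. by move=> hx; rewrite /nrm kap_id ?hx.2 ?invr1 ?scale1r //; exact: sphere_cone. Qed.

Lemma pcone_scale a (v : 'cV[R]_d) : 0 < a -> pcone v -> pcone (a *: v).
Proof.
move=> a0 [v0 [i vi]]; split=> [k|]; first by rewrite mxE mulr_ge0 // ltW.
by exists i; rewrite mxE mulr_gt0.
Qed.

Lemma kap_scale a (v : 'cV[R]_d) : 0 < a -> kap (a *: v) = kap v \/ kap (a *: v) = a *: kap v.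
Proof.
move=> a0; have [hv|hv] := pselect (pcone v).
  by right; rewrite !kap_id //; exact: pcone_scale.
left; rewrite /kap !asboolF // => h; apply: hv.
have -> : v = a^-1 *: (a *: v) by rewrite scalerA mulVf ?gt_eqF // scale1r.
by apply: pcone_scale; rewrite ?invr_gt0.
Qed.

Definition homog F := forall a v, 0 < a -> F (a *: v) = F v.

Lemma nrm_homog a v : 0 < a -> nrm (a *: v) = nrm v.
Proof.
move=> a0; rewrite /nrm; case: (kap_scale v a0) => -> //.
have n0 := enorm_gt0 (cone_kap hd v).
by rewrite enormZ ?(ltW a0) // scalerA invfM mulrAC mulVf ?gt_eqF // mul1r.
Qed.

(** Continuity in the sequential form to which dominated convergence applies. *)
Definition seqcont F := forall (x : 'cV[R]_d) (u : nat -> 'cV[R]_d),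
  sphere_pos x -> (forall n, sphere_pos (u n)) ->
  (forall i, (fun n => u n i 0) @ \oo --> x i 0) -> (fun n => F (u n)) @ \oo --> F x.

Lemma within_seqcont F : {within sphere_pos, continuous F} -> seqcont F.
Proof.
move=> /subspace_continuousP cF x u hx hu ux.
apply: cvg_comp (cF x hx) => B /= [e /= e0 eB].
have : \forall n \near \oo, forall i, e i 0 (u n i 0).
  by apply: filter_forall => i; exact: ux (e0 i 0).
by apply: filterS => n hn; apply: eB => //= i j; rewrite ord1.
Qed.

Lemma seqcont_within F : seqcont F -> {within sphere_pos, continuous F}.
Proof.
move=> cF; apply/subspace_continuousP => x hx; apply/cvgrPdist_lt => e e0.
apply: contrapT => h.
have hn n : exists y, sphere_pos y /\ (forall i, `|x i 0 - y i 0| < n.+1%:R^-1) /\ e <= `|F x - F y|.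
  apply: contrapT => /forallNP hy; apply: h.
  exists (fun i j => ball (x i j) n.+1%:R^-1); first by move=> i j; exact: nbhsx_ballx.
  move=> y xy hy'; rewrite /= ltNge; apply/negP => h.
  by apply: (hy y); split=> //; split=> // i; have := xy i 0.
have [u hu] := choice hn.
have ux i : (fun n => u n i 0) @ \oo --> x i 0.
  apply/cvgrPdist_lt => e' e'0.
  have := near_infty_natSinv_lt (PosNum e'0); apply: filterS => n /=.
  by apply: lt_trans; case: (hu n) => _ [].
have /cvgrPdist_lt/(_ _ e0)[n _ /(_ n (leqnn n))] := cF x u hx (fun n => (hu n).1) ux.
by rewrite ltNge; case: (hu n) => _ [_ ->].
Qed.

Lemma cvg_sum_seq (I : Type) (r : seq I) (f : I -> nat -> R) (l : I -> R) :
  (forall i, f i n @[n --> \oo] --> l i) ->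
  (fun n => \sum_(i <- r) f i n) @ \oo --> \sum_(i <- r) l i.
Proof.
move=> h; elim: r => [|i r ih].
  by rewrite big_nil; under eq_fun do rewrite big_nil; exact: cvg_cst.
by rewrite big_cons; under eq_fun do rewrite big_cons; apply: cvgD.
Qed.

Lemma cvg_enorm (u : nat -> 'cV[R]_d) (x : 'cV[R]_d) : (forall i, (fun n => u n i 0) @ \oo --> x i 0) ->
  (fun n => enorm (u n)) @ \oo --> enorm x.
Proof.
move=> ux; apply: (@cvg_comp _ _ _ (fun n => dotv (u n) (u n)) Num.sqrt _ (nbhs (dotv x x))).
  by apply: cvg_sum_seq => i; apply: cvgM.
exact: sqrt_continuous.
Qed.

Lemma cvg_nrm (u : nat -> 'cV[R]_d) (x : 'cV[R]_d) : pcone x -> (forall n, pcone (u n)) ->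
  (forall i, (fun n => u n i 0) @ \oo --> x i 0) ->
  forall i, (fun n => nrm (u n) i 0) @ \oo --> nrm x i 0.
Proof.
move=> hx hu ux i; rewrite /nrm kap_id // mxE.
under eq_fun do rewrite kap_id // mxE.
by apply: cvgM => //; apply: cvgV; [rewrite gt_eqF ?enorm_gt0 | exact: cvg_enorm].
Qed.

Lemma measurable_nrm : measurable_fun setT (nrm : VX -> VX).
Proof.
apply: measurable_mx => i j; under eq_fun do rewrite mxE.
have mk := @measurable_kap R d.
apply: measurable_funM; last exact: measurableT_comp (measurable_entry i j) mk.
have me : measurable_fun setT (fun v : VX => enorm (kap v)).
  exact: measurableT_comp (@measurable_enorm R d) mk.
have -> : (fun v : VX => (enorm (kap v))^-1) = (fun v : VX => expR (- ln (enorm (kap v)))).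
  by apply/funext => v; rewrite -lnV ?lnK ?posrE ?invr_gt0 ?enorm_gt0 //; exact: cone_kap.
apply: measurableT_comp => //; apply: measurableT_comp => //.
by apply: measurableT_comp me; exact: measurable_ln.
Qed.

Definition hat (f : 'cV[R]_d -> R) v := f (nrm v).

Lemma measurable_hat f : {within sphere_pos, continuous f} ->
  measurable_fun setT (hat f : VX -> R).
Proof.
move=> cf; apply: (measurability _ (RGenOpens.measurableE R)).
move=> _ [_ [a [b ->]] <-]; rewrite setTI.
have oab : open (f @^-1` `]a, b[%classic : set (subspace sphere_pos)).
  by have /continuousP := cf; apply; exact: interval_open.
have [V oV VE] := (open_subspaceP _ _).1 oab.
have -> : hat f @^-1` `]a, b[%classic = nrm @^-1` V.
  apply/seteqP; split=> v /= hv.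
    have : (f @^-1` `]a, b[%classic `&` sphere_pos) (nrm v) by split=> //; exact: nrm_sphere.
    by rewrite -VE => -[].
  have : (V `&` sphere_pos) (nrm v) by split=> //; exact: nrm_sphere.
  by rewrite VE => -[].
rewrite -[X in measurable X]setTI; apply: measurable_nrm => //.
exact: sub_sigma_algebra.
Qed.

Lemma hat_homog f : homog (hat f).
Proof. by move=> a v a0; rewrite /hat nrm_homog. Qed.

Lemma hat_sphere f x : sphere_pos x -> hat f x = f x.
Proof. by move=> hx; rewrite /hat nrm_id. Qed.

Lemma hat_seqcont f : seqcont f -> seqcont (hat f).
Proof.
move=> cf x u hx hu ux; rewrite /hat nrm_id //; under eq_fun do rewrite nrm_id //.
exact: cf.
Qed.

(** On the core, where all entries are comparable, the two projective distances
    are comparable; elsewhere only boundedness is used. *)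
Lemma hat_holder f H gamma : 0 < gamma -> 0 <= H ->
  (forall x, sphere_pos x -> `|f x| <= H) ->
  (forall x y, sphere_pos x -> sphere_pos y -> x <> y ->
    `|f x - f y| <= H * hilbert_dist x y `^ gamma \/ hilbert_dist x y <= 0) ->
  forall v w, `|hat f v - hat f w| <= (2 * H) * pdist C v w `^ gamma.
Proof.
move=> g0 H0 fH fL v w.
have b2 : `|hat f v - hat f w| <= 2 * H.
  apply: le_trans (ler_normB _ _) _.
  by have := fH _ (nrm_sphere v); have := fH _ (nrm_sphere w); rewrite /hat; lra.
have [[hv hw]|h] := pselect (core C v /\ core C w); last first.
  apply: (le_trans b2); rewrite ler_peMr ?mulr_ge0 // /pdist asboolF //.
  have m1 : 1 <= maxdist C by rewrite /maxdist; have := sqr_ge0 C; lra.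
  by rewrite -(powRr0 (maxdist C)) ler_powR // ltW.
rewrite pdist_core //; have [e|ne] := pselect (nrm v = nrm w).
  by rewrite /hat e subrr normr0 mulr_ge0 ?powR_ge0 // mulr_ge0.
have cv := core_cone hd hv; have cw := core_cone hd hw.
have pv := core_pos hv; have pw := core_pos hw.
have nv := enorm_gt0 cv; have nw := enorm_gt0 cw.
have sv := nrm_sphere v; have sw := nrm_sphere w.
have pnv : pos_vec (nrm v) by move=> i; rewrite /nrm kap_id // mxE mulr_gt0 // invr_gt0.
have pnw : pos_vec (nrm w) by move=> i; rewrite /nrm kap_id // mxE mulr_gt0 // invr_gt0.
have h0 := hilbert_gt0 hd pnv pnw sv.2 sw.2 ne.
have h1 : hilbert_dist (nrm v) (nrm w) <= pd v w.
  apply: hilbert_le => //; first exact: pd_ge0.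
  move=> i j; rewrite /nrm !kap_id // !mxE.
  have := pdP i j pv pw; have q : 0 <= (enorm v)^-1 * (enorm w)^-1.
    by rewrite mulr_ge0 // invr_ge0 ltW.
  move=> /(ler_wpM2l q); rewrite mulrACA => /le_trans; apply.
  by rewrite le_eqVlt; apply/orP; left; apply/eqP; ring.
case: (fL _ _ sv sw ne) => [h|]; last by rewrite leNgt h0.
apply: (le_trans h).
have p1 : hilbert_dist (nrm v) (nrm w) `^ gamma <= pd v w `^ gamma.
  by apply: ge0_ler_powR; rewrite ?nnegrE ?(ltW g0) ?(ltW h0) ?pd_ge0.
apply: (le_trans (ler_wpM2l H0 p1)).
by rewrite ler_wpM2r ?powR_ge0 //; lra.
Qed.

Variables (mu : probability MX R) (nu : probability VX R).
Hypothesis mu_good : mu (~` [set g | good C g]) = 0%E.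
Hypothesis nu_stat : stationary mu nu.
Local Notation st := (wstep C : MX -> VX -> VX).

Let mst : measurable_fun setT (fun p : VX * MX => st p.2 p.1) := measurable_wstep C.

Lemma Pop_homog F : homog F -> homog (Pop mu st F).
Proof.
move=> hF a v a0; rewrite /Pop /Rintegral; congr fine; apply: eq_integral => e _.
congr (_%:E); rewrite /wstep; case: (kap_scale v a0) => -> //.
by rewrite -scalemxAr hF.
Qed.

(** One step sends the sphere into positive vectors, where normalising is
    continuous; the average over the step follows by dominated convergence. *)
Lemma Pop_seqcont F H : measurable_fun setT (F : VX -> R) -> (forall v, `|F v| <= H) ->
  homog F -> seqcont F -> seqcont (Pop mu st F).
Proof.
move=> mF FH hF cF x u hx hu ux.
have mFv (v : VX) : measurable_fun setT (fun e => F (st e v)).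
  exact: measurableT_comp mF (mstep_v mst v).
have iF v := @bounded_integrable _ _ _ mu _ H (mFv v) (fun e => FH (st e v)).
have nrmF v : pcone v -> F v = F (nrm v).
  move=> hv; rewrite /nrm kap_id // hF // invr_gt0; exact: enorm_gt0.
have lim e : (fun n => F (st e (u n))) @ \oo --> F (st e x).
  have ct v : pcone (st e v) by apply: core_cone => //; exact: core_step.
  rewrite nrmF //; under eq_fun do rewrite nrmF //.
  apply: cF; [exact: nrm_sphere|by move=> n; exact: nrm_sphere|].
  apply: cvg_nrm => // i; rewrite /wstep kap_id ?mxE; last exact: sphere_cone.
  have uk n : kap (u n) = u n by apply: kap_id; exact: sphere_cone.
  under eq_fun do rewrite uk mxE.
  by apply: cvg_sum_seq => k; apply: cvgM => //; exact: cvg_cst.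
have := @dominated_cvg _ _ _ mu setT measurableT (fun n e => (F (st e (u n)))%:E)
  (fun e => (F (st e x))%:E) (cst H%:E).
move=> h; apply: fine_cvg; rewrite /Pop /Rintegral fineK ?integrable_fin_num //.
apply: h => //.
- by move=> n; apply/measurable_EFinP.
- by move=> e _; apply: cvg_EFin; [exact: nearW|exact: lim].
- exact: finite_measure_integrable_cst.
- by move=> n e _; rewrite lee_fin.
- exact: iF.
Qed.

Lemma real_complex_continuous : continuous (fun a : R => (real_complex R a : R[i]^o)).
Proof.
move=> a; apply/cvgrPdist_lt => e e0.
have e1 : 0 < complex.Re e by move: e0; rewrite ltcE /= => /andP[].
have eE : e = real_complex R (complex.Re e).
  by move: e0; case: e {e1} => p q; rewrite ltcE /= => /andP[/eqP -> _].
have : \forall y \near a, `|a - y| < complex.Re e.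
  by apply: (@cvgr_dist_lt _ _ _ (nbhs a) _ id a).
apply: filterS => y hy; rewrite -rmorphB /= normc_def /= expr0n addr0 sqrtr_sqr eE.
by rewrite ltcR.
Qed.

(** On good matrices, act g x and wstep C g x have the same direction. *)
Lemma stat_step F H : measurable_fun setT (F : VX -> R) -> (forall v, `|F v| <= H) ->
  homog F -> seqcont F ->
  \int[nu]_(x in sphere_pos) Pop mu st F x = \int[nu]_(x in sphere_pos) F x.
Proof.
move=> mF FH hF cF.
pose h (v : 'cV[R]_d) : R[i] := real_complex R (F v).
have ch : continuous_on_sphere h.
  have cF' := seqcont_within cF.
  by move=> x; apply: continuous_comp (cF' x) _; exact: real_complex_continuous.
have [_ /(_ h ch)] := nu_stat.
rewrite /cintegral => /(congr1 (@complex.Re R)) /= <-.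
apply: eq_Rintegral => x /set_mem hx.
have hc := sphere_cone hx.
have actE g : F (act g x) = F (g *m x).
  rewrite /act; have [e0|e0] := ltP 0 (enorm (g *m x)); first by rewrite hF ?invr_gt0.
  have -> : g *m x = 0; last by rewrite scaler0.
  apply/colP => i; rewrite [RHS]mxE; apply/eqP; rewrite -normr_le0.
  exact: le_trans (entry_enorm _ _) e0.
have mk : measurable_fun setT (fun g : MX => F (g *m x)).
  apply: measurableT_comp mF _; apply: measurable_mulmx; [exact: measurable_id|exact: measurable_cst].
have ms : measurable_fun setT (fun g : MX => F (st g x)).
  exact: measurableT_comp mF (mstep_v mst x).
have ik := @bounded_integrable _ _ _ mu _ H mk (fun g => FH (g *m x)).
have ist := @bounded_integrable _ _ _ mu _ H ms (fun g => FH (st g x)).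
have mG := @measurable_good R d C.
have mu_nonneg := @measurable_nonneg R d.
have mNG : measurable (~` [set g : MX | good C g]) by exact: measurableC.
rewrite /Pop /Rintegral; congr fine; symmetry.
under eq_integral do rewrite actE.
rewrite (@negligible_integral _ _ _ mu nonneg_mx _ _ mNG) //; last first.
  by apply: integrableS ik.
rewrite [RHS](@negligible_integral _ _ _ mu setT _ _ mNG) //.
have -> : nonneg_mx `\` ~` [set g : MX | good C g] = [set g | good C g].
  rewrite setDE setCK; apply/seteqP; split=> [g [] //|g hg]; split=> // i j.
  exact: good_ge0 hg i j.
rewrite setTD setCK; apply: eq_integral => g /set_mem hg.
by rewrite /wstep tau_id // kap_id.
Qed.

Lemma iter_regular f H k : {within sphere_pos, continuous f} ->
  (forall x, sphere_pos x -> `|f x| <= H) ->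
  [/\ measurable_fun setT (Pn mu st k (hat f) : VX -> R),
    forall v, `|Pn mu st k (hat f) v| <= H, homog (Pn mu st k (hat f)) & seqcont (Pn mu st k (hat f))].
Proof.
move=> cf fH; elim: k => [|k [m1 m2 m3 m4]].
  split=> //=; [exact: measurable_hat|by move=> v; apply: fH; exact: nrm_sphere|exact: hat_homog|].
  by apply: hat_seqcont; exact: within_seqcont.
have e : Pn mu st k.+1 (hat f) = Pop mu st (Pn mu st k (hat f)) by [].
rewrite e; split; [exact: Pop_measurable| |exact: Pop_homog|exact: Pop_seqcont m1 m2 m3 m4].
move=> v; have mv : measurable_fun setT (fun g => Pn mu st k (hat f) (st g v)).
  exact: measurableT_comp m1 (mstep_v mst v).
have iv := bounded_integrable mu mv (fun g => m2 (st g v)).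
apply: le_trans (le_normr_Rintegral _ iv) _ => //.
rewrite -[X in _ <= X](@Rint_cst _ _ _ mu); apply: le_Rintegral => //.
- by have := integrable_norm iv; apply: eq_integrable.
- exact: finite_measure_integrable_cst.
Qed.

Lemma stat_iter f H n : {within sphere_pos, continuous f} ->
  (forall x, sphere_pos x -> `|f x| <= H) ->
  \int[nu]_(x in sphere_pos) Pn mu st n (hat f) x = \int[nu]_(x in sphere_pos) f x.
Proof.
move=> cf fH; elim: n => [|n ih].
  by apply: eq_Rintegral => x /set_mem hx; rewrite /= hat_sphere.
have [m1 m2 m3 m4] := iter_regular n cf fH; rewrite -ih.
exact: stat_step m1 m2 m3 m4.
Qed.

(** By stationarity the nu-average of Pn j (hat f) is that of f, and by
    contraction Pn j (hat f) is nearly constant. *)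
Lemma psi_decay f H gamma : 0 < gamma -> 0 <= H ->
  mu.-integrable setT (EFin \o (fun e => lsize C e ^+ 8)) ->
  {within sphere_pos, continuous f} -> (forall x, sphere_pos x -> `|f x| <= H) ->
  (forall x y, sphere_pos x -> sphere_pos y -> x <> y ->
    `|f x - f y| <= H * hilbert_dist x y `^ gamma \/ hilbert_dist x y <= 0) ->
  forall j v, `|Pn mu st j (hat f) v - \int[nu]_(x in sphere_pos) f x| <=
    (2 * H * maxdist C `^ gamma) * (rate C `^ gamma) ^+ j.
Proof.
move=> g0 H0 iell cf fH fL j v.
have /andP[r0 r1] := rate_lt1 C1.
pose q := rate C `^ gamma.
have q0 : 0 <= q by exact: powR_ge0.
have q1 : q < 1.
  have -> : 1 = 1 `^ gamma by rewrite powR1.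
  by rewrite /q; apply: gt0_ltr_powR; rewrite ?nnegrE.
have q01 : 0 <= q < 1 by rewrite q0.
pose dist (v w : VX) := pdist C v w `^ gamma.
have ah : adm (@slog R d : VX -> R) (hat f : VX -> R).
  by apply: (adm_bounded _ (measurable_hat cf)) => w; apply: fH; exact: nrm_sphere.
have dstep (e : MX) (v' w' : VX) : dist (st e v') (st e w') <= q * dist v' w'.
  rewrite /dist /q -powRM ?pdist_ge0 //; apply: ge0_ler_powR; rewrite ?nnegrE ?pdist_ge0 ?(ltW g0) //.
    by rewrite mulr_ge0 // pdist_ge0.
  exact: pdist_step.
have H2 : 0 <= 2 * H by rewrite mulr_ge0.
have lip := Pn_lip mst (measurable_lsize C) (lsize_ge1 C) iell (slog_incr hd C1) q01 dstep j H2 ah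
  (hat_holder g0 H0 fH fL).
have [m1 m2 m3 m4] := iter_regular j cf fH.
set G := Pn mu st j (hat f) in lip m1 m2 *.
have bd w : `|G v - G w| <= 2 * H * maxdist C `^ gamma * q ^+ j.
  apply: (le_trans (lip v w)); rewrite mulrAC ler_wpM2r ?exprn_ge0 // ler_wpM2l //.
  apply: ge0_ler_powR; rewrite ?nnegrE ?pdist_ge0 ?(ltW g0) //; last exact: pdist_le.
  exact: le_trans (pdist_ge0 C v w) (pdist_le C v w).
have mS := @measurable_sphere R d; have nuS : nu sphere_pos = 1%E by case: nu_stat.
have onS (c : R) : \int[nu]_(x in sphere_pos) c = c.
  by rewrite Rintegral_cst // [X in fine X]nuS mulr1.
have iG : nu.-integrable sphere_pos (EFin \o G).
  by apply: (integrableS measurableT) => //; exact: bounded_integrable m1 m2.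
have iC (c : R) : nu.-integrable sphere_pos (EFin \o (fun=> c)).
  by apply: (integrableS measurableT) => //; exact: finite_measure_integrable_cst.
rewrite -(stat_iter j cf fH) -/G -{1}(onS (G v)) -RintegralB //.
have iB : nu.-integrable sphere_pos (EFin \o (fun w => G v - G w)).
  by have := integrableB mS (iC (G v)) iG; apply: eq_integrable.
apply: le_trans (le_normr_Rintegral mS iB) _.
rewrite -[X in _ <= X]onS; apply: le_Rintegral => //.
by have := integrable_norm iB; apply: eq_integrable.
Qed.

End Stationary.

(** * Identification of the drift and the variance *)

Section Identify.
Context {R : realType}.

Lemma cvg_nat_inv (f : nat -> R) c K : (forall n, (0 < n)%N -> `|f n| <= n%:R^-1 * K) ->
  (fun n => c + f n) @ \oo --> c.
Proof.
move=> h; rewrite -[X in _ --> X]addr0; apply: cvgD; first exact: cvg_cst.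
apply/cvgrPdist_le => e e0.
have K0 : 0 <= K by have := h 1%N isT; rewrite invr1 mul1r => /(le_trans (normr_ge0 _)).
exists (Num.bound (K / e)).+1 => // n /= hn.
have n0 : (0 < n)%N by exact: leq_ltn_trans hn.
rewrite sub0r normrN; apply: le_trans (h n n0) _.
rewrite ler_pdivrMl ?ltr0n // -ler_pdivrMr //.
apply: le_trans (ltW (archi_boundP _)) _; first by rewrite divr_ge0 // ltW.
by rewrite ler_nat ltnW.
Qed.

Lemma eq_of_all_eps (a b K : R) : (forall t : R, 0 < t <= 1 -> `|a - b| <= K * t) -> a = b.
Proof.
move=> h; apply/eqP; rewrite -subr_eq0 -normr_le0; apply/ler_addgt0Pl => e e0; rewrite addr0.
pose k := `|K| + 1; have k0 : 0 < k by rewrite ltr_wpDl.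
pose t := Num.min 1 (e / k).
have t0 : 0 < t by rewrite lt_min ltr01 divr_gt0.
have te : t <= e / k by rewrite ge_min lexx orbT.
apply: le_trans (h t _) _; first by rewrite t0 ge_min lexx.
apply: (@le_trans _ _ (k * t)); first by rewrite ler_wpM2r ?(ltW t0) // /k (le_trans (ler_norm _)) // lerDl.
by rewrite mulrC -ler_pdivlMr.
Qed.

(** A wrong centering would make e grow like n ^ 2; with the right one, e and V
    agree up to an arbitrarily small proportion. *)
Lemma identify (e V : nat -> R) (l l' sg sg' b c : R) : 0 <= c ->
  (forall n, 0 <= V n) ->
  (forall n (t : R), 0 < t <= 1 -> `|V n - n%:R * sg| <= t * V n + c / t) ->
  (fun n => n%:R^-1 * e n) @ \oo --> sg' ->
  (forall n, (n%:R * (l - l')) ^+ 2 <= 2 * e n + 4 * V n + 4 * b ^+ 2) ->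
  (l = l' -> forall n (t : R), 0 < t <= 1 -> `|e n - V n| <= t * V n + (b ^+ 2 + b ^+ 2 / t)) ->
  l = l' /\ sg = sg'.
Proof.
move=> c0 V0 hV he h1 h2.
have Vle n : V n <= 2 * n%:R * `|sg| + 4 * c.
  have /(_ _)/le_trans := hV n 2^-1; have : 0 < (2^-1 : R) <= 1 by rewrite invr_gt0 ltr0n invf_le1 // ler1n.
  move=> /(hV n); rewrite invrK ler_norml => /andP[_ hh] _.
  have : n%:R * sg <= n%:R * `|sg| by rewrite ler_wpM2l // ler_norm.
  by move: hh; move: (n%:R * sg) (V n) => x v; rewrite -mulrA; move: (n%:R * `|sg|) => z; lra.
have ev : \forall n \near \oo, n%:R^-1 * e n <= sg' + 1.
  have /cvgrPdist_lt/(_ 1 ltr01) := he; apply: filterS => n; rewrite ltr_norml; lra.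
have ll : l = l'.
  apply/eqP; rewrite -subr_eq0 -sqrf_eq0; apply/eqP.
  pose A := 2 * (sg' + 1) + 8 * `|sg| + 16 * c + 4 * b ^+ 2.
  have : \forall n \near \oo, (l - l') ^+ 2 <= n%:R^-1 * A.
    near=> n.
    have n0 : (0 < n)%N by near: n; exact: nbhs_infty_gt.
    have hn : n%:R^-1 * e n <= sg' + 1 by near: n; exact: ev.
    have np : 0 < n%:R :> R by rewrite ltr0n.
    have n1 : 1 <= n%:R :> R by rewrite ler1n.
    have := h1 n; have := Vle n; rewrite exprMn.
    move: hn; rewrite ler_pdivrMl // => hn hv hh.
    have sn : (l - l') ^+ 2 * n%:R <= A.
      rewrite -(ler_pM2l np) /A.
      have b0 := sqr_ge0 b.
      have q1 : c <= n%:R * c by rewrite ler_peMl.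
      have q2 : b ^+ 2 <= n%:R * b ^+ 2 by rewrite ler_peMl.
      move: hn hv hh q1 q2; rewrite expr2.
      move: ((l - l') ^+ 2) (V n) (e n) (b ^+ 2) `|sg| (n%:R) => D v en bb ag m.
      by rewrite -!mulrA ![m * _]mulrC; move: (sg') => sgg; lra.
    by rewrite -ler_pdivrMl ?invr_gt0 // invrK mulrC.
  move=> hA; apply/eqP; rewrite eq_le sqr_ge0 andbT.
  apply/ler_addgt0Pl => t t0; rewrite addr0.
  have : \forall n \near \oo, (l - l') ^+ 2 <= n%:R^-1 * A /\ n%:R^-1 * A <= t.
    near=> n; split; first by near: n.
    have n0 : (0 < n)%N by near: n; exact: nbhs_infty_gt.
    rewrite ler_pdivrMl ?ltr0n // -ler_pdivrMr //.
    apply: (@le_trans _ _ `|A / t|); first exact: ler_norm.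
    apply: le_trans (ltW (archi_boundP (normr_ge0 _))) _.
    by rewrite ler_nat; near: n; exact: nbhs_infty_ge.
  by move=> [N _ /(_ N (leqnn N))][u v]; exact: le_trans u v.
split=> //; apply: (@eq_of_all_eps _ _ (4 * `|sg|)) => t /andP[t0 t1].
have t01 : 0 < t <= 1 by rewrite t0.
have hh := h2 ll.
pose B := 8 * t * c + c / t + (b ^+ 2 + b ^+ 2 / t).
have key n : (0 < n)%N -> `|n%:R^-1 * e n - sg| <= 4 * `|sg| * t + n%:R^-1 * B.
  move=> n0; have np : 0 < n%:R :> R by rewrite ltr0n.
  rewrite -(ler_pM2l np) -[X in X * `|_|](gtr0_norm np) -normrM mulrBr mulrA mulfV ?gt_eqF // mul1r.
  rewrite mulrDr [n%:R * (_^-1 * _)]mulrA mulfV ?gt_eqF // mul1r.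
  have a1 := hV n t t01; have a2 := hh n t t01.
  have -> : e n - n%:R * sg = (e n - V n) + (V n - n%:R * sg) by ring.
  apply: le_trans (ler_normD _ _) _; apply: le_trans (lerD a2 a1) _.
  have := ler_wpM2l (ltW t0) (Vle n); rewrite /B.
  move: (c / t) (b ^+ 2 / t) (V n) => ct bt v.
  have -> : t * (2 * n%:R * `|sg| + 4 * c) = 2 * (n%:R * (`|sg| * t)) + 4 * (t * c) by ring.
  have -> : n%:R * (4 * `|sg| * t) = 4 * (n%:R * (`|sg| * t)) by ring.
  by have := mulr_ge0 (ltW t0) c0; rewrite -[8 * t * c]mulrA; lra.
have lim1 : (fun n => `|n%:R^-1 * e n - sg|) @ \oo --> `|sg' - sg|.
  by apply: cvg_norm; apply: cvgB => //; exact: cvg_cst.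
have lim2 : (fun n => 4 * `|sg| * t + n%:R^-1 * B) @ \oo --> 4 * `|sg| * t.
  apply: (@cvg_nat_inv _ _ `|B|) => n n0; rewrite normrM ger0_norm //.
rewrite distrC; apply: (ler_cvg_to lim1 lim2).
by exists 1%N => // n /= n0; exact: key.
Unshelve. all: by end_near. Qed.

End Identify.

(** * Consequences of the hypotheses on the law *)

Section RandomProducts.
Context {R : realType} {d : nat} {disp : measure_display} {Omega : measurableType disp}.
Local Notation MX := (borel 'M[R]_d).
Local Notation VX := (borel 'cV[R]_d).
Variables (P : probability Omega R) (mu : probability MX R) (g : nat -> {RV P >-> MX}).
Hypothesis hd : (0 < d)%N.
Hypothesis g_nonneg : forall n w, nonneg_mx (g n w).
Hypothesis g_iid : iid mu g.
Hypothesis moment : exists2 eta : R, 0 < eta < 1 &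
     ('E_P[fun w => (mx_N (g 0%N w) `^ eta)%R] < +oo)%E.
Hypothesis column_comparability : forall j : 'I_d, exists2 C : R, 1 < C &
     forall a : 'M[R]_d, msupport mu a -> 1 <= col_max a j / col_min a j <= C.

Lemma law_g n (A : set MX) : measurable A -> P (g n @^-1` A) = mu A.
Proof. by move=> mA; case: g_iid => h _; exact: h. Qed.

(** A negative entry would stay negative on a neighbourhood, which has measure 0
    since the random matrices are nonnegative. *)
Lemma support_nonneg a : msupport mu a -> nonneg_mx a.
Proof.
move=> ha i j; rewrite leNgt; apply/negP => aij.
pose U : set 'M[R]_d := (fun b : 'M[R]_d => b i j) @^-1` `]-oo, 0[%classic.
have oU : open U.
  apply: open_comp; last exact: interval_open.
  by move=> b _; exact: coord_continuous.
have Ua : U a by rewrite /U /= in_itv.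
have mU : measurable (U : set MX) by exact: sub_sigma_algebra.
have h0 : (0 < mu U)%E := ha U oU Ua; move: h0; rewrite -(law_g 0 mU).
have -> : g 0%N @^-1` U = set0; last by rewrite measure0 ltxx.
apply/seteqP; split=> // w; rewrite /U /= in_itv /= => h.
by have := g_nonneg 0 w i j; rewrite leNgt h.
Qed.

Lemma exists_good : exists2 C : R, 1 <= C & forall a, msupport mu a -> good C a.
Proof.
have /choice[f hf] : forall j : 'I_d, exists C : R, 1 < C /\
     forall a : 'M[R]_d, msupport mu a -> 1 <= col_max a j / col_min a j <= C.
  by move=> j; case: (column_comparability j) => C h1 h2; exists C.
have f0 j : 0 <= f j by have [h _] := hf j; rewrite ltW // (lt_trans ltr01).
exists (1 + \sum_j f j); first by rewrite lerDl sumr_ge0.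
move=> a ha; have a0 := support_nonneg ha.
move=> i j; have [fj1 /(_ a ha)/andP[h1 h2]] := hf j.
have M0 : 0 <= col_max a j by exact: bigmax_ge_id.
have m0 : 0 < col_min a j.
  rewrite ltNge; apply/negP => m0; have : col_max a j / col_min a j <= 0.
    by rewrite mulr_ge0_le0 // invr_le0.
  by rewrite leNgt (lt_le_trans ltr01 h1).
have mle k : col_min a j <= a k j by exact: bigmin_le_cond.
have leM k : a k j <= col_max a j by exact: (@le_bigmax _ _ _ _ (fun i => a i j) k).
split; first exact: lt_le_trans (mle i).
move=> k; apply: le_trans (leM i) _; move: h2; rewrite ler_pdivrMr // => /le_trans; apply.
apply: ler_pM => //; first exact: ltW.
by rewrite (bigD1 j) //= addrCA lerDl addr_ge0 ?sumr_ge0.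
Qed.

Section WithConstant.
Variable C : R.
Hypothesis C1 : 1 <= C.
Hypothesis suppC : forall a, msupport mu a -> good C a.
Local Notation st := (wstep C : MX -> VX -> VX).
Local Notation walk := (walk g st).

Lemma mu_good : mu (~` [set a : MX | good C a]) = 0%E.
Proof. by apply: support_full; [exact: measurable_good|exact: suppC]. Qed.

Lemma ae_good : {ae P, forall w, forall n, good C (g n w)}.
Proof.
have mN : measurable (~` [set a : MX | good C a]).
  by apply: measurableC; exact: measurable_good.
have : P.-negligible (\bigcup_(n in [set: nat]) g n @^-1` (~` [set a : MX | good C a])).
  apply: negligible_bigcup => n; exists (g n @^-1` (~` [set a : MX | good C a])); split=> //.
    by rewrite -[X in measurable X]setTI; exact: measurable_funPT.
  by rewrite /= law_g // mu_good.
apply: negligibleS => w /= /existsNP[n hn].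
by exists n.
Qed.

Lemma walk_rprod x w n : pcone x -> (forall k, good C (g k w)) ->
  walk x n w = rprod (fun k => g k w) n *m x.
Proof.
move=> hx hg; elim: n => [|n ih] /=; first by rewrite mul1mx.
rewrite ih -mulmxA /wstep tau_id // kap_id // -ih.
by case: n {ih} => [|n] //=; apply: core_cone => //; exact: core_step.
Qed.

Lemma walk_core x n w : (0 < n)%N -> core C (walk x n w).
Proof. by case: n => // n _; exact: core_step. Qed.

Lemma rprod_good w n : (0 < n)%N -> (forall k, good C (g k w)) -> good C (rprod (fun k => g k w) n).
Proof.
move=> n0 hg; case: n n0 => // n _; elim: n => [|n ih]; first by rewrite /= mulmx1.
exact: good_mul (hg _) ih.
Qed.

(** mx_N may fail to be measurable, so the comparison goes through the lower
    integral of its power. *)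
Lemma lsize_integrable : mu.-integrable setT (EFin \o (fun e : MX => lsize C e ^+ 8)).
Proof.
have [eta /andP[eta0 _] hE] := moment.
have [K K0 hK] := lsize_moment C hd eta0.
have l8 (e : MX) : 0 <= lsize C e ^+ 8.
  by rewrite exprn_ge0 // (le_trans _ (lsize_ge1 C e)).
have ml : measurable_fun setT (fun e : MX => lsize C e ^+ 8).
  by apply: measurable_funX; exact: measurable_lsize.
apply/integrableP; split; first exact/measurable_EFinP.
under eq_integral do rewrite gee0_abs ?lee_fin //.
have mE : measurable_fun setT (fun e : MX => (lsize C e ^+ 8)%:E) by exact/measurable_EFinP.
have -> : (\int[mu]_e (lsize C e ^+ 8)%:E = \int[P]_w (lsize C (g 0%N w) ^+ 8)%:E)%E.
  rewrite -[RHS](@ge0_integral_distribution _ _ _ _ _ P (g 0%N) _ mE) //.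
  by apply: eq_measure_integral => A mA _; exact: esym (law_g 0 mA).
have m0 : measurable_fun setT (fun w => K^-1 * lsize C (g 0%N w) ^+ 8).
  apply: measurable_funM; first exact: measurable_cst.
  exact: measurableT_comp ml (measurable_funPT _).
have le : (\int[P]_w (K^-1 * lsize C (g 0%N w) ^+ 8)%:E <= \int[P]_w (mx_N (g 0%N w) `^ eta)%:E)%E.
  apply: ae_le_integral_l.
  - exact/measurable_EFinP.
  - by move=> w; rewrite lee_fin mulr_ge0 // invr_ge0 ltW.
  - by move=> w; rewrite lee_fin powR_ge0.
  - by apply: filterS ae_good => w hg; rewrite lee_fin ler_pdivrMl //; exact: hK.
have -> : (\int[P]_w (lsize C (g 0%N w) ^+ 8)%:E = K%:E * \int[P]_w (K^-1 * lsize C (g 0%N w) ^+ 8)%:E)%E.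
  rewrite -ge0_integralZl //.
  - by apply: eq_integral => w _; rewrite -EFinM mulrA mulfV ?gt_eqF // mul1r.
  - exact/measurable_EFinP.
  - by move=> w _; rewrite lee_fin mulr_ge0 // invr_ge0 ltW.
  - by rewrite lee_fin ltW.
rewrite lte_mul_pinfty ?lee_fin ?(ltW K0) //.
by apply: le_lt_trans le _; move: hE; rewrite unlock.
Qed.

End WithConstant.
End RandomProducts.

(** * Estimates for real and complex test functions *)

Section Estimate.
Context {R : realType} {d : nat} {disp : measure_display} {Omega : measurableType disp}.
Local Notation MX := (borel 'M[R]_d).
Local Notation VX := (borel 'cV[R]_d).
Variables (P : probability Omega R) (mu : probability MX R) (g : nat -> {RV P >-> MX}).
Hypothesis hd : (0 < d)%N.
Hypothesis g_iid : iid mu g.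
Variable C : R.
Hypothesis C1 : 1 <= C.
Hypothesis aeg : {ae P, forall w, forall n, good C (g n w)}.
Hypothesis iell : mu.-integrable setT (EFin \o (fun e : MX => lsize C e ^+ 8)).
Local Notation st := (wstep C : MX -> VX -> VX).
Local Notation walk := (walk g st).
Local Notation s := (@slog R d : VX -> R).
Local Notation Pn := (Pn mu st).
Local Notation adm := (adm s).

Let mst : measurable_fun setT (fun p : VX * MX => st p.2 p.1) := measurable_wstep C.
Let ms : measurable_fun setT s := @measurable_slog R d.
Let mell : measurable_fun setT (lsize C : MX -> R) := measurable_lsize C.
Let ell1 := @lsize_ge1 R d C : forall e : MX, 1 <= lsize C e.
Let ss : forall (e : MX) (v : VX), `|s (st e v) - s v| <= lsize C e := slog_incr hd C1.

Let PD := PnD mst mell ell1 iell ss.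
Let PZ := PnZ mst mell ell1 iell ss.
Let PB := PnB mst mell ell1 iell ss.
Let PDx n F G (aF : adm F) (aG : adm G) x :
  Pn n (fun v => F v + G v) x = Pn n F x + Pn n G x.
Proof. by rewrite PD. Qed.
Let PBx n F G (aF : adm F) (aG : adm G) x :
  Pn n (fun v => F v - G v) x = Pn n F x - Pn n G x.
Proof. by rewrite PB. Qed.
Let PZx n c F (aF : adm F) x : Pn n (fun v => c * F v) x = c * Pn n F x.
Proof. by rewrite PZ. Qed.
Let PCx n c x : Pn n (fun=> c) x = c.
Proof. by rewrite Pn_cst. Qed.
Let Ple := Pn_le mst mell ell1 iell ss.
Let Pnorm := Pn_norm mst mell ell1 iell ss.
Let lnk x n := link_real g_iid mst mell ell1 iell ss x n.

Definition elog (v : 'cV[R]_d) : R := ln (enorm (kap v)).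

Lemma elog_slog v : `|elog v - slog v| <= ln d%:R.
Proof.
have hv := cone_kap hd v; have [v0 _] := hv.
have e0 := enorm_gt0 hv; have o0 := onorm_gt0 hv.
have d0 : 0 < d%:R :> R by rewrite ltr0n.
have h1 : elog v <= slog v by rewrite ler_ln ?posrE //; exact: enorm_onorm.
have h2 : slog v <= ln d%:R + elog v.
  by rewrite -lnM ?posrE // ler_ln ?posrE ?mulr_gt0 //; exact: onorm_enorm.
rewrite ler_norml; lra.
Qed.

Lemma measurable_elog : measurable_fun setT (elog : VX -> R).
Proof.
apply: measurableT_comp; first exact: measurable_ln.
exact: measurableT_comp (@measurable_enorm R d) (@measurable_kap R d).
Qed.

Lemma adm_sqr_near (h : VX -> R) (a b : R) : measurable_fun setT h ->
  (forall v, `|h v - s v| <= b) -> adm (fun v => (h v - a) ^+ 2).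
Proof.
move=> mh hb; split.
  by apply: measurable_funX; apply: measurable_funB => //; exact: measurable_cst.
exists (2 + 2 * (b + `|a|) ^+ 2); first by rewrite addr_ge0 // mulr_ge0 // sqr_ge0.
move=> v; rewrite ger0_norm ?sqr_ge0 //.
have h1 : `|h v - a| <= `|s v| + (b + `|a|).
  have -> : h v - a = (h v - s v) + (s v - a) by ring.
  apply: le_trans (ler_normD _ _) _; have := hb v; have := ler_normB (s v) a; lra.
have h2 : (h v - a) ^+ 2 <= (`|s v| + (b + `|a|)) ^+ 2.
  by rewrite -real_normK ?num_real // lerXn2r // ?nnegrE // (le_trans _ h1).
apply: (le_trans h2); have -> : s v ^+ 2 = `|s v| ^+ 2 by rewrite real_normK ?num_real.
move: `|s v| (b + `|a|) => p q; have := sqr_ge0 (p - q); have := sqr_ge0 (p * q).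
have := sqr_ge0 p; have := sqr_ge0 q; rewrite !expr2; nra.
Qed.

Lemma link_ge0_ae (F : VX -> R) (X : Omega -> \bar R) x n : adm F -> (forall v, 0 <= F v) ->
  (forall w, 0 <= X w)%E -> {ae P, forall w, X w = (F (walk x n w))%:E} ->
  (\int[P]_w X w = (Pn n F x)%:E)%E.
Proof.
move=> aF F0 X0 h.
rewrite -(link g_iid mst mell ell1 iell ss x n aF F0).
have mF : measurable_fun setT (fun w => (F (walk x n w))%:E).
  apply/measurable_EFinP; apply: measurableT_comp (measurable_walk g mst x n).
  by case: aF.
apply/eqP; rewrite eq_le; apply/andP; split.
  apply: ae_le_integral_r => //; first by move=> w; rewrite lee_fin.
  by apply: filterS h => w ->.
apply: ae_le_integral_l => //; first by move=> w; rewrite lee_fin.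
by apply: filterS h => w ->.
Qed.

(** The logarithms of the Euclidean norm and of the sum of the entries differ by
    at most ln d, which does not affect the growth of second moments. *)
Lemma variance_identified lam lambda sg2 sigma2 (x : 'cV[R]_d) : sphere_pos x ->
  (exists2 c : R, 0 <= c & forall n (delta : R), 0 < delta <= 1 ->
    `|Pn n (fun w => pos s lam n 0 w ^+ 2) x - n%:R * sg2| <=
    delta * Pn n (fun w => pos s lam n 0 w ^+ 2) x + c / delta) ->
  (fun n : nat => ((n%:R^-1)%R%:E *
        'E_P[fun w => ((ln (enorm (rprod (fun k => g k w) n *m x))
                         - n%:R * lambda) ^+ 2)%R])%E)
       @ \oo --> sigma2%:E ->
  lambda = lam /\ sg2 = sigma2.
Proof.
move=> hx [c c0 hc] hs.
have cx := sphere_cone hx.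
pose b := ln d%:R : R.
have b0 : 0 <= b by rewrite ln_ge0 // ler1n.
pose Fe n (v : VX) := (elog v - n%:R * lambda) ^+ 2.
have aFe n : adm (Fe n) by apply: (@adm_sqr_near _ _ b) => //; [exact: measurable_elog|exact: elog_slog].
pose Fv n (v : VX) := pos s lam n 0 v ^+ 2.
have aFv n : adm (Fv n).
  have := @adm_sqr_near s (n%:R * lam) 0 ms; rewrite /Fv /pos.
  move=> h; have -> : (fun v => (s v - n%:R * lam - 0) ^+ 2) = (fun v => (s v - n%:R * lam) ^+ 2).
    by apply/funext => v; rewrite subr0.
  by apply: h => v; rewrite subrr normr0.
have posE n v : pos s lam n 0 v = s v - n%:R * lam by rewrite /pos subr0.
pose e n := Pn n (Fe n) x; pose V n := Pn n (Fv n) x.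
have eE n : ('E_P[fun w => ((ln (enorm (rprod (fun k => g k w) n *m x)) - n%:R * lambda) ^+ 2)%R] = (e n)%:E)%E.
  rewrite unlock; apply: link_ge0_ae => //.
  - by move=> v; exact: sqr_ge0.
  - by move=> w; rewrite lee_fin sqr_ge0.
  - apply: filterS aeg => w hw /=; congr (_%:E); rewrite /Fe /elog kap_id.
      by rewrite (walk_rprod hd C1 n cx hw).
    case: (n) => [|m]; first by [].
    by apply: core_cone => //; exact: core_step.
have he : (fun n => n%:R^-1 * e n) @ \oo --> sigma2.
  move: hs; under eq_fun do rewrite eE -EFinM.
  by move=> /fine_cvg.
apply: (@identify _ e V _ _ _ _ b c) => //.
- move=> n; rewrite /V; have := Ple n (@adm_cst _ _ _ s 0) (aFv n) _ x.
  by rewrite PCx; apply => v; exact: sqr_ge0.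
- move=> n; rewrite /e /V.
  have a1 := admZ 2 (aFe n); have a2 := admZ 4 (aFv n); have a3 := @adm_cst _ _ _ s (4 * b ^+ 2).
  have a12 := admD a1 a2; have a123 := admD a12 a3.
  have := Ple n (@adm_cst _ _ _ s ((n%:R * (lambda - lam)) ^+ 2)) a123 _ x.
  rewrite (PDx n a12 a3) (PDx n a1 a2) (PZx n 2 (aFe n)) (PZx n 4 (aFv n)) !PCx; apply => v.
  rewrite /Fe /Fv posE; have := elog_slog v; rewrite -/b ler_norml => /andP[].
  rewrite mulrBr; move: (elog v) (slog v) (n%:R * lambda) (n%:R * lam) => E S p q h1 h2.
  have : (E - S) ^+ 2 <= b ^+ 2.
    by rewrite -real_normK ?num_real // lerXn2r ?nnegrE // ler_norml h1.
  have := sqr_ge0 ((E - p) + (E - q)); have := sqr_ge0 ((E - S) - (S - q)).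
  rewrite !expr2; nra.
- move=> ll n t /andP[t0 t1]; rewrite /e /V.
  have a1 := admZ t (aFv n); have a2 := @adm_cst _ _ _ s (b ^+ 2 + b ^+ 2 / t).
  have := Pnorm n (admB (aFe n) (aFv n)) (admD a1 a2) _ x.
  rewrite (PDx n a1 a2) (PBx n (aFe n) (aFv n)) (PZx n t (aFv n)) PCx; apply => v.
  rewrite /Fe /Fv posE ll; have := elog_slog v; rewrite -/b.
  move: (elog v) (slog v) (n%:R * lam) => E S p hES.
  have -> : (E - p) ^+ 2 - (S - p) ^+ 2 = (E - S) * ((E - S) + 2 * (S - p)) by ring.
  rewrite normrM; have h2 : `|E - S + 2 * (S - p)| <= b + 2 * `|S - p|.
    by apply: le_trans (ler_normD _ _) _; rewrite normrM ger0_norm // lerD2r.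
  apply: le_trans (ler_pM (normr_ge0 _) (normr_ge0 _) hES h2) _.
  rewrite -[(S - p) ^+ 2]real_normK ?num_real //.
  move: `|S - p| => q.
  have hq : t * (q - b / t) ^+ 2 = t * q ^+ 2 - 2 * b * q + b ^+ 2 / t.
    by field; rewrite gt_eqF.
  have : 0 <= t * (q - b / t) ^+ 2 by rewrite mulr_ge0 ?sqr_ge0 // ltW.
  rewrite hq; lra.
Qed.

Variables (lam sg2 : R).
Hypothesis sg2_gt0 : 0 < sg2.
Hypothesis concentrated : forall c : R, 0 <= c -> exists2 A : R, 0 < A & forall n v y,
  Pn n (ind s lam c n y) v <= A * (Num.sqrt n.+1%:R)^-1.
Hypothesis half_line : exists2 A : R, 0 < A & forall n y v, (0 < n)%N ->
  `|Pn n (fun w => (pos s lam n y w <= 0)%R%:R) v - Phi (- (pos s lam 0 y v / Num.sqrt (sg2 * n%:R)))|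
    <= A * (Num.sqrt n%:R)^-1.
Hypothesis decorrelated : forall q : R, 0 <= q < 1 -> exists2 A : R, 0 < A &
  forall (psi : nat -> VX -> R) (H : R) n y v, (0 < n)%N -> 0 <= H ->
    (forall j, measurable_fun setT (psi j)) ->
    (forall j w, `|psi j w| <= H * q ^+ j) ->
    (forall j w, psi j.+1 w = Pop mu st (psi j) w) ->
    `|Pn n (fun w => psi 0%N w * (pos s lam n y w <= 0)%R%:R) v| <= A * H * (Num.sqrt n%:R)^-1.
Variable nu : probability VX R.
Hypothesis mu_good : mu (~` [set e : MX | good C e]) = 0%E.
Hypothesis nu_stat : stationary mu nu.

Lemma slog_sphere x : sphere_pos x -> `|s x| <= ln d%:R.
Proof.
move=> hx; have /andP[h1 h2] := sphere_onorm hx.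
rewrite /slog kap_id; last exact: sphere_cone.
rewrite ger0_norm ?ln_ge0 // ler_ln ?posrE ?ltr0n //.
exact: lt_le_trans ltr01 h1.
Qed.

(** The thresholds y - c and y + c enclose the event b; the sharp estimate is
    applied at y - c, and concentration bounds what lies in between. *)
Lemma real_estimate (gamma c : R) : 0 < gamma -> 0 <= c -> exists2 A : R, 0 < A &
  forall (f : 'cV[R]_d -> R) H n (x : 'cV[R]_d) y (F : Omega -> R) (b : Omega -> bool),
  (0 < n)%N -> 0 <= H -> {within sphere_pos, continuous f} ->
  (forall x, sphere_pos x -> `|f x| <= H) ->
  (forall x y, sphere_pos x -> sphere_pos y -> x <> y ->
    `|f x - f y| <= H * hilbert_dist x y `^ gamma \/ hilbert_dist x y <= 0) ->
  sphere_pos x ->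
  {ae P, forall w, [/\ F w = hat f (walk x n w),
     (pos s lam n (y - c) (walk x n w) <= 0) ==> b w &
     b w ==> (pos s lam n (y + c) (walk x n w) <= 0)]} ->
  `|\int[P]_w (F w * (b w)%:R) - (\int[nu]_(x in sphere_pos) f x) * Phi (y / Num.sqrt (sg2 * n%:R))|
    <= A * (Num.sqrt n%:R)^-1 * H.
Proof.
move=> gam0 c0.
have [A1 A10 h1] := concentrated c0.
have [A2 A20 h2] := half_line.
pose q := rate C `^ gamma.
have q01 : 0 <= q < 1.
  have /andP[r0 r1] := rate_lt1 C1.
  rewrite /q powR_ge0 /=; have -> : 1 = 1 `^ gamma by rewrite powR1.
  by apply: gt0_ltr_powR; rewrite ?nnegrE.
have [A3 A30 h3] := decorrelated q01.
pose B := 2 * maxdist C `^ gamma.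
have B0 : 0 <= B by rewrite mulr_ge0 ?powR_ge0.
pose D := (c + ln d%:R) * (Num.sqrt sg2)^-1.
have ld0 : 0 <= ln d%:R :> R by rewrite ln_ge0 // ler1n.
have D0 : 0 <= D by rewrite mulr_ge0 ?invr_ge0 ?sqrtr_ge0 // addr_ge0.
exists (A1 + A3 * B + A2 + D).
  by rewrite ltr_wpDr // ltr_wpDr ?(ltW A20) // ltr_wpDr // mulr_ge0 // ltW.
move=> f H n x y F b n0 H0 cf fH fL hx hae.
have mh := measurable_hat hd cf.
have hH v : `|hat f v| <= H by apply: fH; exact: nrm_sphere.
have ah : adm (hat f : VX -> R) by exact: adm_bounded mh hH.
set nf := \int[nu]_(x in sphere_pos) f x.
have decay := psi_decay hd C1 mu_good nu_stat gam0 H0 iell cf fH fL.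
pose lo (v : VX) := pos s lam n (y - c) v <= 0.
pose hi (v : VX) := pos s lam n (y + c) v <= 0.
have mW := measurable_walk g mst x n.
have mbool z : measurable_fun setT (fun w => pos s lam n z (walk x n w) <= 0).
  apply: measurable_fun_ler; last exact: measurable_cst.
  exact: measurableT_comp (measurable_pos ms lam n z) mW.
have mhw : measurable_fun setT (fun w => hat f (walk x n w)) by exact: measurableT_comp mh mW.
have sand := @sandwich _ _ _ P b (fun w => lo (walk x n w)) (fun w => hi (walk x n w))
   (mbool _) (mbool _) (fun w => hat f (walk x n w)) F H mhw (fun w => hH _) hae.
have aind := adm_ind ms lam c n y.
have [iind eind] := lnk x n aind.
set r := (Num.sqrt n%:R)^-1.
have r0 : 0 <= r by rewrite invr_ge0 sqrtr_ge0.
have rle : (Num.sqrt n.+1%:R)^-1 <= r.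
  rewrite lef_pV2 ?posrE ?sqrtr_gt0 ?ltr0n //.
  by rewrite ler_sqrt // ler_nat.
have e1 : \int[P]_w (hi (walk x n w) && ~~ lo (walk x n w))%:R <= A1 * r.
  apply: le_trans (_ : Pn n (ind s lam c n y) x <= _); last first.
    by apply: le_trans (h1 n x y) _; rewrite ler_wpM2l // ltW.
  rewrite -eind; apply: le_Rintegral => //.
    apply: (@bounded_integrable _ _ _ P _ 1) => [|w]; last by case: (_ && _); rewrite ?normr1 ?normr0.
    by apply: measurable_natb; apply: measurable_and; [exact: mbool|apply: measurable_neg; exact: mbool].
  move=> w _; rewrite /ind /hi /lo; case: (boolP (_ && _)) => //= /andP[].
  rewrite -ltNge /pos => u1 u2; rewrite (_ : `|_| <= c) //.
  move: (s (walk x n w) - n%:R * lam) u1 u2 => z; rewrite ler_norml; lra.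
have alo : adm (fun v : VX => (lo v)%:R) := adm_half ms lam n (y - c).
pose Fl (v : VX) := hat f v * (lo v)%:R.
have aFl : adm Fl.
  apply: (@adm_bounded _ _ _ s _ H); first by apply: measurable_funM => //; case: alo.
  move=> v; rewrite normrM -[X in _ <= X]mulr1; apply: ler_pM => //.
  by case: (lo v); rewrite ?normr1 ?normr0.
have [iFl eFl] := lnk x n aFl.
pose psi j (v : VX) := Pn j (hat f) v - nf.
have mpsi j : measurable_fun setT (psi j).
  by apply: measurable_funB; [case: (iter_regular hd C1 mu j cf fH) | exact: measurable_cst].
have bpsi j v : `|psi j v| <= (B * H) * q ^+ j.
  apply: le_trans (decay j v) _.
  by rewrite le_eqVlt; apply/orP; left; apply/eqP; rewrite /B /q; ring.
have spsi j v : psi j.+1 v = Pop mu st (psi j) v.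
  have aj := adm_Pn mst mell ell1 iell ss j ah.
  rewrite /psi (_ : (fun v => Pn j (hat f) v - nf) = (fun v => Pn j (hat f) v - (fun=> nf) v)) //.
  by rewrite (PopB mst ell1 iell ss aj (adm_cst _ _)) Pop_cst.
have h3' := h3 psi (B * H) n (y - c) x n0 (mulr_ge0 B0 H0) mpsi bpsi spsi.
have aps : adm (fun v => psi 0%N v * (lo v)%:R).
  apply: (@adm_bounded _ _ _ s _ (B * H)); first by apply: measurable_funM => //; case: alo.
  move=> v; rewrite normrM -[X in _ <= X]mulr1; apply: ler_pM => //.
    by have := bpsi 0%N v; rewrite expr0 mulr1.
  by case: (lo v); rewrite ?normr1 ?normr0.
have FlE : Pn n Fl x = Pn n (fun v => psi 0%N v * (lo v)%:R) x + nf * Pn n (fun v => (lo v)%:R) x.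
  rewrite -(PZx n nf alo) -(PDx n aps (admZ nf alo)).
  by congr (Pn n _ x); apply/funext => v; rewrite /Fl /psi /=; ring.
have nfH : `|nf| <= H.
  have h : `|nf - 0| <= H; last by rewrite subr0 in h.
  have mS := @measurable_sphere R d; have nuS : nu sphere_pos = 1%E by case: nu_stat.
  have iG : nu.-integrable sphere_pos (EFin \o (hat f : VX -> R)).
    by apply: (integrableS measurableT) => //; exact: bounded_integrable mh hH.
  have nfE : nf = \int[nu]_(x in sphere_pos) hat f x.
    by apply: eq_Rintegral => v /set_mem hv; rewrite hat_sphere.
  rewrite subr0 nfE; apply: le_trans (le_normr_Rintegral mS iG) _.
  have -> : H = \int[nu]_(x in sphere_pos) H.
    by rewrite Rintegral_cst // [X in fine X]nuS mulr1.
  apply: le_Rintegral => //.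
    by have := integrable_norm iG; apply: eq_integrable.
  by apply: (integrableS measurableT) => //; exact: finite_measure_integrable_cst.
have h2' := h2 n (y - c) x n0.
have nn0 : 0 < n%:R :> R by rewrite ltr0n.
have sE : (Num.sqrt (sg2 * n%:R))^-1 = (Num.sqrt sg2)^-1 * r.
  by rewrite sqrtrM ?(ltW sg2_gt0) // invfM.
have hPhi : `|Phi (- (pos s lam 0 (y - c) x / Num.sqrt (sg2 * n%:R))) - Phi (y / Num.sqrt (sg2 * n%:R))| <= D * r.
  apply: le_trans (Phi_lipschitz _ _) _.
  rewrite -mulNr -mulrBl normrM sE /D.
  rewrite [X in _ * X]ger0_norm; last by rewrite mulr_ge0 // invr_ge0 sqrtr_ge0.
  rewrite -[X in _ <= X]mulrA ler_wpM2r ?mulr_ge0 ?invr_ge0 ?sqrtr_ge0 //.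
  have := slog_sphere hx; rewrite /pos mul0r.
  by move: (s x) => z; rewrite !ler_norml => /andP[u1 u2]; lra.
have sand' := le_trans sand (ler_wpM2l H0 e1).
have {}sand' : `|\int[P]_w (F w * (b w)%:R) - \int[P]_w Fl (walk x n w)| <= H * (A1 * r) := sand'.
rewrite eFl FlE in sand'.
rewrite -/r in h2' h3' *.
set p2 := Phi (y / _) in hPhi *; set p1 := Phi (- _) in hPhi h2'.
move: sand' h2' h3' hPhi nfH.
move: (\int[P]_w _) (Pn n (fun v => psi 0%N v * (lo v)%:R) x) (Pn n (fun v => (lo v)%:R) x).
move: p1 p2 => p1 p2 I U L hI hL hU hp hn.
have -> : I - nf * p2 = (I - (U + nf * L)) + U + nf * (L - p1) + nf * (p1 - p2) by ring.
have t1 : `|nf * (L - p1)| <= H * (A2 * r) by rewrite normrM; exact: ler_pM.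
have t2 : `|nf * (p1 - p2)| <= H * (D * r) by rewrite normrM; exact: ler_pM.
apply: le_trans (ler_normD _ _) _; apply: le_trans (lerD (ler_normD _ _) (lexx _)) _.
apply: le_trans (lerD (lerD (ler_normD _ _) (lexx _)) (lexx _)) _.
have -> : (A1 + A3 * B + A2 + D) * r * H = H * (A1 * r) + A3 * (B * H) * r + H * (A2 * r) + H * (D * r).
  by ring.
exact: lerD (lerD (lerD hI hU) t1) t2.
Qed.

End Estimate.
Local Open Scope complex_scope.

Section ComplexValues.
Context {R : realType}.

Lemma Re_le_normc (z : R[i]) : `|complex.Re z| <= normc z.
Proof.
case: z => a b /=; rewrite -sqrtr_sqr ler_sqrt ?addr_ge0 ?sqr_ge0 //.
by rewrite lerDl sqr_ge0.
Qed.

Lemma Im_le_normc (z : R[i]) : `|complex.Im z| <= normc z.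
Proof.
case: z => a b /=; rewrite -sqrtr_sqr ler_sqrt ?addr_ge0 ?sqr_ge0 //.
by rewrite lerDr sqr_ge0.
Qed.

Lemma normc_le_parts (a b : R) : normc (a +i* b) <= `|a| + `|b|.
Proof.
rewrite /normc -[X in _ <= X]ger0_norm ?addr_ge0 // -sqrtr_sqr ler_sqrt ?sqr_ge0 //.
rewrite -[a ^+ 2]real_normK ?num_real // -[b ^+ 2]real_normK ?num_real //.
have := mulr_ge0 (normr_ge0 a) (normr_ge0 b); move: `|a| `|b| => p q.
by rewrite sqrrD; lra.
Qed.

Lemma lipschitz_part_continuous (part : R[i]^o -> R) :
  (forall z z', `|part z - part z'| <= normc (z - z')) -> continuous part.
Proof.
move=> h z; apply/(@cvgrPdist_lt _ _ _ (nbhs z)) => e e0.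
have e0' : (0 : R[i]) < real_complex R e by rewrite ltcR.
have : \forall z' \near z, `|z - z'| < real_complex R e.
  by apply: (@cvgr_dist_lt _ _ _ (nbhs z) _ id z).
apply: filterS => z' hz; apply: le_lt_trans (h _ _) _.
by rewrite -ltcR.
Qed.

Lemma Re_continuous : continuous (@complex.Re R : R[i]^o -> R).
Proof.
apply: lipschitz_part_continuous => z z'.
by apply: le_trans (Re_le_normc (z - z')); case: z => a b; case: z'.
Qed.

Lemma Im_continuous : continuous (@complex.Im R : R[i]^o -> R).
Proof.
apply: lipschitz_part_continuous => z z'.
by apply: le_trans (Im_le_normc (z - z')); case: z => a b; case: z'.
Qed.

Lemma ln_near (a b M : R) : 0 < b -> 1 <= M -> b / M <= a -> a <= M * b -> `|ln a - ln b| <= ln M.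
Proof.
move=> b0 M1 h1 h2.
have M0 : 0 < M by exact: lt_le_trans M1.
have a0 : 0 < a by apply: lt_le_trans h1; rewrite divr_gt0.
have : ln (b / M) <= ln a by rewrite ler_ln ?posrE ?divr_gt0.
have : ln a <= ln (M * b) by rewrite ler_ln ?posrE ?mulr_gt0.
rewrite !lnM ?posrE ?invr_gt0 // lnV ?posrE // ler_norml; lra.
Qed.

End ComplexValues.

Section HolderNorm.
Context {R : realType} {d : nat}.
Hypothesis hd : (2 <= d)%N.
Variables (gamma : R) (phi : 'cV[R]_d -> R[i]).
Hypothesis hphi : holder_space gamma phi.

Lemma holder_fine : exists2 H : R, 0 <= H & [/\ holder_norm gamma phi = H%:E,
  forall x, sphere_pos x -> normc (phi x) <= H &
  forall x y, sphere_pos x -> sphere_pos y -> x <> y ->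
    normc (phi x - phi y) <= H * hilbert_dist x y `^ gamma \/ hilbert_dist x y <= 0].
Proof.
have [_ hfin] := hphi; move: hfin; rewrite /holder_norm.
set S1 := ereal_sup _; set S2 := ereal_sup _.
pose i0 : 'I_d := Ordinal (ltnW hd); pose i1 : 'I_d := Ordinal hd.
have s0 := basis_sphere i0 (R := R); have s1 := basis_sphere i1 (R := R).
have ne : basis_vec i0 (R := R) <> basis_vec i1.
  by move=> /colP/(_ i0); rewrite !mxE eqxx /= => /eqP; rewrite oner_eq0.
have u1 x : sphere_pos x -> ((normc (phi x))%:E <= S1)%E.
  by move=> hx; apply: ereal_sup_ubound; exists x.
have u2 x y : sphere_pos x -> sphere_pos y -> x <> y ->
    ((normc (phi x - phi y) / (hilbert_dist x y `^ gamma))%:E <= S2)%E.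
  by move=> hx hy xy; apply: ereal_sup_ubound; exists (x, y).
have p1 : (0 <= S1)%E by apply: le_trans (u1 _ s0); rewrite lee_fin normc_ge0.
have p2 : (0 <= S2)%E.
  by apply: le_trans (u2 _ _ s0 s1 ne); rewrite lee_fin divr_ge0 ?normc_ge0 ?powR_ge0.
move=> hfin.
have f1 : S1 \is a fin_num by rewrite ge0_fin_numE // (le_lt_trans _ hfin) // leeDl.
have f2 : S2 \is a fin_num by rewrite ge0_fin_numE // (le_lt_trans _ hfin) // leeDr.
move: S1 S2 f1 f2 u1 u2 p1 p2 {hfin} => [a| |] // [b| |] // _ _ u1 u2.
rewrite !lee_fin => a0 b0; exists (a + b); first exact: addr_ge0.
split=> // [x /u1|x y hx hy xy].
  by rewrite lee_fin => /le_trans; apply; rewrite lerDl.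
have [h|h] := leP (hilbert_dist x y) 0; first by right.
left; have := u2 _ _ hx hy xy; rewrite lee_fin ler_pdivrMr ?powR_gt0 // => /le_trans; apply.
by rewrite ler_wpM2r ?powR_ge0 // lerDr.
Qed.

End HolderNorm.

Section ComplexEstimate.
Context {R : realType} {d : nat} {disp : measure_display} {Omega : measurableType disp}.
Local Notation MX := (borel 'M[R]_d).
Local Notation VX := (borel 'cV[R]_d).
Variables (P : probability Omega R) (mu : probability MX R) (g : nat -> {RV P >-> MX}).
Variables (nu : probability VX R) (C lam sg2 gamma c : R).
Hypothesis hd : (2 <= d)%N.
Hypothesis C1 : 1 <= C.
Hypothesis sg2_gt0 : 0 < sg2.
Hypothesis aeg : {ae P, forall w, forall n, good C (g n w)}.
Local Notation st := (wstep C : MX -> VX -> VX).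
Local Notation walk := (walk g st).
Local Notation s := (@slog R d : VX -> R).
Hypothesis real_est : exists2 A : R, 0 < A &
  forall (f : 'cV[R]_d -> R) H n (x : 'cV[R]_d) y (F : Omega -> R) (b : Omega -> bool),
  (0 < n)%N -> 0 <= H -> {within sphere_pos, continuous f} ->
  (forall x, sphere_pos x -> `|f x| <= H) ->
  (forall x y, sphere_pos x -> sphere_pos y -> x <> y ->
    `|f x - f y| <= H * hilbert_dist x y `^ gamma \/ hilbert_dist x y <= 0) ->
  sphere_pos x ->
  {ae P, forall w, [/\ F w = hat f (walk x n w),
     (pos s lam n (y - c) (walk x n w) <= 0) ==> b w &
     b w ==> (pos s lam n (y + c) (walk x n w) <= 0)]} ->
  `|\int[P]_w (F w * (b w)%:R) - (\int[nu]_(x in sphere_pos) f x) * Phi (y / Num.sqrt (sg2 * n%:R))|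
    <= A * (Num.sqrt n%:R)^-1 * H.

Let hd0 : (0 < d)%N. Proof. exact: ltnW. Qed.

Lemma complex_estimate : exists2 A : R, 0 < A &
  forall (n : nat) (phi : 'cV[R]_d -> R[i]) (x : 'cV[R]_d) (y : R) (L : Omega -> R),
  (1 <= n)%N -> holder_space gamma phi -> sphere_pos x ->
  {ae P, forall w, `|L w - slog (walk x n w)| <= c} ->
  ((normc (cintegral P setT (fun w => phi (act (rprod (fun k => g k w) n) x) *
                  ((L w - n%:R * lam) / (Num.sqrt sg2 * Num.sqrt n%:R) <= y)%R%:R)
          - cintegral nu sphere_pos phi * (Phi y)%:C))%:E
    <= (A / Num.sqrt n%:R)%:E * holder_norm gamma phi)%E.
Proof.
have [A A0 hA] := real_est.
exists (2 * A); first by rewrite mulr_gt0.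
move=> n phi x y L n1 hphi hx hL.
have [H H0 [-> bd lip]] := holder_fine hd hphi; have [cphi _] := hphi.
have cx := sphere_cone hx.
have np : 0 < n%:R :> R by rewrite ltr0n.
have sq0 : 0 < Num.sqrt sg2 * Num.sqrt n%:R by rewrite mulr_gt0 // sqrtr_gt0.
pose y' := y * (Num.sqrt sg2 * Num.sqrt n%:R).
have yE : y' / Num.sqrt (sg2 * n%:R) = y.
  by rewrite sqrtrM ?(ltW sg2_gt0) // /y' mulfK // gt_eqF.
pose b w := (L w - n%:R * lam) / (Num.sqrt sg2 * Num.sqrt n%:R) <= y.
have ae (part : R[i] -> R) : {ae P, forall w,
    [/\ part (phi (act (rprod (fun k => g k w) n) x)) = hat (part \o phi) (walk x n w),
     (pos s lam n (y' - c) (walk x n w) <= 0) ==> b w &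
     b w ==> (pos s lam n (y' + c) (walk x n w) <= 0)]}.
  apply: filterS2 aeg hL => w hg hw; split.
  - rewrite /hat /= /nrm kap_id; last by apply: core_cone => //; exact: walk_core.
    by rewrite (walk_rprod hd0 C1 n cx hg).
  - apply/implyP; rewrite /pos /b ler_pdivrMr // -/y'.
    by move: hw; move: (slog _) => z; rewrite ler_norml; lra.
  - apply/implyP; rewrite /pos /b ler_pdivrMr // -/y'.
    by move: hw; move: (slog _) => z; rewrite ler_norml; lra.
have est (part : R[i] -> R) : continuous (part : R[i]^o -> R) ->
    (forall z, `|part z| <= normc z) -> {morph part : z z' / z - z'} ->
    `|\int[P]_w (part (phi (act (rprod (fun k => g k w) n) x)) * (b w)%:R)
      - (\int[nu]_(x in sphere_pos) part (phi x)) * Phi y| <= A * (Num.sqrt n%:R)^-1 * H.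
  move=> cp pn pB.
  have := hA (part \o phi) H n x y' (fun w => part (phi (act (rprod (fun k => g k w) n) x))) b n1 H0.
  rewrite yE; apply => //.
  - by move=> z; apply: continuous_comp (cphi z) _; exact: cp.
  - by move=> z hz; apply: le_trans (pn _) (bd z hz).
  - move=> z z' hz hz' zz'; case: (lip z z' hz hz' zz') => [h|]; [left|by right].
    by rewrite /= -pB; apply: le_trans (pn _) h.
have e1 := est (@complex.Re R) Re_continuous Re_le_normc (raddfB _).
have e2 := est (@complex.Im R) Im_continuous Im_le_normc (raddfB _).
rewrite -EFinM lee_fin.
have -> : 2 * A / Num.sqrt n%:R * H = A * (Num.sqrt n%:R)^-1 * H + A * (Num.sqrt n%:R)^-1 * H by ring.
have -> : cintegral P setT (fun w => phi (act (rprod (fun k => g k w) n) x) * (b w)%:R)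
    - cintegral nu sphere_pos phi * (Phi y)%:C =
    (\int[P]_w (complex.Re (phi (act (rprod (fun k => g k w) n) x)) * (b w)%:R)
      - (\int[nu]_(x in sphere_pos) complex.Re (phi x)) * Phi y) +i*
    (\int[P]_w (complex.Im (phi (act (rprod (fun k => g k w) n) x)) * (b w)%:R)
      - (\int[nu]_(x in sphere_pos) complex.Im (phi x)) * Phi y).
  rewrite /cintegral; set r1 := \int[nu]_(x in _) _; set r2 := \int[nu]_(x in _) _.
  have -> : \int[P]_w complex.Re (phi (act (rprod (fun k => g k w) n) x) * (b w)%:R) =
      \int[P]_w (complex.Re (phi (act (rprod (fun k => g k w) n) x)) * (b w)%:R).
    by apply: eq_Rintegral => w _; case: (b w); rewrite ?mulr1 ?mulr0.
  have -> : \int[P]_w complex.Im (phi (act (rprod (fun k => g k w) n) x) * (b w)%:R) =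
      \int[P]_w (complex.Im (phi (act (rprod (fun k => g k w) n) x)) * (b w)%:R).
    by apply: eq_Rintegral => w _; case: (b w); rewrite ?mulr1 ?mulr0.
  by rewrite /real_complex_def; apply/eqP; rewrite eq_complex /= !mulr0 subr0 add0r !eqxx.
by apply: le_trans (normc_le_parts _ _) _; exact: lerD.
Qed.

End ComplexEstimate.

(** * Coefficients and spectral radius *)
Section Sizes.
Context {R : realType} {d : nat}.
Variable C : R.
Hypothesis hd : (0 < d)%N.
Hypothesis C1 : 1 <= C.
Implicit Types (g : 'M[R]_d) (v x : 'cV[R]_d).

Let C0 : 0 < C. Proof. exact: lt_le_trans C1. Qed.
Let dp : 0 < d%:R :> R. Proof. by rewrite ltr0n. Qed.
Let d1 : 1 <= d%:R :> R. Proof. by rewrite ler1n. Qed.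

(** On the core each entry is at least onorm v / (d C), and the weights f sum to
    at least 1. *)
Lemma ln_dotv (f : 'cV[R]_d) v : sphere_pos f -> core C v -> `|ln (dotv f v) - slog v| <= ln (d%:R * C).
Proof.
move=> hf hv; have [f0 _] := hf; have /andP[f1 _] := sphere_onorm hf.
have cv := core_cone hd hv; have [v0 _] := cv; have o0 := onorm_gt0 cv.
have M1 : 1 <= d%:R * C by exact: mulr_ege1.
have M0 : 0 < d%:R * C by rewrite mulr_gt0.
rewrite /slog kap_id //; apply: ln_near => //.
  have low i : onorm v / (d%:R * C) <= v i 0.
    rewrite ler_pdivrMr // /onorm.
    apply: (@le_trans _ _ (\sum_(k < d) C * v i 0)).
      by apply: ler_sum => k _; have [_] := hv k; exact.
    by rewrite sumr_const card_ord -mulr_natl le_eqVlt; apply/orP; left; apply/eqP; ring.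
  apply: (@le_trans _ _ (\sum_i f i 0 * (onorm v / (d%:R * C)))).
    by rewrite -mulr_suml ler_peMl // divr_ge0 // ltW.
  by apply: ler_sum => i _; rewrite ler_wpM2l.
apply: (@le_trans _ _ (onorm v)); last by rewrite ler_peMl // ltW.
by apply: ler_sum => i _; rewrite ler_piMl //; exact: sphere_entry.
Qed.

(** Between the trace and the sum of all entries, the spectral radius of a
    matrix with comparable columns is of the order of each of them. *)
Lemma ln_spectral_radius g x k : good C g -> sphere_pos x -> 0 < k -> (forall i, k <= x i 0) ->
  `|ln (spectral_radius g) - slog (g *m x)| <= ln (d%:R ^+ 2 * C + k^-1).
Proof.
move=> hg hx k0 kx; have g0 := good_ge0 hg; have cx := sphere_cone hx; have [x0 _] := cx.
have cv := core_mul hg cx; have o0 := onorm_gt0 (core_cone hd cv).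
have [up low] := spectral_radius_bounds hd g0.
have tr : \sum_j csum g j <= d%:R * C * \tr g.
  rewrite /mxtrace mulr_sumr; apply: ler_sum => j _.
  apply: (@le_trans _ _ (\sum_(i < d) C * g j j)).
    by apply: ler_sum => i _; have [_] := hg i j; exact.
  by rewrite sumr_const card_ord -[X in X <= _]mulr_natl mulrA.
have SE : \sum_i \sum_j g i j = \sum_j csum g j by rewrite exchange_big.
have oE : onorm (g *m x) = \sum_j csum g j * x j 0 by rewrite onorm_mul.
have c0 j : 0 <= csum g j by exact: sumr_ge0.
set S := \sum_j csum g j in tr SE.
have h1 : onorm (g *m x) <= S.
  by rewrite oE; apply: ler_sum => j _; rewrite ler_piMr //; exact: sphere_entry.
have h2 : k * S <= onorm (g *m x).
  by rewrite oE mulr_sumr; apply: ler_sum => j _; rewrite mulrC ler_wpM2l.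
have S0 : 0 < S by exact: lt_le_trans h1.
have D1 : 1 <= d%:R ^+ 2 * C by apply: mulr_ege1 => //; rewrite exprn_ege1.
have ki : 0 < k^-1 by rewrite invr_gt0.
set M := d%:R ^+ 2 * C + k^-1.
have M1 : 1 <= M by rewrite /M; move: D1 ki; move: (_ * C) (k^-1) => u v; lra.
have M0 : 0 < M by exact: lt_le_trans M1.
rewrite SE in up.
rewrite /slog kap_id; last exact: core_cone.
apply: ln_near => //.
  rewrite ler_pdivrMr //; apply: (le_trans h1); apply: (le_trans tr).
  have C0' := ltW C0; have dC : 0 <= d%:R * C by rewrite mulr_ge0 // ltW.
  apply: (le_trans (ler_wpM2l dC low)).
  have r0 : 0 <= spectral_radius g.
    rewrite -(ler_pM2l dp) mulr0; apply: le_trans low; apply: sumr_ge0 => i _; exact: g0.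
  have -> : d%:R * C * (d%:R * spectral_radius g) = spectral_radius g * (d%:R ^+ 2 * C) by ring.
  by rewrite ler_wpM2l // lerDl ltW.
apply: (le_trans up); apply: (@le_trans _ _ (k^-1 * onorm (g *m x))).
  by rewrite ler_pdivlMl // mulrC.
by rewrite ler_wpM2r ?(ltW o0) // lerDr (le_trans _ D1).
Qed.

End Sizes.

Theorem theorem2p2
  (R : realType) (d : nat) (hd : (2 <= d)%N)
  (* the sequence is indexed from 0: rprod (fun k => g k w) n is G_n *)
  (disp : measure_display) (Omega : measurableType disp)
  (P : probability Omega R)
  (mu : probability (borel 'M[R]_d) R)
  (g : nat -> {RV P >-> borel 'M[R]_d})
  (g_nonneg : forall n w, nonneg_mx (g n w))
  (g_iid : iid mu g)
  (moment : exists2 eta : R, 0 < eta < 1 &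
     ('E_P[fun w => (mx_N (g 0%N w) `^ eta)%R] < +oo)%E)
  (column_comparability : forall j : 'I_d, exists2 C : R, 1 < C &
     forall a : 'M[R]_d, msupport mu a -> 1 <= col_max a j / col_min a j <= C)
  (nu : probability (borel 'cV[R]_d) R)
  (nu_stationary : stationary mu nu)
  (lambda : R)
  (lambda_lyapunov : {ae P, forall w,
     (fun n : nat => n%:R^-1 * ln (mx_norm_pos (rprod (fun k => g k w) n)))
       @ \oo --> lambda})
  (sigma2 : R)
  (sigma2_variance : forall x : 'cV[R]_d, sphere_pos x ->
     (fun n : nat => ((n%:R^-1)%R%:E *
        'E_P[fun w => ((ln (enorm (rprod (fun k => g k w) n *m x))
                         - n%:R * lambda) ^+ 2)%R])%E)
       @ \oo --> sigma2%:E)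
  (sigma2_gt0 : 0 < sigma2) :
  exists2 gamma0 : R, 0 < gamma0 & forall gamma : R, 0 < gamma <= gamma0 ->
    (exists2 C : R, 0 < C &
       forall (n : nat) (phi : 'cV[R]_d -> R[i]), (1 <= n)%N ->
         holder_space gamma phi ->
         (ereal_sup [set ereal_sup
            [set (normc
               (cintegral P setT (fun w =>
                  phi (act (rprod (fun k => g k w) n) fx.2) *
                  ((ln (dotv fx.1 (rprod (fun k => g k w) n *m fx.2))
                      - n%:R * lambda)
                     / (Num.sqrt sigma2 * Num.sqrt n%:R) <= y)%R%:R)
                - cintegral nu sphere_pos phi * (Phi y)%:C))%:E
            | fx in sphere_pos `*` sphere_pos] | y in [set: R]]
          <= (C / Num.sqrt n%:R)%:E * holder_norm gamma phi)%E) /\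
    (forall K : set 'cV[R]_d, compact K -> K `<=` sphere_pos_int ->
       exists2 C : R, 0 < C &
       forall (n : nat) (phi : 'cV[R]_d -> R[i]), (1 <= n)%N ->
         holder_space gamma phi ->
         (ereal_sup [set ereal_sup
            [set (normc
               (cintegral P setT (fun w =>
                  phi (act (rprod (fun k => g k w) n) x) *
                  ((ln (spectral_radius (rprod (fun k => g k w) n))
                      - n%:R * lambda)
                     / (Num.sqrt sigma2 * Num.sqrt n%:R) <= y)%R%:R)
                - cintegral nu sphere_pos phi * (Phi y)%:C))%:E
            | x in K] | y in [set: R]]
          <= (C / Num.sqrt n%:R)%:E * holder_norm gamma phi)%E).
Proof.
have hd0 : (0 < d)%N by exact: ltnW.
have [C C1 suppC] := exists_good g_nonneg g_iid column_comparability.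
have aeg := ae_good g_iid suppC.
have mug := mu_good suppC.
have iell := lsize_integrable hd0 g_iid moment suppC.
have [lam [sg2 [hvar hclt]]] := @contracting_cocycle_clt _ _ _ _ _ mu _ _ _ (measurable_wstep C)
  (@measurable_slog R d) (measurable_lsize C) (@lsize_ge1 R d C) iell (slog_incr hd0 C1)
  _ _ _ (pdist_ge0 C) (pdist_le C) (rate_lt1 C1) (pdist_step hd0 C1) (slog_lip hd0 C1) 0.
pose x0 : 'cV[R]_d := basis_vec (Ordinal hd0).
have hx0 : sphere_pos x0 := basis_sphere _.
have [elam esg] := variance_identified hd0 g_iid C1 aeg iell hx0 (hvar x0) (sigma2_variance x0 hx0).
have sg0 : 0 < sg2 by rewrite esg.
have [p1 p2 p3] := hclt sg0.
have real c gamma : 0 <= c -> 0 < gamma -> _ := fun c0 gam0 =>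
  real_estimate hd0 g_iid C1 iell sg0 p1 p2 p3 mug nu_stationary gam0 c0.
have main c gamma : 0 <= c -> 0 < gamma -> _ := fun c0 gam0 =>
  complex_estimate hd C1 sg0 aeg (real c gamma c0 gam0).
rewrite elam -esg.
exists 1 => // gamma /andP[gam0 _]; split.
  have c0 : 0 <= ln (d%:R * C) by rewrite ln_ge0 // mulr_ege1 // ler1n.
  have [A A0 hA] := main _ gamma c0 gam0.
  exists A => // n phi n1 hphi; apply: ge_ereal_sup => _ [y _ <-].
  apply: ge_ereal_sup => _ [fx [hf hx] <-]; apply: hA => //.
  apply: filterS aeg => w hw.
  rewrite -(walk_rprod hd0 C1 n (sphere_cone hx) hw).
  by apply: ln_dotv => //; exact: walk_core.
move=> K cK Ki; have [k k0 hk] := compact_interior_lb cK Ki.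
have c0 : 0 <= ln (d%:R ^+ 2 * C + k^-1).
  have d1 : 1 <= d%:R :> R by rewrite ler1n.
  have D1 : 1 <= d%:R ^+ 2 * C by apply: mulr_ege1 => //; rewrite exprn_ege1.
  by rewrite ln_ge0 // (le_trans D1) // lerDl invr_ge0 ltW.
have [A A0 hA] := main _ gamma c0 gam0.
exists A => // n phi n1 hphi; apply: ge_ereal_sup => _ [y _ <-].
apply: ge_ereal_sup => _ [x Kx <-].
have hx : sphere_pos x by have [h1 h2] := Ki x Kx; split=> // i; exact: ltW.
apply: hA => //; apply: filterS aeg => w hw.
rewrite (walk_rprod hd0 C1 n (sphere_cone hx) hw).
by apply: ln_spectral_radius => //; [exact: rprod_good | move=> i; exact: hk].
Qed.
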